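(* Let $A=\mathbb{F}_q[t]$, $F=\mathbb{F}_q(t)$, $n\ge1$ and $r\ge1$. The ring $R_n$ is an integral domain and the natural homomorphism $R_n\to RS_n$ is injective.
   Context: $\mathbb{F}_q$ is a finite field with $q$ elements, $A=\mathbb{F}_q[t]$, $F=\mathbb{F}_q(t)$. For $0\le\nu\le n$ put $V_\nu=(t^{-\nu}A/A)^{\oplus r}$, so $V_0=0$ and $V_\nu\subset V_n$ is the $t^\nu$-torsion submodule. For a finite dimensional $\mathbb{F}_q$-vector space $V$ let $K_V$ be the field of quotients of the symmetric algebra of $V$ over $\mathbb{F}_q$, and $R_V\subset K_V$ the $\mathbb{F}_q$-subalgebra generated by the elements $\frac1v$ for all $v\in V\setminus\{0\}$. $R_n$ is the factor ring of $R_{V_n}\otimes_{\mathbb{F}_q}F$ by the ideal generated by the elements $\frac{1}{av}\otimes a-\sum_{v'\in V_\nu}\frac{1}{v-v'}\otimes1$ for all $a=\alpha t^\nu$ with $\alpha\in\mathbb{F}_q^\times$, $0\le\nu\le n$, and all $v\in V_n\setminus V_\nu$. $[f]$ denotes the image of $f$ in $R_n$. $RS_n$ is the localization of $R_n$ obtained by inverting $[\frac1v\otimes1]$ for all $v\in V_n\setminus\{0\}$. *)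

(* Defs.v *)
From HB Require Import structures.
From mathcomp Require Import all_boot all_algebra all_field.
From mathcomp Require Import boolp.
From mathcomp Require Import ring zify.
From mathcomp Require Import mpoly.

Set Implicit Arguments.
Unset Strict Implicit.
Unset Printing Implicit Defensive.

Import GRing.Theory.
Local Open Scope ring_scope.
Local Open Scope quotient_scope.

(* The quotient of R by the ideal generated by G.  All rings below are in     *)
(* comPzRingType, where 1 = 0 is allowed: ring_quotient.v only builds ring    *)
(* quotients by proper ideals, and G may generate the unit ideal.             *)
Section QuotientByGenerators.
Variables (R : comPzRingType) (G : R -> Prop).

Definition ideal_gen : {pred R} := fun x =>
  `[< exists2 s : seq (R * R),
      (forall p, p \in s -> G p.2) & x = \sum_(p <- s) p.1 * p.2 >].

Lemma ideal_genP x : reflect (exists2 s : seq (R * R),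
  (forall p, p \in s -> G p.2) & x = \sum_(p <- s) p.1 * p.2) (x \in ideal_gen).
Proof. exact: asboolP. Qed.

Lemma ideal_genM a x : x \in ideal_gen -> a * x \in ideal_gen.
Proof.
case/ideal_genP=> s sG ->; apply/ideal_genP.
exists [seq (a * p.1, p.2) | p <- s].
  by move=> p /mapP[q qs ->]; apply: (sG q).
by rewrite big_map mulr_sumr; apply: eq_bigr => p _; rewrite mulrA.
Qed.

Lemma mem_ideal_gen x : G x -> x \in ideal_gen.
Proof.
move=> Gx; apply/ideal_genP; exists [:: (1, x)].
  by move=> p; rewrite inE => /eqP->.
by rewrite big_seq1 mul1r.
Qed.

Lemma ideal_gen_zmod_closed : zmod_closed ideal_gen.
Proof.
split=> [|x y Ix Iy]; first by apply/ideal_genP; exists [::]; rewrite ?big_nil.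
have := ideal_genM (-1) Iy; rewrite mulN1r; move/ideal_genP: Ix => [s sG ->].
case/ideal_genP=> u uG ->; apply/ideal_genP; exists (s ++ u).
  by move=> p; rewrite mem_cat => /orP[/sG|/uG].
by rewrite big_cat.
Qed.

HB.instance Definition _ :=
  GRing.isZmodClosed.Build R ideal_gen ideal_gen_zmod_closed.

Definition qring := {ideal_quot ideal_gen}.
HB.instance Definition _ := GRing.Zmodule.on qring.
HB.instance Definition _ := EqQuotient.on qring.

Definition qpi (x : R) : qring := \pi_qring x.

Lemma qpi_eq x y : (qpi x == qpi y) = (x - y \in ideal_gen).
Proof. by rewrite /qpi Quotient.idealrBE. Qed.

Lemma qpiK (x : qring) : qpi (repr x) = x.
Proof. exact: reprK. Qed.

Definition qone : qring := qpi 1.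
Definition qmul (x y : qring) : qring := qpi (repr x * repr y).

Lemma qpi_mul x y : qmul (qpi x) (qpi y) = qpi (x * y).
Proof.
apply/eqP; rewrite /qmul qpi_eq.
have rE z : repr (qpi z) - z \in ideal_gen by rewrite -qpi_eq qpiK.
set x' := repr _; set y' := repr _.
have ->: x' * y' - x * y = x' * (y' - y) + y * (x' - x).
  by rewrite !mulrBr [y * x']mulrC [y * x]mulrC addrA subrK.
by rewrite rpredD ?ideal_genM ?rE.
Qed.

Lemma qpiD x y : qpi (x + y) = qpi x + qpi y.
Proof. exact: (raddfD (\pi_{ideal_quot ideal_gen})). Qed.

Lemma qmulA : associative qmul.
Proof.
by move=> x y z; rewrite -[x]qpiK -[y]qpiK -[z]qpiK !qpi_mul mulrA.
Qed.
Lemma qmulC : commutative qmul.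
Proof. by move=> x y; rewrite /qmul mulrC. Qed.
Lemma qmul1 : left_id qone qmul.
Proof. by move=> x; rewrite -[x]qpiK qpi_mul mul1r. Qed.
Lemma qmulDl : left_distributive qmul +%R.
Proof.
move=> x y z; rewrite -[x]qpiK -[y]qpiK -[z]qpiK.
by rewrite -qpiD !qpi_mul mulrDl qpiD.
Qed.

HB.instance Definition _ :=
  GRing.Zmodule_isComPzRing.Build qring qmulA qmulC qmul1 qmulDl.

Lemma qpi_is_zmod_morphism : zmod_morphism qpi.
Proof. exact: (raddfB (\pi_{ideal_quot ideal_gen})). Qed.
HB.instance Definition _ :=
  GRing.isZmodMorphism.Build R qring qpi qpi_is_zmod_morphism.

Lemma qpi_is_monoid_morphism : monoid_morphism qpi.
Proof. by split=> // x y; rewrite -qpi_mul. Qed.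
HB.instance Definition _ :=
  GRing.isMonoidMorphism.Build R qring qpi qpi_is_monoid_morphism.

End QuotientByGenerators.

(* The localization of R at the multiplicative subset generated by G; R may   *)
(* have zero divisors, so that (x, s) ~ (y, t) when u (x t) = u (y s) for     *)
(* some u in this subset.                                                     *)
Section Localization.
Variables (R : comPzRingType) (G : R -> Prop).

Definition mset_gen : pred R := fun x =>
  `[< exists2 s : seq R, (forall y, y \in s -> G y) & x = \prod_(y <- s) y >].

Lemma mset_gen1 : mset_gen 1.
Proof. by apply/asboolP; exists [::]; rewrite ?big_nil. Qed.

Lemma mset_genM x y : mset_gen x -> mset_gen y -> mset_gen (x * y).
Proof.
move=> /asboolP[s sG ->] /asboolP[u uG ->]; apply/asboolP; exists (s ++ u).
  by move=> p; rewrite mem_cat => /orP[/sG|/uG].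
by rewrite big_cat.
Qed.

Lemma mem_mset_gen x : G x -> mset_gen x.
Proof.
move=> Gx; apply/asboolP; exists [:: x]; rewrite ?big_seq1 //.
by move=> y; rewrite inE => /eqP->.
Qed.

Local Notation D := (R * {s : R | mset_gen s})%type.
Implicit Types p q : D.

Definition fracp (x : R) (s : R) (Ss : mset_gen s) : D := (x, exist _ s Ss).
Local Notation num p := p.1.
Local Notation den p := (sval p.2).
Local Notation denP p := (svalP p.2).

Definition loc_equiv : rel D := fun p q =>
  `[< exists2 u, mset_gen u & u * (num p * den q) = u * (num q * den p) >].

Lemma loc_equivP p q : reflect
  (exists2 u, mset_gen u & u * (num p * den q) = u * (num q * den p))
  (loc_equiv p q).
Proof. exact: asboolP. Qed.

Lemma loc_equiv_is_equiv : equiv_class_of loc_equiv.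
Proof.
split=> [p|p q|q p r].
- by apply/loc_equivP; exists 1; rewrite ?mset_gen1.
- by apply/loc_equivP/loc_equivP => -[u Su E]; exists u.
case/loc_equivP=> u Su Eu /loc_equivP[w Sw Ew]; apply/loc_equivP.
exists (u * w * den q); first by rewrite !mset_genM ?(denP q).
have ->: u * w * den q * (num p * den r) = w * den r * (u * (num p * den q)).
  by ring.
have ->: u * w * den q * (num r * den p) = u * den p * (w * (num r * den q)).
  by ring.
by rewrite Eu -Ew; ring.
Qed.

Canonical loc_equiv_equiv := EquivRelPack loc_equiv_is_equiv.
Canonical loc_equiv_encModRel := defaultEncModRel loc_equiv.

Definition loc := {eq_quot loc_equiv}.
HB.instance Definition _ : EqQuotient D loc_equiv loc := EqQuotient.on loc.
HB.instance Definition _ := Choice.on loc.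

Definition lpi (p : D) : loc := \pi_loc p.

Lemma lpi_eq p q : (lpi p == lpi q) = loc_equiv p q.
Proof. by rewrite /lpi eqmodE. Qed.

Lemma lpiK (x : loc) : lpi (repr x) = x. Proof. exact: reprK. Qed.

Lemma lpi_repr p : loc_equiv (repr (lpi p)) p.
Proof. by rewrite -lpi_eq lpiK. Qed.

Definition addD p q : D :=
  fracp (num p * den q + num q * den p) (mset_genM (denP p) (denP q)).
Definition oppD p : D := (- num p, p.2).
Definition mulD p q : D := fracp (num p * num q) (mset_genM (denP p) (denP q)).

Definition ladd (x y : loc) := lpi (addD (repr x) (repr y)).
Definition lopp (x : loc) := lpi (oppD (repr x)).
Definition lmul (x y : loc) := lpi (mulD (repr x) (repr y)).
Definition lzero := lpi (fracp 0 mset_gen1).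
Definition lone := lpi (fracp 1 mset_gen1).

Lemma ladd_pi p q : ladd (lpi p) (lpi q) = lpi (addD p q).
Proof.
apply/eqP; rewrite lpi_eq; apply/loc_equivP.
have /loc_equivP[u Su Eu] := lpi_repr p; have /loc_equivP[w Sw Ew] := lpi_repr q.
move: (repr (lpi p)) (repr (lpi q)) Eu Ew => p' q' Eu Ew.
exists (u * w); rewrite ?mset_genM //=.
transitivity (w * den q * den q' * (u * (num p' * den p))
  + u * den p * den p' * (w * (num q' * den q))); first by ring.
by rewrite Eu Ew; ring.
Qed.

Lemma lopp_pi p : lopp (lpi p) = lpi (oppD p).
Proof.
apply/eqP; rewrite lpi_eq; apply/loc_equivP.
have /loc_equivP[u Su Eu] := lpi_repr p.
by exists u; rewrite //= !mulNr !mulrN Eu.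
Qed.

Lemma lmul_pi p q : lmul (lpi p) (lpi q) = lpi (mulD p q).
Proof.
apply/eqP; rewrite lpi_eq; apply/loc_equivP.
have /loc_equivP[u Su Eu] := lpi_repr p; have /loc_equivP[w Sw Ew] := lpi_repr q.
move: (repr (lpi p)) (repr (lpi q)) Eu Ew => p' q' Eu Ew.
exists (u * w); rewrite ?mset_genM //=.
transitivity ((u * (num p' * den p)) * (w * (num q' * den q))); first by ring.
by rewrite Eu Ew; ring.
Qed.

Lemma eq_lpi p q : num p * den q = num q * den p -> lpi p = lpi q.
Proof.
move=> E; apply/eqP; rewrite lpi_eq; apply/loc_equivP.
by exists 1; rewrite ?mset_gen1 ?E.
Qed.

Lemma laddA : associative ladd.
Proof.
move=> x y z; rewrite -[x]lpiK -[y]lpiK -[z]lpiK !ladd_pi.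
by apply: eq_lpi => /=; ring.
Qed.
Lemma laddC : commutative ladd.
Proof.
by move=> x y; rewrite -[x]lpiK -[y]lpiK !ladd_pi; apply: eq_lpi => /=; ring.
Qed.
Lemma ladd0 : left_id lzero ladd.
Proof. by move=> x; rewrite -[x]lpiK ladd_pi; apply: eq_lpi => /=; ring. Qed.
Lemma laddN : left_inverse lzero lopp ladd.
Proof.
by move=> x; rewrite -[x]lpiK lopp_pi ladd_pi; apply: eq_lpi => /=; ring.
Qed.

HB.instance Definition _ := GRing.isZmodule.Build loc laddA laddC ladd0 laddN.

Lemma lmulA : associative lmul.
Proof.
move=> x y z; rewrite -[x]lpiK -[y]lpiK -[z]lpiK !lmul_pi.
by apply: eq_lpi => /=; ring.
Qed.
Lemma lmulC : commutative lmul.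
Proof.
by move=> x y; rewrite -[x]lpiK -[y]lpiK !lmul_pi; apply: eq_lpi => /=; ring.
Qed.
Lemma lmul1 : left_id lone lmul.
Proof. by move=> x; rewrite -[x]lpiK lmul_pi; apply: eq_lpi => /=; ring. Qed.
Lemma lmulDl : left_distributive lmul +%R.
Proof.
move=> x y z; rewrite -[x]lpiK -[y]lpiK -[z]lpiK.
rewrite [X in lmul X _]ladd_pi !lmul_pi [RHS]ladd_pi.
by apply: eq_lpi => /=; ring.
Qed.

HB.instance Definition _ :=
  GRing.Zmodule_isComPzRing.Build loc lmulA lmulC lmul1 lmulDl.

Lemma lpiD p q : lpi p + lpi q = lpi (addD p q). Proof. exact: ladd_pi. Qed.
Lemma lpiN p : - lpi p = lpi (oppD p). Proof. exact: lopp_pi. Qed.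
Lemma lpiM p q : lpi p * lpi q = lpi (mulD p q). Proof. exact: lmul_pi. Qed.

Definition to_loc (x : R) : loc := lpi (fracp x mset_gen1).

Lemma to_loc_is_zmod_morphism : zmod_morphism to_loc.
Proof.
move=> x y; rewrite /to_loc lpiN lpiD.
by apply: eq_lpi => /=; ring.
Qed.
HB.instance Definition _ :=
  GRing.isZmodMorphism.Build R loc to_loc to_loc_is_zmod_morphism.

Lemma to_loc_is_monoid_morphism : monoid_morphism to_loc.
Proof.
split=> // x y; rewrite /to_loc lpiM.
by apply: eq_lpi => /=; ring.
Qed.
HB.instance Definition _ :=
  GRing.isMonoidMorphism.Build R loc to_loc to_loc_is_monoid_morphism.

Lemma to_loc_eq0 x : to_loc x = 0 <-> exists2 u, mset_gen u & u * x = 0.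
Proof.
split=> [/eqP|[u Su E]].
  rewrite lpi_eq => /loc_equivP[u Su /=]; rewrite mul0r mulr1 mulr0.
  by exists u.
apply/eqP; rewrite lpi_eq; apply/loc_equivP; exists u => //=.
by rewrite mul0r mulr1 mulr0.
Qed.

Lemma to_locV x : G x -> exists y, to_loc x * y = 1.
Proof.
move=> Gx; exists (lpi (fracp 1 (mem_mset_gen Gx))).
by rewrite /to_loc lpiM; apply: eq_lpi => /=; ring.
Qed.

End Localization.

(* The tensor product of two commutative algebras over K: formal sums of      *)
(* pairs, two of them being identified when no bilinear map separates them    *)
(* (equivalently, when one is obtained from the other by the bilinearity      *)
(* relations).                                                                *)
Section TensorProduct.
Variables (K : fieldType) (A B : comAlgType K).

Definition bilin (M : lmodType K) (b : A -> B -> M) : Prop :=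
  (forall y, linear (fun x => b x y)) /\ (forall x, linear (b x)).

Definition tsum (M : lmodType K) (b : A -> B -> M) (s : seq (A * B)) : M :=
  \sum_(p <- s) b p.1 p.2.

Definition tens_equiv : rel (seq (A * B)) := fun s u =>
  `[< forall (M : lmodType K) (b : A -> B -> M), bilin b -> tsum b s = tsum b u >].

Lemma tens_equiv_is_equiv : equiv_class_of tens_equiv.
Proof.
split=> [s|s u|u s w]; first exact/asboolP.
  by apply/asboolP/asboolP => E M b bb; rewrite E.
by move=> /asboolP E1 /asboolP E2; apply/asboolP => M b bb; rewrite E1 ?E2.
Qed.

Canonical tens_equiv_equiv := EquivRelPack tens_equiv_is_equiv.
Canonical tens_equiv_encModRel := defaultEncModRel tens_equiv.

Definition tens := {eq_quot tens_equiv}.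
HB.instance Definition _ : EqQuotient (seq (A * B)) tens_equiv tens :=
  EqQuotient.on tens.
HB.instance Definition _ := Choice.on tens.

Definition tpi (s : seq (A * B)) : tens := \pi_tens s.
Definition tensor (x : A) (y : B) : tens := tpi [:: (x, y)].

Lemma tpiP s u : tpi s = tpi u <->
  forall (M : lmodType K) (b : A -> B -> M), bilin b -> tsum b s = tsum b u.
Proof.
rewrite /tpi; split=> [/eqP|E]; first by rewrite eqmodE => /asboolP.
by apply/eqP; rewrite eqmodE; apply/asboolP.
Qed.

Lemma tpiK (x : tens) : tpi (repr x) = x. Proof. exact: reprK. Qed.

Lemma tsum_repr (M : lmodType K) (b : A -> B -> M) s :
  bilin b -> tsum b (repr (tpi s)) = tsum b s.
Proof. by apply: (tpiP _ _).1; rewrite tpiK. Qed.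

Definition tmul_seq (s u : seq (A * B)) : seq (A * B) :=
  [seq (p.1 * q.1, p.2 * q.2) | p <- s, q <- u].
Definition topp_seq (s : seq (A * B)) : seq (A * B) :=
  [seq (- p.1, p.2) | p <- s].

Definition tadd (x y : tens) := tpi (repr x ++ repr y).
Definition topp (x : tens) := tpi (topp_seq (repr x)).
Definition tmul (x y : tens) := tpi (tmul_seq (repr x) (repr y)).
Definition tzero := tpi [::].
Definition tone := tensor 1 1.

Section Bilinear.
Variables (M : lmodType K) (b : A -> B -> M) (bb : bilin b).

Lemma bilinDl x x' y : b (x + x') y = b x y + b x' y.
Proof. by have := bb.1 y 1 x x'; rewrite !scale1r. Qed.
Lemma bilinDr x y y' : b x (y + y') = b x y + b x y'.
Proof. by have := bb.2 x 1 y y'; rewrite !scale1r. Qed.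
Lemma bilin0l y : b 0 y = 0.
Proof. by apply: (addrI (b 0 y)); rewrite -bilinDl !addr0. Qed.
Lemma bilin0r x : b x 0 = 0.
Proof. by apply: (addrI (b x 0)); rewrite -bilinDr !addr0. Qed.
Lemma bilinNl x y : b (- x) y = - b x y.
Proof. by apply/eqP; rewrite -addr_eq0 -bilinDl addNr bilin0l. Qed.
Lemma bilinZl c x y : b (c *: x) y = c *: b x y.
Proof. by have := bb.1 y c x 0; rewrite bilin0l !addr0. Qed.
Lemma bilinZr c x y : b x (c *: y) = c *: b x y.
Proof. by have := bb.2 x c y 0; rewrite bilin0r !addr0. Qed.

Lemma tsum_cat s u : tsum b (s ++ u) = tsum b s + tsum b u.
Proof. by rewrite /tsum big_cat. Qed.

Lemma tsum_opp s : tsum b (topp_seq s) = - tsum b s.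
Proof.
by rewrite /tsum big_map -sumrN; apply: eq_bigr => p _; rewrite bilinNl.
Qed.

Lemma tsum_mul s u : tsum b (tmul_seq s u) =
  \sum_(p <- s) \sum_(q <- u) b (p.1 * q.1) (p.2 * q.2).
Proof. by rewrite /tsum big_allpairs_dep. Qed.

Lemma bilin_mulr q : bilin (fun x y => b (x * q.1) (y * q.2)).
Proof.
split=> [y|x] c z t; rewrite /= mulrDl -scalerAl.
  by rewrite bilinDl bilinZl.
by rewrite bilinDr bilinZr.
Qed.

Lemma bilin_mull p : bilin (fun x y => b (p.1 * x) (p.2 * y)).
Proof.
split=> [y|x] c z t; rewrite /= mulrDr -scalerAr.
  by rewrite bilinDl bilinZl.
by rewrite bilinDr bilinZr.
Qed.

Lemma tsum_mul_repr s u :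
  tsum b (tmul_seq (repr (tpi s)) (repr (tpi u))) = tsum b (tmul_seq s u).
Proof.
rewrite !tsum_mul.
transitivity (\sum_(p <- repr (tpi s)) \sum_(q <- u) b (p.1 * q.1) (p.2 * q.2)).
  by apply: eq_bigr => p _; exact: (tsum_repr u (bilin_mull p)).
rewrite exchange_big [RHS]exchange_big /=; apply: eq_bigr => q _.
exact: (tsum_repr s (bilin_mulr q)).
Qed.

End Bilinear.

Lemma tadd_pi s u : tadd (tpi s) (tpi u) = tpi (s ++ u).
Proof.
by apply/tpiP => M b bb; rewrite !tsum_cat !tsum_repr.
Qed.
Lemma topp_pi s : topp (tpi s) = tpi (topp_seq s).
Proof. by apply/tpiP => M b bb; rewrite !tsum_opp ?tsum_repr. Qed.
Lemma tmul_pi s u : tmul (tpi s) (tpi u) = tpi (tmul_seq s u).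
Proof. by apply/tpiP => M b bb; rewrite tsum_mul_repr. Qed.

Lemma taddA : associative tadd.
Proof.
by move=> x y z; rewrite -[x]tpiK -[y]tpiK -[z]tpiK !tadd_pi catA.
Qed.
Lemma taddC : commutative tadd.
Proof.
move=> x y; apply/tpiP => M b bb.
by rewrite !tsum_cat addrC.
Qed.
Lemma tadd0 : left_id tzero tadd.
Proof. by move=> x; rewrite -[x]tpiK tadd_pi. Qed.
Lemma taddN : left_inverse tzero topp tadd.
Proof.
move=> x; rewrite -[x]tpiK topp_pi tadd_pi; apply/tpiP => M b bb.
by rewrite tsum_cat tsum_opp // addNr /tsum big_nil.
Qed.

HB.instance Definition _ := GRing.isZmodule.Build tens taddA taddC tadd0 taddN.

Lemma tmulA : associative tmul.
Proof.
move=> x y z; rewrite -[x]tpiK -[y]tpiK -[z]tpiK !tmul_pi.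
apply/tpiP => M b bb; rewrite !tsum_mul big_allpairs_dep.
apply: eq_bigr => p _; rewrite big_allpairs_dep.
by apply: eq_bigr => q _; apply: eq_bigr => r _; rewrite /= !mulrA.
Qed.
Lemma tmulC : commutative tmul.
Proof.
move=> x y; apply/tpiP => M b bb; rewrite !tsum_mul exchange_big.
apply: eq_bigr => p _; apply: eq_bigr => q _.
by rewrite [p.1 * _]mulrC [p.2 * _]mulrC.
Qed.
Lemma tmul1 : left_id tone tmul.
Proof.
move=> x; rewrite -[x]tpiK tmul_pi; apply/tpiP => M b bb.
by rewrite tsum_mul big_seq1; apply: eq_bigr => p _; rewrite !mul1r.
Qed.
Lemma tmulDl : left_distributive tmul +%R.
Proof.
move=> x y z; rewrite -[x]tpiK -[y]tpiK -[z]tpiK.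
rewrite [X in tmul X _]tadd_pi !tmul_pi [RHS]tadd_pi.
by apply/tpiP => M b bb; rewrite tsum_cat // !tsum_mul big_cat.
Qed.

HB.instance Definition _ :=
  GRing.Zmodule_isComPzRing.Build tens tmulA tmulC tmul1 tmulDl.

Lemma tpiE s : tpi s = \sum_(p <- s) tensor p.1 p.2.
Proof.
elim: s => [|p s IHs]; first by rewrite big_nil.
by rewrite big_cons -IHs [RHS]tadd_pi; case: p.
Qed.

Lemma tensorM x x' y y' : tensor x y * tensor x' y' = tensor (x * x') (y * y').
Proof. exact: tmul_pi. Qed.

Lemma tensorDl x x' y : tensor (x + x') y = tensor x y + tensor x' y.
Proof.
rewrite [RHS]tadd_pi; apply: (tpiP _ _).2 => M b bb.
by rewrite tsum_cat // /tsum !big_seq1 /= bilinDl.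
Qed.
Lemma tensorDr x y y' : tensor x (y + y') = tensor x y + tensor x y'.
Proof.
rewrite [RHS]tadd_pi; apply: (tpiP _ _).2 => M b bb.
by rewrite tsum_cat // /tsum !big_seq1 /= bilinDr.
Qed.
Lemma tensorZ c x y : tensor (c *: x) y = tensor x (c *: y).
Proof.
by apply: (tpiP _ _).2 => M b bb; rewrite /tsum !big_seq1 /= bilinZl // bilinZr.
Qed.

End TensorProduct.

(* The symmetric algebra of V, realized as the polynomial ring on a basis of  *)
(* V, with sym_in : V -> symV the inclusion of V as the linear forms; the     *)
(* universal property is symV_universal.                                      *)
Section SymmetricAlgebra.
Variables (K : fieldType) (V : vectType K).

Definition symV := {mpoly K[\dim {:V}]}.

Definition sym_in (v : V) : symV :=
  \sum_(i < \dim {:V}) coord (vbasis {:V}) i v *: 'X_i.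

Lemma sym_in_is_linear : linear sym_in.
Proof.
move=> c u v; rewrite /sym_in scaler_sumr -big_split /=.
by apply: eq_bigr => i _; rewrite linearP scalerDl scalerA.
Qed.
HB.instance Definition _ :=
  GRing.isLinear.Build K V symV _ sym_in sym_in_is_linear.

Lemma sym_in_basis (i : 'I_(\dim {:V})) : sym_in (vbasis {:V})`_i = 'X_i.
Proof.
have fb : free (vbasis {:V}) by exact: basis_free (vbasisP _).
rewrite /sym_in (bigD1 i) //= coord_free // eqxx scale1r.
rewrite big1 ?addr0 // => j ji.
by rewrite coord_free // eq_sym (negPf ji) scale0r.
Qed.

Lemma sym_in_inj : injective sym_in.
Proof.
move=> u v E; rewrite (coord_vbasis (memvf u)) (coord_vbasis (memvf v)).
apply: eq_bigr => i _; congr (_ *: _).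
have cE w : coord (vbasis {:V}) i w = (sym_in w)@_(U_(i))%MM.
  rewrite /sym_in raddf_sum (bigD1 i) //= mcoeffZ mcoeffXU eqxx mulr1.
  rewrite big1 ?addr0 // => j ji.
  by rewrite mcoeffZ mcoeffXU (negPf ji) mulr0.
by rewrite !cE E.
Qed.

Section Lift.
Variables (C : comAlgType K) (f : {linear V -> C}).

Definition sym_lift : symV -> C :=
  mmap (GRing.in_alg C) (fun i : 'I_(\dim {:V}) => f (vbasis {:V})`_i).
HB.instance Definition _ := GRing.RMorphism.on sym_lift.

Fact sym_lift_is_scalable : scalable sym_lift.
Proof. by move=> c p; rewrite /sym_lift mmapZ /= -scalerAl mul1r. Qed.
HB.instance Definition _ :=
  GRing.isScalable.Build K symV C *:%R sym_lift sym_lift_is_scalable.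

Lemma sym_lift_in v : sym_lift (sym_in v) = f v.
Proof.
rewrite [in RHS](coord_vbasis (memvf v)) /sym_in !linear_sum.
apply: eq_bigr => i _; rewrite !linearZ /=; congr (_ *: _).
by rewrite /sym_lift mmapX mmap1U.
Qed.
End Lift.

Lemma symV_universal (C : comAlgType K) (f : {linear V -> C}) :
  exists g : {lrmorphism symV -> C}, (forall v, g (sym_in v) = f v) /\
    forall g' : {lrmorphism symV -> C},
      (forall v, g' (sym_in v) = f v) -> g' =1 g.
Proof.
exists (sym_lift f); split=> [v|g' g'E p]; first exact: sym_lift_in.
elim/mpolyind: p => [|c m p _ _ IHp]; first by rewrite !raddf0.
rewrite !raddfD /= IHp !linearZ /=; congr (_ *: _ + _).
rewrite mpolyXE_id !rmorph_prod; apply: eq_bigr => i _.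
by rewrite !rmorphXn -sym_in_basis /= g'E sym_lift_in.
Qed.

Definition fracV := {fraction symV}.
HB.instance Definition _ := GRing.Field.on fracV.

Definition fracV_scale (c : K) (x : fracV) : fracV :=
  FracField.tofrac (c%:MP : symV) * x.

Fact fracV_scaleA a b v :
  fracV_scale a (fracV_scale b v) = fracV_scale (a * b) v.
Proof. by rewrite /fracV_scale mulrA -tofracM mpolyCM. Qed.
Fact fracV_scale1 : left_id 1 fracV_scale.
Proof. by move=> x; rewrite /fracV_scale tofrac1 mul1r. Qed.
Fact fracV_scaleDr : right_distributive fracV_scale +%R.
Proof. by move=> c x y; rewrite /fracV_scale mulrDr. Qed.
Fact fracV_scaleDl v : {morph fracV_scale^~ v : a b / a + b}.
Proof. by move=> a b; rewrite /fracV_scale mpolyCD tofracD mulrDl. Qed.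
HB.instance Definition _ := GRing.Zmodule_isLmodule.Build K fracV
  fracV_scaleA fracV_scale1 fracV_scaleDr fracV_scaleDl.

Fact fracV_scaleAl (a : K) (x y : fracV) : a *: (x * y) = (a *: x) * y.
Proof. exact: mulrA. Qed.
HB.instance Definition _ := GRing.Lmodule_isLalgebra.Build K fracV fracV_scaleAl.
HB.instance Definition _ := GRing.Lalgebra_isComAlgebra.Build K fracV.

Definition frac_in (v : V) : fracV := FracField.tofrac (sym_in v).

(* R_V, the intersection of the K-subalgebras of K_V = fracV which contain    *)
(* 1/v for all v != 0.                                                        *)
Definition RV_pred : {pred fracV} := fun x =>
  `[< forall S : {pred fracV}, GRing.subalg_closed S ->
        (forall v : V, v != 0 -> (frac_in v)^-1 \in S) -> x \in S >].

Lemma RV_pred_closed : GRing.subalg_closed RV_pred.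
Proof.
split=> [|c x y /asboolP Rx /asboolP Ry|x y /asboolP Rx /asboolP Ry];
  apply/asboolP => S Salg Sv; case: (Salg) => S1 SL SM //.
- exact: SL (Rx S Salg Sv) (Ry S Salg Sv).
- exact: SM (Rx S Salg Sv) (Ry S Salg Sv).
Qed.
HB.instance Definition _ := GRing.isSubalgClosed.Build K fracV RV_pred
  RV_pred_closed.

Definition RV := {x : fracV | x \in RV_pred}.
HB.instance Definition _ := SubChoice.on RV.
HB.instance Definition _ := [SubChoice_isSubComNzRing of RV by <:].
HB.instance Definition _ := [SubZmodule_isSubLmodule of RV by <:].
HB.instance Definition _ := [SubNzRing_SubLmodule_isSubLalgebra of RV by <:].
HB.instance Definition _ := [SubLalgebra_isSubAlgebra of RV by <:].

Fact RV_inv_subproof (v : V) : (frac_in v)^-1 \in RV_pred.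
Proof.
apply/asboolP => S /GRing.subalg_closedZ[S0 _] Sv.
have [->|/Sv//] := eqVneq v 0.
by rewrite /frac_in linear0 tofrac0 invr0.
Qed.

(* 1/v as an element of RV; the value at v = 0 is 0, and is never used below. *)
Definition RV_inv (v : V) : RV := Sub (frac_in v)^-1 (RV_inv_subproof v).

End SymmetricAlgebra.

(* A = K[t] is {poly K}, F = K(t) is ratfun, and polyF : A -> F.              *)
Section RationalFunctions.
Variable K : fieldType.

Definition ratfun := {fraction {poly K}}.
HB.instance Definition _ := GRing.Field.on ratfun.

Definition polyF (p : {poly K}) : ratfun := FracField.tofrac p.
HB.instance Definition _ := GRing.isZmodMorphism.Build {poly K} ratfun polyF
  (@tofrac_is_zmod_morphism {poly K}).
HB.instance Definition _ := GRing.isMonoidMorphism.Build {poly K} ratfun polyF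
  (@tofrac_is_monoid_morphism {poly K}).

Definition ratfun_scale (c : K) (x : ratfun) : ratfun := polyF c%:P * x.

Fact ratfun_scaleA a b v :
  ratfun_scale a (ratfun_scale b v) = ratfun_scale (a * b) v.
Proof. by rewrite /ratfun_scale mulrA -rmorphM -polyCM. Qed.
Fact ratfun_scale1 : left_id 1 ratfun_scale.
Proof. by move=> x; rewrite /ratfun_scale rmorph1 mul1r. Qed.
Fact ratfun_scaleDr : right_distributive ratfun_scale +%R.
Proof. by move=> c x y; rewrite /ratfun_scale mulrDr. Qed.
Fact ratfun_scaleDl v : {morph ratfun_scale^~ v : a b / a + b}.
Proof. by move=> a b; rewrite /ratfun_scale polyCD rmorphD mulrDl. Qed.
HB.instance Definition _ := GRing.Zmodule_isLmodule.Build K ratfun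
  ratfun_scaleA ratfun_scale1 ratfun_scaleDr ratfun_scaleDl.

Fact ratfun_scaleAl (a : K) (x y : ratfun) : a *: (x * y) = (a *: x) * y.
Proof. exact: mulrA. Qed.
HB.instance Definition _ :=
  GRing.Lmodule_isLalgebra.Build K ratfun ratfun_scaleAl.
HB.instance Definition _ := GRing.Lalgebra_isComAlgebra.Build K ratfun.

(* F/A, with the action of A through pscale.  It is declared as a K-vector    *)
(* space only, since HB allows a single ring of scalars for a given type.     *)
Definition integral : {pred ratfun} := fun x => `[< exists p, x = polyF p >].

Lemma integralP x : reflect (exists p, x = polyF p) (x \in integral).
Proof. exact: asboolP. Qed.

Lemma integral_zmod_closed : zmod_closed integral.
Proof.
split=> [|x y /integralP[p ->] /integralP[q ->]]; apply/integralP.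
  by exists 0; rewrite rmorph0.
by exists (p - q); rewrite rmorphB.
Qed.
HB.instance Definition _ :=
  GRing.isZmodClosed.Build ratfun integral integral_zmod_closed.

Definition FmodA := {ideal_quot integral}.
HB.instance Definition _ := GRing.Zmodule.on FmodA.
HB.instance Definition _ := EqQuotient.on FmodA.

Definition fpi (x : ratfun) : FmodA := \pi_FmodA x.

Lemma fpi_eq x y : (fpi x == fpi y) = (x - y \in integral).
Proof. by rewrite /fpi Quotient.idealrBE. Qed.

Lemma fpiK (x : FmodA) : fpi (repr x) = x.
Proof. exact: reprK. Qed.

Lemma fpi_is_zmod_morphism : zmod_morphism fpi.
Proof. exact: (raddfB (\pi_{ideal_quot integral})). Qed.
HB.instance Definition _ :=
  GRing.isZmodMorphism.Build ratfun FmodA fpi fpi_is_zmod_morphism.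

Definition pscale (a : {poly K}) (x : FmodA) : FmodA := fpi (polyF a * repr x).

Lemma pscale_pi a x : pscale a (fpi x) = fpi (polyF a * x).
Proof.
apply/eqP; rewrite fpi_eq -mulrBr.
have : repr (fpi x) - x \in integral by rewrite -fpi_eq fpiK.
by case/integralP=> p ->; apply/integralP; exists (a * p); rewrite rmorphM.
Qed.

Lemma pscaleA a b x : pscale a (pscale b x) = pscale (a * b) x.
Proof. by rewrite -[x]fpiK !pscale_pi rmorphM mulrA. Qed.
Lemma pscale1 x : pscale 1 x = x.
Proof. by rewrite -[x]fpiK !pscale_pi rmorph1 mul1r. Qed.
Lemma pscaleDr a x y : pscale a (x + y) = pscale a x + pscale a y.
Proof.
by rewrite -[x]fpiK -[y]fpiK -raddfD /= !pscale_pi mulrDr raddfD.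
Qed.
Lemma pscaleDl a b x : pscale (a + b) x = pscale a x + pscale b x.
Proof. by rewrite -[x]fpiK !pscale_pi rmorphD mulrDl raddfD. Qed.
Lemma pscale0 a : pscale a 0 = 0.
Proof. by apply: (addrI (pscale a 0)); rewrite -pscaleDr !addr0. Qed.

Definition FmodA_scale (c : K) (x : FmodA) := pscale c%:P x.
Fact FmodA_scaleA a b v :
  FmodA_scale a (FmodA_scale b v) = FmodA_scale (a * b) v.
Proof. by rewrite /FmodA_scale pscaleA polyCM. Qed.
Fact FmodA_scale1 : left_id 1 FmodA_scale. Proof. exact: pscale1. Qed.
Fact FmodA_scaleDr : right_distributive FmodA_scale +%R.
Proof. by move=> c; exact: pscaleDr. Qed.
Fact FmodA_scaleDl v : {morph FmodA_scale^~ v : a b / a + b}.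
Proof. by move=> a b; rewrite /FmodA_scale polyCD pscaleDl. Qed.
HB.instance Definition _ := GRing.Zmodule_isLmodule.Build K FmodA
  FmodA_scaleA FmodA_scale1 FmodA_scaleDr FmodA_scaleDl.

(* The submodule t^-nu A / A of F/A.                                          *)
Definition tA (nu : nat) : {pred FmodA} := fun x =>
  `[< exists p : {poly K}, x = fpi (polyF p / polyF 'X^nu) >].

Lemma tAP nu x :
  reflect (exists p : {poly K}, x = fpi (polyF p / polyF 'X^nu)) (x \in tA nu).
Proof. exact: asboolP. Qed.

Lemma tA0 nu : 0 \in tA nu.
Proof. by apply/tAP; exists 0; rewrite rmorph0 mul0r raddf0. Qed.

Lemma tAD nu x y : x \in tA nu -> y \in tA nu -> x + y \in tA nu.
Proof.
move=> /tAP[p ->] /tAP[q ->]; apply/tAP; exists (p + q).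
by rewrite rmorphD mulrDl raddfD.
Qed.

Lemma tA_pscale nu a x : x \in tA nu -> pscale a x \in tA nu.
Proof.
by move=> /tAP[p ->]; apply/tAP; exists (a * p); rewrite pscale_pi rmorphM mulrA.
Qed.

End RationalFunctions.

(* V_n = (t^-n A / A)^r, as a subspace of (F/A)^r.                            *)
Section Torsion.
Variables (K : fieldType) (n r : nat).
Local Notation FmodA := (FmodA K).

Definition tAr (nu : nat) : {pred {ffun 'I_r -> FmodA}} :=
  fun v => [forall j, v j \in tA nu].

Lemma tArP nu (v : {ffun 'I_r -> FmodA}) :
  reflect (forall j, v j \in tA nu) (v \in tAr nu).
Proof. exact: forallP. Qed.

Lemma tAr_submod_closed nu : GRing.submod_closed (tAr nu).
Proof.
split=> [|c u v /tArP Hu /tArP Hv]; apply/tArP => j; rewrite !ffunE ?tA0 //.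
by rewrite tAD ?Hv //; apply: tA_pscale.
Qed.
HB.instance Definition _ nu :=
  GRing.isSubmodClosed.Build K {ffun 'I_r -> FmodA} (tAr nu) (tAr_submod_closed nu).

Definition Vn := {v : {ffun 'I_r -> FmodA} | v \in tAr n}.
HB.instance Definition _ := SubChoice.on Vn.
HB.instance Definition _ := [SubChoice_isSubLmodule of Vn by <:].

(* Coordinates on Vn: row j of M lists the coefficients of the polynomial p   *)
(* of degree < n such that p / t^n represents the j-th component.             *)
Definition Vn_of_fun (M : 'M[K]_(r, n)) : {ffun 'I_r -> FmodA} :=
  [ffun j => fpi (polyF (rVpoly (row j M)) / polyF 'X^n)].

Fact Vn_of_subproof M : Vn_of_fun M \in tAr n.
Proof. by apply/tArP => j; rewrite ffunE; apply/tAP; eexists. Qed.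

Definition Vn_of (M : 'M[K]_(r, n)) : Vn := Sub (Vn_of_fun M) (Vn_of_subproof M).

Lemma Vn_of_is_linear : linear Vn_of.
Proof.
move=> c M N; apply: val_inj; apply/ffunP => j.
rewrite /= !ffunE !linearP /= [_ *: fpi _]pscale_pi.
by rewrite -raddfD /= -mul_polyC rmorphD rmorphM mulrDl mulrA.
Qed.
HB.instance Definition _ :=
  GRing.isLinear.Build K 'M[K]_(r, n) Vn _ Vn_of Vn_of_is_linear.

Lemma polyFX_neq0 nu : polyF ('X^nu : {poly K}) != 0.
Proof. by rewrite /polyF tofrac_eq0 -size_poly_eq0 size_polyXn. Qed.

Lemma Vn_of_inj : injective Vn_of.
Proof.
apply: raddf_inj => M /(congr1 val)/= M0; apply/row_matrixP => j.
rewrite row0 -[row j M]rVpolyK.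
move/ffunP: M0 => /(_ j); rewrite !ffunE.
rewrite -(raddf0 (@fpi K)) => /eqP; rewrite fpi_eq subr0 => /integralP[p].
move/(canRL (divfK (polyFX_neq0 n))); rewrite -rmorphM /= => /eqP.
rewrite /polyF tofrac_eq => /eqP E.
suff -> : rVpoly (row j M) = 0 by rewrite linear0.
have sz : (size (rVpoly (row j M)) <= n)%N by exact: size_poly.
rewrite E; have [->|p0] := eqVneq p 0; first by rewrite mul0r.
have := p0; rewrite -size_poly_gt0; move: sz; rewrite E size_mulXn //.
by move: (size p) => k; lia.
Qed.

Lemma Vn_of_surj v : exists M, Vn_of M == v.
Proof.
have H j : exists u : 'rV[K]_n,
    val v j = fpi (polyF (rVpoly u) / polyF 'X^n).
  have /tArP/(_ j)/tAP[p ->] := valP v.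
  exists (poly_rV (p %% 'X^n)); rewrite poly_rV_K; last first.
    by rewrite -ltnS -(size_polyXn K n) ltn_modp -size_poly_eq0 size_polyXn.
  apply/eqP; rewrite fpi_eq -mulrBl -rmorphB; apply/integralP.
  exists (p %/ 'X^n); rewrite {1}(divp_eq p 'X^n) addrK rmorphM mulfK //.
  exact: (polyFX_neq0 n).
have [u uE] := choice H.
exists (\matrix_j u j); apply/eqP/val_inj/ffunP => j.
by rewrite uE /= ffunE rowK.
Qed.

Definition Vn_coord (v : Vn) : 'rV[K]_(r * n) := mxvec (xchoose (Vn_of_surj v)).

Lemma Vn_coordK v : Vn_of (vec_mx (Vn_coord v)) = v.
Proof. by rewrite mxvecK; apply/eqP/(xchooseP (Vn_of_surj v)). Qed.

Lemma Vn_ofK u : Vn_coord (Vn_of (vec_mx u)) = u.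
Proof.
by apply: (can_inj vec_mxK); apply: Vn_of_inj; rewrite Vn_coordK.
Qed.

Fact Vn_hasFinDim : Vector.axiom (r * n) Vn.
Proof.
exists Vn_coord; last first.
  by exists (Vn_of \o vec_mx) => [v|u] /=; rewrite ?Vn_coordK ?Vn_ofK.
move=> c u v; apply: (can_inj Vn_ofK) => /=.
by rewrite !linearP /= !Vn_coordK.
Qed.
HB.instance Definition _ := Lmodule_hasFinDim.Build K Vn Vn_hasFinDim.

Definition act_fun (a : {poly K}) (v : Vn) : {ffun 'I_r -> FmodA} :=
  [ffun j => pscale a (val v j)].
Fact act_subproof (a : {poly K}) (v : Vn) : act_fun a v \in tAr n.
Proof.
apply/tArP => j; rewrite ffunE; apply: tA_pscale.
exact: (elimT (tArP n (val v)) (valP v)).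
Qed.
Definition act (a : {poly K}) (v : Vn) : Vn :=
  Sub (act_fun a v) (act_subproof a v).

(* V_nu = (t^-nu A / A)^r, as a subset of V_n when nu <= n.                   *)
Definition Vsub (nu : nat) : {pred Vn} := fun v => val v \in tAr nu.

Lemma Vsub_torsion (nu : nat) (v : Vn) : v \in Vsub nu <-> act 'X^nu v = 0.
Proof.
split=> [/tArP vt|/(congr1 val) v0].
  apply/val_inj/ffunP => j; rewrite !ffunE; have /tAP[p ->] := vt j.
  rewrite pscale_pi mulrC divfK ?polyFX_neq0 //.
  by apply/eqP; rewrite -(raddf0 (@fpi K)) fpi_eq subr0; apply/integralP; exists p.
apply/tArP => j; move/ffunP: v0 => /(_ j); rewrite !ffunE.
rewrite -[val v j]fpiK pscale_pi -(raddf0 (@fpi K)) => /eqP.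
rewrite fpi_eq subr0 => /integralP[p pE]; apply/tAP; exists p.
by rewrite -pE mulrAC divff ?polyFX_neq0 ?mul1r.
Qed.

End Torsion.

Section Main.
Variables (Fq : finFieldType) (n r : nat).
Local Notation V := (Vn Fq n r).

Definition RVF := tens (RV V) (ratfun Fq).

(* finvect_type V is V, seen as a finite type.                                *)
Definition Rn_rel (al : Fq) (nu : nat) (v : V) : RVF :=
  let a := al *: 'X^nu in
  tensor (RV_inv (act a v)) (polyF a)
  - \sum_(v' : finvect_type V | Vsub nu v') tensor (RV_inv (v - v')) 1.

Definition Rn_gen (x : RVF) : Prop :=
  exists (al : Fq) (nu : nat) (v : V),
    [/\ al != 0, (nu <= n)%N, v \notin Vsub nu & x = Rn_rel al nu v].

Definition Rn := qring Rn_gen.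

Definition RSn_gen (x : Rn) : Prop :=
  exists2 v : V, v != 0 & x = qpi Rn_gen (tensor (RV_inv v) 1).

Definition RSn := loc RSn_gen.

Definition Rn_to_RSn : Rn -> RSn := @to_loc Rn RSn_gen.

End Main.

(* Main.v *)
(* Let k = Fq(x_1, ..., x_r) and let D, with linear coefficient 1, be the      *)
(* Fq-linear polynomial of degree q^r whose roots are the combinations of the *)
(* x_j.  Put phi = t D and choose e_j with phi^n e_j = x_j in an algebraic    *)
(* closure Om of k(t).  Then the matrix M with entries M j m in Fq, which     *)
(* stands for a vector v of V_(n+1), is mapped to the phi^(n+1)-torsion point *)
(* hat M = sum_(j, m) M j m phi^m(e_j); the kernel of phi^nu consists of the  *)
(* hat N with t^nu N = 0, so the logarithmic derivative of the polynomial     *)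
(* phi^nu yields the relations defining R_(n+1), and 1/v |-> 1 / hat v is a   *)
(* morphism R_(n+1) -> Om.  The theorem follows from its injectivity.         *)
(*   Call residue of v the vector t^n v, in Fq^r, which is identified with    *)
(* the roots of D through u |-> sum_j u_j x_j.  The relations show that       *)
(* R_(n+1) is spanned over F by the good monomials, the products of powers of *)
(* 1/v_i, with at most one v_i for each i, whose residue has last nonzero     *)
(* coordinate i, equal to 1.  Suppose that a combination of good monomials is *)
(* mapped to 0.  The monomials in the e_j with exponents below q^(rn) being   *)
(* independent over k(t), the image remains 0 when the e_j are replaced by    *)
(* other preimages of the x_j; hence the relations are permuted by the        *)
(* p-group of automorphisms of V_(n+1) which preserve residues, and a nonzero *)
(* one gives a nonzero one whose coefficients depend on the residues only.    *)
(* This is a relation between products of the power sums of the 1 / hat v     *)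
(* over all v of residue u, which are polynomials in t with leading term      *)
(* (t^n / u)^m.  The coefficient of highest degree in t is therefore an       *)
(* Fq-relation between products of powers of the 1/u_i, with u_i of leading   *)
(* index i; it is trivial, since a substitution x_i |-> z^(N^i) after a       *)
(* change of basis separates the orders of these products at z = 0.           *)

Require Import Defs.
From HB Require Import structures.
From mathcomp Require Import all_boot all_fingroup all_algebra all_solvable all_field.
From mathcomp Require Import mxrepresentation mxabelem.
From mathcomp Require Import boolp.
From mathcomp Require Import ring zify.
From mathcomp Require Import mpoly.

Set Implicit Arguments.
Unset Strict Implicit.
Unset Printing Implicit Defensive.

Import GRing.Theory.
Local Open Scope ring_scope.

(** * Specialization of fractions *)

(** The ring is embedded in a field [Om] so that no 1/v goes to 0 ([Rn_embedding]). It is then a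
    domain, and inverting the 1/v kills nothing. The embedding sends v to a torsion point [hat v] of
    a Drinfeld module phi of rank r. The iterate phi^nu is t^nu times an additive polynomial of
    derivative 1, so the logarithmic derivative of that polynomial turns each defining relation into
    an identity in [Om] ([sum_inv_hat], [evaluation]).

    Injectivity compares a spanning family with an independent one. The relations rewrite every
    product of inverses into good monomials, up to a linear system that is invertible over F
    ([prodY_good_span]). The values of the good monomials are independent over F
    ([monom_value_independent]), for three reasons. Relations persist when the torsion points are
    changed ([reduced_transfer], [value_act]). A p-group acting on nonzero relations in
    characteristic p fixes one ([pgroup_fixed_vector], [residue_auts_pgroup]). An invariant relation
    is one between power sums, whose top terms in t are known ([trace_poly]) and independent over
    [Fq] ([res_value_independent]). *)

Section Specialization.
Variables (D : idomainType) (L : fieldType) (f : {rmorphism D -> L}).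

(** The extension of [f] to the local ring of [D] at the prime [ker f], as a relation: it is only
    partial when [f] is not injective. It serves for substitutions that may meet poles and for maps
    out of [R_V]. *)
Definition specializes (x : {fraction D}) (y : L) : Prop :=
  exists a b, [/\ f b != 0, x * FracField.tofrac b = FracField.tofrac a
                & y * f b = f a].

Lemma specializes_fun x y y' : specializes x y -> specializes x y' -> y = y'.
Proof.
move=> [a [b [b0 xb yb]]] [a' [b' [b'0 xb' yb']]].
apply: (mulIf b0); apply: (mulIf b'0); rewrite yb [y' * _ * _]mulrAC yb'.
rewrite -!rmorphM; congr (f _); apply/eqP; rewrite -tofrac_eq !tofracM -xb -xb'.
by rewrite mulrAC.
Qed.

Lemma specializes_tofrac a : specializes (FracField.tofrac a) (f a).
Proof. by exists a, 1; rewrite !rmorph1 !mulr1 oner_eq0. Qed.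

Lemma specializesD x y x' y' :
  specializes x y -> specializes x' y' -> specializes (x + x') (y + y').
Proof.
move=> [a [b [b0 xb yb]]] [a' [b' [b'0 xb' yb']]].
exists (a * b' + a' * b), (b * b'); rewrite !rmorphD !rmorphM mulf_neq0 //=.
by split=> //; rewrite mulrDl -?xb -?xb' -?yb -?yb' !mulrA [X in _ + X]mulrAC.
Qed.

Lemma specializesM x y x' y' :
  specializes x y -> specializes x' y' -> specializes (x * x') (y * y').
Proof.
move=> [a [b [b0 xb yb]]] [a' [b' [b'0 xb' yb']]].
exists (a * a'), (b * b'); rewrite !rmorphM mulf_neq0 //=.
by split=> //; rewrite mulrACA ?xb ?xb' ?yb ?yb'.
Qed.

Lemma specializesV x y : y != 0 -> specializes x y -> specializes x^-1 y^-1.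
Proof.
move=> y0 [a [b [b0 xb yb]]]; have a0 : f a != 0 by rewrite -yb mulf_neq0.
have x0 : x != 0.
  apply: contraNneq a0 => x0; move: xb; rewrite x0 mul0r => /esym/eqP.
  by rewrite tofrac_eq0 => /eqP->; rewrite rmorph0.
by exists b, a; split=> //; rewrite -?xb -?yb mulKf.
Qed.

Lemma specializesX x y m : specializes x y -> specializes (x ^+ m) (y ^+ m).
Proof.
move=> xy; elim: m => [|m IHm]; last by rewrite !exprS; apply: specializesM.
by rewrite !expr0 -tofrac1 -(rmorph1 f); apply: specializes_tofrac.
Qed.

Lemma specializes_prod I (s : seq I) (P : pred I) (x : I -> {fraction D}) y :
  (forall i, P i -> specializes (x i) (y i)) ->
  specializes (\prod_(i <- s | P i) x i) (\prod_(i <- s | P i) y i).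
Proof.
move=> xy; elim/big_ind2: _ => [|*|//]; last exact: specializesM.
by rewrite -tofrac1 -(rmorph1 f); apply: specializes_tofrac.
Qed.

Lemma specializes_sum I (s : seq I) (P : pred I) (x : I -> {fraction D}) y :
  (forall i, P i -> specializes (x i) (y i)) ->
  specializes (\sum_(i <- s | P i) x i) (\sum_(i <- s | P i) y i).
Proof.
move=> xy; elim/big_ind2: _ => [|*|//]; last exact: specializesD.
by rewrite -tofrac0 -(rmorph0 f); apply: specializes_tofrac.
Qed.

Lemma fracP (x : {fraction D}) :
  exists a b, b != 0 /\ x * FracField.tofrac b = FracField.tofrac a.
Proof.
elim/quotW: x => x; exists (frac x).1, (frac x).2; split; first exact: denom_ratioP.
apply/eqP; unlock FracField.tofrac; rewrite -[_ == _]/(_ == _ :> {fraction D}).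
rewrite -[_ * _](FracField.pi_mul) eqmodE /= FracField.equivfE /FracField.mulf.
rewrite !numden_Ratio ?oner_eq0 ?mulf_neq0 ?denom_ratioP ?oner_neq0 //.
by rewrite !mulr1 mulrC.
Qed.

Lemma common_denominator (I : finType) (x : I -> {fraction D}) :
  exists2 b, b != 0 & exists a : I -> D,
    forall i, x i * FracField.tofrac b = FracField.tofrac (a i).
Proof.
have [d dP] := choice (fun i => fracP (x i)); have [e eP] := choice dP.
exists (\prod_i e i); first by apply/prodf_neq0 => i _; case: (eP i).
exists (fun i => d i * \prod_(j | j != i) e j) => i.
by rewrite (bigD1 i) //= !tofracM mulrA (eP i).2.
Qed.

Hypothesis f_inj : injective f.

Fact frac_ext_subproof x : exists y, specializes x y.
Proof.
have [a [b [b0 xb]]] := fracP x.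
have fb0 : f b != 0 by rewrite -(rmorph0 f) (inj_eq f_inj).
by exists (f a / f b), a, b; rewrite divfK.
Qed.

Definition frac_ext x : L := sval (cid (frac_ext_subproof x)).

Lemma frac_extP x : specializes x (frac_ext x).
Proof. exact: (svalP (cid (frac_ext_subproof x))). Qed.

Lemma frac_ext_tofrac a : frac_ext (FracField.tofrac a) = f a.
Proof. by apply: specializes_fun (frac_extP _) (specializes_tofrac a). Qed.

Fact frac_ext_is_zmod_morphism : zmod_morphism frac_ext.
Proof.
move=> x y; rewrite -mulN1r -[- frac_ext y]mulN1r.
apply: specializes_fun (frac_extP _) _.
apply: specializesD (frac_extP _) (specializesM _ (frac_extP _)).
by rewrite -tofrac1 -tofracN -(rmorph1 f) -rmorphN; apply: specializes_tofrac.
Qed.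
HB.instance Definition _ := GRing.isZmodMorphism.Build {fraction D} L frac_ext
  frac_ext_is_zmod_morphism.

Fact frac_ext_is_monoid_morphism : monoid_morphism frac_ext.
Proof.
split; first by rewrite -tofrac1 frac_ext_tofrac rmorph1.
move=> x y; apply: specializes_fun (frac_extP _) _.
by apply: specializesM; apply: frac_extP.
Qed.
HB.instance Definition _ := GRing.isMonoidMorphism.Build {fraction D} L frac_ext
  frac_ext_is_monoid_morphism.

End Specialization.

(** * Fixed vectors of p-groups *)

Section FixedVector.
Variables (F : fieldType) (gT : finGroupType) (G : {group gT}) (X : finType).
Variables (act : gT -> X -> X).
Hypothesis act1 : act 1%g =1 id.
Hypothesis actM : {in G &, forall g h, act (g * h)%g =1 act h \o act g}.

Let rG g : 'M[F]_#|X| :=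
  \matrix_(i, j) (enum_val j == act g (enum_val i))%:R.

Let rG_mul (d : 'rV_#|X|) g j :
  (d *m rG g) 0 j = \sum_(i | enum_val j == act g (enum_val i)) d 0 i.
Proof.
rewrite mxE (bigID (fun i => enum_val j == act g (enum_val i))) /=.
rewrite [X in _ + X]big1 ?addr0 => [|i /negPf jN]; last by rewrite mxE jN mulr0.
by apply: eq_bigr => i ji; rewrite mxE ji mulr1.
Qed.

Let rG_repr : mx_repr G rG.
Proof.
split=> [|g h Gg Gh]; apply/matrixP => i j.
  by rewrite !mxE act1 (inj_eq enum_val_inj) eq_sym.
rewrite mxE actM //= mxE (bigD1 (enum_rank (act g (enum_val i)))) //=.
rewrite !mxE enum_rankK eqxx mul1r big1 ?addr0 // => l li.
rewrite mxE; case: eqP => [lE|]; last by rewrite mul0r.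
by rewrite -lE enum_valK eqxx in li.
Qed.

(* d' is a fixed vector in the submodule of the permutation module generated  *)
(* by d, which exists since G is a p-group in characteristic p.               *)
Lemma pgroup_fixed_vector (p : nat) (d : X -> F) :
    p \in [pchar F] -> (p.-group G)%g -> (exists x, d x != 0) ->
  exists (a : gT -> F) (d' : X -> F),
   [/\ forall y, d' y = \sum_(g in G) a g * \sum_(x | y == act g x) d x,
       exists x, d' x != 0 & forall g x, g \in G -> d' (act g x) = d' x].
Proof.
move=> pF pG [x dx]; pose R := MxRepresentation rG_repr.
pose u : 'rV[F]_#|X| := \row_i d (enum_val i).
have u0 : u != 0.
  by apply/eqP => /rowP/(_ (enum_rank x)); rewrite !mxE enum_rankK; apply/eqP.
pose modU := cyclic_mx_module R u.
have rkU : (0 < \rank (cyclic_mx R u))%N by rewrite lt0n mxrank_eq0 cyclic_mx_eq0.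
have fix0 := rfix_pgroup_pchar pF (submod_repr modU) rkU pG (subxx _).
have [w [wU wfix w0]] : exists w : 'rV[F]_#|X|,
    [/\ (w <= cyclic_mx R u)%MS, (w <= rfix_mx R G)%MS & w != 0].
  have /rowV0Pn[w wI w0] : (cyclic_mx R u :&: rfix_mx R G)%MS != 0.
    apply: contraNneq fix0 => E.
    by rewrite -submx0 (rfix_submod modU) // E linear0 submx0.
  by exists w; move: wI; rewrite sub_capmx => /andP[].
(* An element of the cyclic module is [u] times a combination of the matrices [rG g], whose
   coefficients are the required [a]. *)
have [A /envelop_mxP[a AE] wE] := cyclic_mxP wU.
have wGE y : w 0 (enum_rank y) = \sum_(g in G) a g * \sum_(x | y == act g x) d x.
  rewrite wE AE mulmx_sumr summxE; apply: eq_bigr => g _.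
  rewrite -scalemxAr mxE rG_mul enum_rankK; congr (_ * _).
  rewrite (reindex _ (onW_bij _ (@enum_rank_bij X))) /=.
  by apply: eq_big => [z|z _]; rewrite ?mxE enum_rankK.
exists a, (fun y => w 0 (enum_rank y)); split=> //.
  have /existsP[j wj] : [exists j, w 0 j != 0].
    apply: contraNT w0; rewrite negb_exists => /forallP w0.
    by apply/eqP/rowP => j; rewrite mxE; apply/eqP/negPn/w0.
  by exists (enum_val j); rewrite enum_valK.
move=> g y Gg; move/rfix_mxP: wfix => /(_ g Gg)/rowP/(_ (enum_rank (act g y))).
rewrite rG_mul enum_rankK (bigD1 (enum_rank y)) /= ?enum_rankK ?eqxx //.
rewrite big1 ?addr0 // => i /andP[/eqP iE]; rewrite -[i]enum_valK.
have actK z : act g^-1%g (act g z) = z.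
  by rewrite -[LHS]/((act g^-1%g \o act g) z) -actM ?groupV ?mulgV ?act1.
by rewrite -[enum_val i]actK -iE actK eqxx.
Qed.

End FixedVector.

(** * Good monomials *)

Section Coordinates.
Variables (K : fieldType) (r n : nat).
Implicit Types (M : 'M[K]_(r, n.+1)) (u : 'rV[K]_r).

(* Multiplication by t on the coordinates Vn_of, hence residue M is t^n M.    *)
Definition shift_mx : 'M[K]_n.+1 := \matrix_(i, j) (j == i.+1 :> nat)%:R.

Definition residue M : 'rV[K]_r := (col 0 M)^T.

Fact residue_is_linear : linear residue.
Proof. by move=> c M N; rewrite /residue !linearP. Qed.
HB.instance Definition _ := GRing.isLinear.Build K _ _ _ residue residue_is_linear.

Lemma residueE M j : residue M 0 j = M j 0.
Proof. by rewrite !mxE. Qed.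

Lemma mulmx_shift_expE M nu j (m : 'I_n.+1) :
  (M *m shift_mx ^+ nu) j m = if (nu <= m)%N then M j (inord (m - nu)) else 0.
Proof.
elim: nu m => [|nu IHnu] m; first by rewrite mulmx1 subn0 inord_val.
rewrite exprSr mulmxA mxE.
have [m0|m_gt0] := posnP m.
  rewrite big1 => [|l _]; first by rewrite m0.
  by rewrite !mxE m0 mulr0.
have lt_m : (m.-1 < n.+1)%N by apply: leq_ltn_trans (leq_pred m) _.
rewrite (bigD1 (Ordinal lt_m)) //= big1 => [|l /eqP lN]; last first.
  rewrite [shift_mx _ _]mxE; case: eqP => [mE|]; last by rewrite mulr0.
  by case: lN; apply: val_inj; rewrite /= mE.
rewrite [shift_mx _ _]mxE /= prednK // eqxx mulr1 addr0 IHnu /=.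
by rewrite -ltnS prednK //; congr (if _ then M j (inord _) else _); lia.
Qed.

Lemma mulmx_shiftE M j (m : 'I_n.+1) :
  (M *m shift_mx) j m = if (0 < m)%N then M j (inord m.-1) else 0.
Proof. by rewrite -[shift_mx]expr1 mulmx_shift_expE subn1. Qed.

Lemma mulmx_shift_top M j (m : 'I_n.+1) :
  (M *m shift_mx ^+ n) j m = if m == n :> nat then residue M 0 j else 0.
Proof.
rewrite mulmx_shift_expE residueE.
have -> : (n <= m)%N = (m == n :> nat) by have := ltn_ord m; lia.
by case: eqP => // ->; rewrite subnn; congr (M j _); apply: val_inj; rewrite /= inordK.
Qed.

(** The residue is the image under t^n, and in a free module over A / t^(n+1) the kernel of t^n is
    the image of t. *)
Lemma residue0_shift M : residue M = 0 -> exists N, M = N *m shift_mx.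
Proof.
move=> M0; exists (\matrix_(j, m) if (m < n)%N then M j (inord m.+1) else 0).
apply/matrixP => j m; rewrite mulmx_shiftE.
have [m0|m_gt0] := posnP m.
  have -> : m = 0 by apply: val_inj.
  by rewrite -residueE M0 mxE.
have ltm := ltn_ord m; rewrite mxE inordK; last by lia.
by rewrite prednK // inord_val ifT //; lia.
Qed.

Lemma mulmx_shift_n M : M *m shift_mx ^+ n.+1 = 0.
Proof.
by apply/matrixP => j m; rewrite mulmx_shift_expE mxE ltnNge -ltnS ltn_ord.
Qed.

Definition leading i u := (u 0 i == 1) && [forall j : 'I_r, (i < j)%N ==> (u 0 j == 0)].

Lemma leadingP i u :
  reflect (u 0 i = 1 /\ forall j : 'I_r, (i < j)%N -> u 0 j = 0) (leading i u).
Proof.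
apply: (iffP andP) => [[/eqP-> /forallP u0]|[-> u0]]; split=> //.
  by move=> j ij; apply/eqP; have := u0 j; rewrite ij.
by apply/forallP => j; apply/implyP => /u0->.
Qed.

(** The measure that decreases when products are rewritten into good monomials; the shift by one
    separates the zero vector from index 0. *)
Definition height u : nat := \max_(i < r | u 0 i != 0) i.+1.

Lemma leading_height i u : leading i u -> height u = i.+1.
Proof.
move=> /leadingP[ui u0]; apply/eqP; rewrite eqn_leq; apply/andP; split.
  apply/bigmax_leqP => j; apply: contraNT; rewrite -ltnNge ltnS => ij.
  by rewrite u0.
by apply: (@leq_bigmax_cond _ _ (fun i : 'I_r => i.+1)); rewrite ui oner_eq0.
Qed.

Lemma leading_inj i j u : leading i u -> leading j u -> i = j.
Proof.
by move=> /leading_height ui /leading_height uj; apply: val_inj; case: (etrans (esym ui) uj).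
Qed.

Lemma leadingB_height i u v : leading i u -> leading i v -> (height (u - v) <= i)%N.
Proof.
move=> /leadingP[ui u0] /leadingP[vi v0]; apply/bigmax_leqP => j.
rewrite !mxE ltnNge; apply: contraNN; rewrite leq_eqVlt => /orP[/eqP/val_inj<-|ij].
  by rewrite ui vi subrr.
by rewrite u0 ?v0 ?subrr.
Qed.

Lemma heightZ c u : c != 0 -> height (c *: u) = height u.
Proof. by move=> c0; apply: eq_bigl => i; rewrite mxE mulf_eq0 (negPf c0). Qed.

Lemma leading_normalize u : u != 0 -> exists c i, c != 0 /\ leading i (c *: u).
Proof.
move=> /rV0Pn[i0 ui0].
case: (@arg_maxnP _ i0 (fun i => u 0 i != 0) (fun i => i : nat) ui0) => i ui imax.
exists (u 0 i)^-1, i; split; first by rewrite invr_eq0.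
apply/leadingP; rewrite mxE mulVf //; split=> // j ij; rewrite mxE.
apply/eqP; rewrite mulf_eq0; apply/orP; right; apply: contraLR ij => uj.
by rewrite -leqNgt; apply: imax.
Qed.

End Coordinates.

(** * Spanning by good monomials *)

Section Monomials.
Variables (Fq : finFieldType) (r n : nat).
Local Notation W := 'M[Fq]_(r, n.+1).

(** [Some (w, a)] stands for the factor (1/w)^(a+1) and [None] for 1, so that exponent 0 has a
    single encoding. Bounding the exponents makes the type finite, as the permutation action of a
    group requires. *)
Definition monom k := {ffun 'I_r -> option (W * 'I_k)}.

Definition good_factor i k (z : option (W * 'I_k)) : bool :=
  if z is Some (w, _) then leading i (residue w) else true.

Definition good k (m : monom k) := [forall i, good_factor i (m i)].

Section Value.
Variables (R : pzSemiRingType) (Y : W -> R).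

Definition factor_value k (z : option (W * 'I_k)) : R :=
  if z is Some (w, a) then Y w ^+ a.+1 else 1.

Definition monom_value k (m : monom k) : R := \prod_i factor_value (m i).
End Value.

Section Spanning.
Variables (R : comPzRingType) (iota : {rmorphism ratfun Fq -> R}) (Y : W -> R).
Local Notation con c := (iota (polyF c%:P)).
Local Notation t := (polyF 'X : ratfun Fq).

Hypothesis YZ : forall c w, c != 0 -> Y (c *: w) = con c^-1 * Y w.
Hypothesis YM : forall v w, v != 0 -> w != 0 -> v + w != 0 ->
  Y v * Y w = Y (v + w) * (Y v + Y w).
Hypothesis YT : forall w, w *m shift_mx Fq n != 0 ->
  iota t * Y (w *m shift_mx Fq n) =
  \sum_(w' : W | w' *m shift_mx Fq n == 0) Y (w - w').

Variable k : nat.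

Definition good_span (x : R) : Prop := exists d : monom k -> ratfun Fq,
  (forall m, ~~ good m -> d m = 0) /\
  x = \sum_(m : monom k) iota (d m) * monom_value Y m.

Lemma good_span0 : good_span 0.
Proof.
exists (fun=> 0); split=> //; rewrite big1 // => m _.
by rewrite rmorph0 mul0r.
Qed.

Lemma good_spanD x y : good_span x -> good_span y -> good_span (x + y).
Proof.
move=> [d [d0 ->]] [d' [d'0 ->]]; exists (fun m => d m + d' m); split.
  by move=> m mN; rewrite d0 ?d'0 ?addr0.
by rewrite -big_split; apply: eq_bigr => m _; rewrite rmorphD mulrDl.
Qed.

Lemma good_spanZ c x : good_span x -> good_span (iota c * x).
Proof.
move=> [d [d0 ->]]; exists (fun m => c * d m); split=> [m /d0->|].
  by rewrite mulr0.
by rewrite mulr_sumr; apply: eq_bigr => m _; rewrite rmorphM mulrA.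
Qed.

Lemma good_span_sum I (s : seq I) (P : pred I) (x : I -> R) :
  (forall i, P i -> good_span (x i)) -> good_span (\sum_(i <- s | P i) x i).
Proof. by move=> xP; elim/big_ind: _ => //; [apply: good_span0|apply: good_spanD]. Qed.

Lemma good_span_monom (m : monom k) : good m -> good_span (monom_value Y m).
Proof.
move=> mg; exists (fun m' => (m' == m)%:R); split=> [m'|].
  by case: eqP => // ->; rewrite mg.
rewrite (bigD1 m) //= eqxx rmorph1 mul1r big1 ?addr0 // => m' /negPf->.
by rewrite rmorph0 mul0r.
Qed.

Definition nonzero (s : seq W) := all (fun w => w != 0) s.
Definition prodY (s : seq W) := \prod_(w <- s) Y w.
Definition weight (s : seq W) := (\sum_(w <- s) height (residue w))%N.

(** Good up to [t^-1] times products of the same length. The error has coefficients in [Fq], not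
    merely in F, so that the final linear system has a matrix t - B with B constant. *)
Definition reducible l (x : R) : Prop := exists y (b : l.-tuple W -> Fq),
  [/\ good_span y, forall w : l.-tuple W, ~~ nonzero w -> b w = 0
    & x = y + iota t^-1 * \sum_(w : l.-tuple W) con (b w) * prodY w].

Lemma reducibleD l x y : reducible l x -> reducible l y -> reducible l (x + y).
Proof.
move=> [x' [b [x'g b0 ->]]] [y' [b' [y'g b'0 ->]]].
exists (x' + y'), (fun w => b w + b' w); split; first exact: good_spanD.
  by move=> w wN; rewrite b0 ?b'0 ?addr0.
rewrite addrACA -mulrDr -big_split /=; congr (_ + _ * _).
by apply: eq_bigr => w _; rewrite polyCD !rmorphD mulrDl.
Qed.

Lemma reducibleZ l c x : reducible l x -> reducible l (con c * x).
Proof.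
move=> [x' [b [x'g b0 ->]]].
exists (con c * x'), (fun w => c * b w); split; first exact: good_spanZ.
  by move=> w wN; rewrite b0 ?mulr0.
rewrite mulrDr mulrCA mulr_sumr; congr (_ + _ * _).
by apply: eq_bigr => w _; rewrite polyCM !rmorphM mulrA.
Qed.

Lemma reducible_good l x : good_span x -> reducible l x.
Proof.
move=> xg; exists x, (fun=> 0); split=> //.
by rewrite big1 ?mulr0 ?addr0 // => w _; rewrite polyC0 !rmorph0 mul0r.
Qed.

Lemma reducible_small s : nonzero s -> reducible (size s) (iota t^-1 * prodY s).
Proof.
move=> s0; exists 0, (fun w => (w == in_tuple s)%:R); split.
- exact: good_span0.
- by move=> w; case: eqP => // ->; rewrite s0.
rewrite add0r (bigD1 (in_tuple s)) //= eqxx polyC1 !rmorph1 mul1r.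
by rewrite big1 ?addr0 // => w /negPf->; rewrite polyC0 !rmorph0 mul0r.
Qed.

Lemma reducible_sum l I (s : seq I) (P : pred I) (x : I -> R) :
  (forall i, P i -> reducible l (x i)) -> reducible l (\sum_(i <- s | P i) x i).
Proof.
move=> xP; elim/big_ind: _ => //; last exact: reducibleD.
exact: reducible_good good_span0.
Qed.

Lemma t_neq0 : t != 0.
Proof. by rewrite /polyF tofrac_eq0 polyX_eq0. Qed.

(** Such a [w] is t w', and the relation for t replaces Y w by [t^-1] times the sum of the Y (w' -
    v) with t v = 0. No argument vanishes, since t (w' - v) = w. *)
Lemma reducible_residue0 s w : nonzero s -> w \in s -> residue w = 0 ->
  reducible (size s) (prodY s).
Proof.
move=> s0 ws w0; have [w' wE] := residue0_shift w0.
have ps := perm_to_rem ws; rewrite /prodY (perm_big _ ps) (perm_size ps) big_cons.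
have := s0; rewrite /nonzero (perm_all _ ps) /= => /andP[w_neq0 rem0].
have -> : Y w = iota t^-1 * \sum_(v | v *m shift_mx Fq n == 0) Y (w' - v).
  have := @YT w'; rewrite -wE => /(_ w_neq0) <-.
  by rewrite mulrA -rmorphM mulVf ?t_neq0 // rmorph1 mul1r.
rewrite -mulrA mulr_suml mulr_sumr; apply: reducible_sum => v v0.
have -> : Y (w' - v) * \prod_(u <- rem w s) Y u = prodY ((w' - v) :: rem w s).
  by rewrite /prodY big_cons.
apply: (@reducible_small ((w' - v) :: rem w s)); rewrite /nonzero /= rem0 andbT.
by apply: contraNneq w_neq0 => E; rewrite wE -[w'](subrK v) E add0r.
Qed.

Lemma nonzero_normalize s : (forall w, w \in s -> residue w != 0) ->
  exists c s', [/\ c != 0, size s' = size s, weight s' = weight s,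
    forall w, w \in s' -> exists i, leading i (residue w) & prodY s = con c * prodY s'].
Proof.
elim: s => [|w s IHs] s0.
  exists 1, [::]; split; rewrite ?oner_eq0 //.
  by rewrite /prodY !big_nil polyC1 !rmorph1 mul1r.
have [v vs|c [s' [c0 s's s'w s'P sE]]] := IHs; first by rewrite s0 // inE vs orbT.
have [a [i [a0 ai]]] := leading_normalize (s0 w (mem_head _ _)).
rewrite -linearZ in ai; exists (a * c), (a *: w :: s'); split.
- by rewrite mulf_neq0.
- by rewrite /= s's.
- by rewrite /weight !big_cons linearZ heightZ //=; congr (_ + _)%N.
- by move=> v; rewrite inE => /predU1P[->|/s'P//]; exists i.
rewrite /prodY !big_cons; move: sE; rewrite /prodY => ->; rewrite YZ // polyCM !rmorphM /=.
have : con a * con a^-1 = 1 by rewrite -!rmorphM /= mulfV // polyC1 !rmorph1.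
by move=> E; rewrite -{1}[Y w]mul1r -E; ring.
Qed.

Lemma good_span_distinct s : (size s <= k)%N ->
    (forall w, w \in s -> exists i, leading i (residue w)) ->
    (forall i v w, v \in s -> w \in s -> leading i (residue v) ->
       leading i (residue w) -> v = w) ->
  good_span (prodY s).
Proof.
move=> sk sP s_inj.
pose f (i : 'I_r) (w : W) := (w \in s) && leading i (residue w).
have kP w : w \in s -> ((count_mem w s).-1 < k)%N.
  move=> ws; have := count_size (pred1 w) s.
  by move: ws; rewrite -has_pred1 has_count; lia.
pose m : monom k := [ffun i => if pick (f i) is Some w then
  omap (pair w) (insub (count_mem w s).-1) else None].
have -> : prodY s = monom_value Y m.
  rewrite /prodY -prodr_undup_exp_count big_uniq ?undup_uniq //=.
  pose g w := [pick i | leading i (residue w)].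
  rewrite (eq_bigl (fun w => w \in s)) => [|w]; last exact: mem_undup.
  transitivity (\prod_(i < r) \prod_(w | f i w) Y w ^+ count_mem w s); last first.
    apply: eq_bigr => i _; rewrite ffunE; case: pickP => [w /andP[ws wi]|f0].
      rewrite (big_pred1 w) => [|v]; last first.
        apply/idP/eqP => [/andP[vs vi]|->]; last by rewrite /f ws.
        exact: s_inj vs ws vi wi.
      rewrite insubT ?kP //= => lt_k; rewrite /= prednK //.
      by rewrite -has_count has_pred1.
    by rewrite big_pred0.
  rewrite (exchange_big_dep (fun w => w \in s)) /= => [|i w _ /andP[]//].
  apply: eq_bigr => w ws; have [i wi] := sP w ws.
  rewrite (big_pred1 i) // => j; rewrite /f ws /=.
  by apply/idP/eqP => [wj|->//]; apply: leading_inj wj wi.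
apply: good_span_monom; apply/forallP => i; rewrite ffunE.
by case: pickP => // w /andP[ws wi]; rewrite insubT ?kP.
Qed.

(** Induction on the sum of the heights of the residues. Two distinct normalized factors with the
    same leading index are separated by 1/v 1/w = 1/(v - w) (1/w - 1/v), where the residue of v - w
    has smaller height. The process stops at a residue 0 or at a good monomial. *)
Lemma prodY_reducible s : (size s <= k)%N -> nonzero s -> reducible (size s) (prodY s).
Proof.
have [N] := ubnP (weight s); elim: N s => // N IHN s; rewrite ltnS => sN sk s0.
have [/hasP[w ws /eqP w0]|/hasPn sr] := boolP (has (fun w => residue w == 0) s).
  exact: reducible_residue0 s0 ws w0.
have [c [s' [c0 s's s'w s'P ->]]] := nonzero_normalize sr.
rewrite -s's in sk *; rewrite -{}s'w in sN; apply: reducibleZ.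
have {s s0 sr s's} s'0 w : w \in s' -> w != 0.
  move=> /s'P[i /leadingP[wi _]]; apply: contra_eq_neq wi => ->.
  by rewrite residueE mxE eq_sym oner_eq0.
move: s' sN sk s'P s'0 => s sN sk sP s0.
pose bad (v w : W) := (v != w) && [exists i, leading i (residue v) && leading i (residue w)].
have [/hasP[v vs /hasP[w ws]]|/hasPn s_inj] := boolP (has (fun v => has (bad v) s) s).
  case/andP=> vw /existsP[i /andP[vi wi]].
  have ps : perm_eq s (v :: w :: rem w (rem v s)).
    apply: perm_trans (perm_to_rem vs) _; rewrite perm_cons; apply: perm_to_rem.
    have := perm_mem (perm_to_rem vs) w.
    by rewrite ws inE eq_sym (negPf vw) => /esym.
  set s' := rem w _ in ps; rewrite (perm_size ps) [prodY s](perm_big _ ps) /= !big_cons.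
  rewrite -/(prodY s').
  have wvv : v - w != 0 by rewrite subr_eq0.
  have -> : Y v * (Y w * prodY s') =
    con 1 * prodY [:: v - w, w & s'] + con (-1) * prodY [:: v - w, v & s'].
    have Nw : Y (- w) = - Y w.
      rewrite -scaleN1r YZ ?oppr_eq0 ?oner_eq0 // invrN1 polyCN rmorphN rmorphN.
      by rewrite !rmorph1 mulN1r.
    have := YM (s0 v vs) (_ : - w != 0) wvv; rewrite oppr_eq0 => /(_ (s0 w ws)).
    rewrite Nw => E; rewrite /prodY !big_cons -/(prodY s') polyCN rmorphN rmorphN.
    rewrite !rmorph1.
    transitivity (- (Y v * - Y w) * prodY s'); first by ring.
    by rewrite E; ring.
  have s'0 u : u \in s' -> u != 0.
    by move=> us; apply: s0; rewrite (perm_mem ps) !inE us !orbT.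
  have sE : size s = (size s').+2 by rewrite (perm_size ps).
  have wt : (height (residue v) + (height (residue w) + weight s') <= N)%N.
    by move: sN; rewrite /weight (perm_big _ ps) !big_cons.
  have dec := leadingB_height vi wi.
  have [hv hw] := (leading_height vi, leading_height wi).
  apply: reducibleD; apply: reducibleZ.
  - apply: (IHN [:: v - w, w & s']).
    + rewrite /weight !big_cons linearB /= -addSn; apply: leq_trans wt.
      by rewrite leq_add2r hv ltnS.
    + by move: sk; rewrite sE.
    + by rewrite /nonzero /= wvv s0 //=; apply/allP.
  apply: (IHN [:: v - w, v & s']).
  + rewrite /weight !big_cons linearB /= -addSn; apply: leq_trans wt.
    by rewrite hv hw leq_add2r ltnS.
  + by move: sk; rewrite sE.
  + by rewrite /nonzero /= wvv s0 //=; apply/allP.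
apply: reducible_good; apply: good_span_distinct => // i v w vs ws vi wi.
have /hasPn/(_ w ws) := s_inj v vs; rewrite negb_and negbK => /orP[/eqP//|].
by move=> /existsPn/(_ i); rewrite vi wi.
Qed.

(* Nakayama's argument at t = oo: in matrix form the reductions read          *)
(* (t - B) P = t G with B over Fq, and char_poly B is invertible in F.        *)
Lemma prodY_good_span s : (size s <= k)%N -> nonzero s -> good_span (prodY s).
Proof.
move=> sk s0; pose S := [pred w : (size s).-tuple W | nonzero w].
have redS (i : 'I_#|S|) : reducible (size s) (prodY (enum_val i)).
  rewrite -[X in reducible X](size_tuple (enum_val i)).
  by apply: prodY_reducible (enum_valP i); rewrite size_tuple.
have [g gP] := choice redS; have [b bP] := choice gP.
pose phi : {rmorphism {poly Fq} -> R} := iota \o @polyF Fq.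
pose P : 'cV[R]_#|S| := \col_(i < #|S|) prodY (enum_val i).
pose A := char_poly_mx (\matrix_(i < #|S|, j < #|S|) b i (enum_val j)).
have AP : map_mx phi A *m P = \col_(i < #|S|) (phi 'X * g i).
  apply/colP => i; have [_ b0 E] := bP i.
  have -> : (\col_(i < #|S|) (phi 'X * g i)) i 0 =
      phi 'X * prodY (enum_val i) - \sum_(w : (size s).-tuple W) con (b i w) * prodY w.
    by rewrite mxE E -[phi 'X]/(iota t) mulrDr mulrA -rmorphM mulfV ?t_neq0 // rmorph1 mul1r addrK.
  have -> : \sum_(w : (size s).-tuple W) con (b i w) * prodY w = \sum_(j < #|S|) con (b i (enum_val j)) * P j 0.
    rewrite (bigID (fun w => w \in S)) /= [X in _ + X]big1 ?addr0 => [|w /b0->]; last first.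
      by rewrite polyC0 !rmorph0 mul0r.
    by rewrite big_enum_val; apply: eq_bigr => j _; rewrite mxE.
  have AE j : map_mx phi A i j = phi 'X *+ (i == j) - con (b i (enum_val j)).
    by rewrite !mxE rmorphB rmorphMn.
  rewrite mxE; under eq_bigr => j _ do rewrite AE mulrBl.
  rewrite sumrB; congr (_ - _); rewrite (bigD1 i) //= eqxx mulr1n mxE.
  by rewrite big1 ?addr0 // => j /negPf ji; rewrite eq_sym ji mul0r.
have sS : in_tuple s \in S by [].
have := congr1 (fun M : 'cV_ _ => (map_mx phi (\adj A) *m M) (enum_rank_in sS (in_tuple s)) 0) AP.
rewrite mulmxA -map_mxM mul_adj_mx -/(char_poly _) map_scalar_mx mul_scalar_mx.
set c := char_poly _; rewrite !mxE enum_rankK_in //= => E.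
have c0 : polyF c != 0 by rewrite /polyF tofrac_eq0 monic_neq0 ?char_poly_monic.
have -> : prodY s = iota (polyF c)^-1 * (phi c * prodY s).
  by rewrite mulrA -rmorphM mulVf // rmorph1 mul1r.
rewrite E; apply/good_spanZ/good_span_sum => j _; rewrite !mxE mulrA -rmorphM.
by apply: good_spanZ; case: (bP j).
Qed.

End Spanning.
End Monomials.

(** * The leading coefficients *)

Section Frobenius.
Variables (Fq : finFieldType) (R : comNzRingType) (c : {rmorphism Fq -> R}).
Local Notation q := #|Fq|.

Lemma pnat_card_pow i : ([pchar R].-nat (q ^ i))%N.
Proof.
have [p p_pr pFq] := finPcharP Fq.
have pR := rmorph_pchar c pFq.
have pq : (p.-nat (q ^ i))%N.
  rewrite pnatX; apply/orP; left; have := abelem_pgroup (fin_ring_pchar_abelem pFq).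
  by rewrite /pgroup cardsT.
by apply: sub_in_pnat pq => l _; rewrite inE => /eqP->.
Qed.

Lemma exprDq i (x y : R) : (x + y) ^+ (q ^ i) = x ^+ (q ^ i) + y ^+ (q ^ i).
Proof. exact: exprDn_pchar (pnat_card_pow i). Qed.

Lemma expr0q i : (0 : R) ^+ (q ^ i) = 0.
Proof. by rewrite expr0n expn_eq0 -leqn0 leqNgt (ltnW (finNzRing_gt1 Fq)). Qed.

Lemma expr_sumq i I (s : seq I) (P : pred I) (f : I -> R) :
  (\sum_(j <- s | P j) f j) ^+ (q ^ i) = \sum_(j <- s | P j) f j ^+ (q ^ i).
Proof. exact: (big_morph _ (exprDq i) (expr0q i)). Qed.

Lemma expr_constq i a : c a ^+ (q ^ i) = c a.
Proof.
rewrite -rmorphXn; congr (c _); elim: i => [|i IHi]; first by rewrite expn0 expr1.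
by rewrite expnSr exprM IHi expf_card.
Qed.
End Frobenius.

Section GenericField.
Variables (Fq : finFieldType) (r : nat).
Local Notation q := #|Fq|.
Local Notation k := {fraction {mpoly Fq[r]}}.

Definition const_k (a : Fq) : k := FracField.tofrac a%:MP.
HB.instance Definition _ := GRing.RMorphism.copy const_k
  (@FracField.tofrac {mpoly Fq[r]} \o @mpolyC r Fq).

Definition var_k (i : 'I_r) : k := FracField.tofrac 'X_i.

(** Exponents have a unique form b q^e + a with all a_i < q^e, so distinct [a] contribute distinct
    monomials. *)
Lemma mcoeff_expq e (B : {mpoly Fq[r]}) (a a0 : 'X_{1..r}) b :
  (forall i, (a i < q ^ e)%N) -> (forall i, (a0 i < q ^ e)%N) ->
  (B ^+ (q ^ e) * 'X_[a])@_(b *+ (q ^ e) + a0) = (B@_b) ^+ (q ^ e) *+ (a == a0).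
Proof.
move=> aQ a0Q; have Q_gt0 : (0 < q ^ e)%N by rewrite expn_gt0 (ltnW (finNzRing_gt1 Fq)).
rewrite {1}[B]mpolyE (expr_sumq (@mpolyC r Fq)) mulr_suml raddf_sum /=.
under eq_bigr => m _.
  rewrite exprZn mpolyXn -scalerAl -mpolyXD mcoeffZ mcoeffX.
  have -> : ((m *+ (q ^ e) + a)%MM == (b *+ (q ^ e) + a0)%MM) = (a == a0) && (m == b).
    apply/eqP/andP => [/mnmP E|[/eqP-> /eqP->//]].
    have E' i : a i = a0 i /\ m i = b i.
      have := E i; rewrite !mnmDE !mulmnE => {}E; split.
        by have := congr1 (modn^~ (q ^ e)%N) E; rewrite /= !modnMDl !modn_small.
      by have := congr1 (divn^~ (q ^ e)%N) E; rewrite /= !divnMDl // !divn_small ?addn0.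
    by split; apply/eqP/mnmP => i; case: (E' i).
  over.
case: (a == a0) => /=; last by rewrite mulr0n big1 // => m _; rewrite mulr0.
rewrite mulr1n; have [bB|bB] := boolP (b \in msupp B).
  rewrite (bigD1_seq b) ?msupp_uniq //= eqxx mulr1 big1 ?addr0 // => m /negPf->.
  by rewrite mulr0.
rewrite (memN_msupp_eq0 bB) expr0n gtn_eqF // big_seq big1 // => m mB.
by case: eqP => [E|]; rewrite ?mulr0 //; rewrite E (negPf bB) in mB.
Qed.

(** Multiplying by the q^e-th power of a common denominator moves the relation to polynomials, where
    [mcoeff_expq] isolates each coefficient. *)
Lemma var_k_p_independent e (D : {ffun 'I_r -> 'I_(q ^ e)} -> k) :
  \sum_a D a ^+ (q ^ e) * \prod_i var_k i ^+ a i = 0 -> forall a, D a = 0.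
Proof.
have [s s0 [B BE]] := common_denominator D; move=> D0 a0.
have {D0} : \sum_a B a ^+ (q ^ e) * 'X_[[multinom (a i : nat) | i < r]] = 0.
  apply/eqP; rewrite -tofrac_eq0 rmorph_sum /=; apply/eqP.
  apply: etrans (etrans (congr1 (GRing.mul (FracField.tofrac s ^+ (q ^ e))) D0) (mulr0 _)).
  rewrite mulr_sumr.
  apply: eq_bigr => a _; rewrite rmorphM rmorphXn /= -BE exprMn mulrA.
  rewrite [_ * D a ^+ _]mulrC; congr (_ * _).
  rewrite mpolyXE_id rmorph_prod; apply: eq_bigr => i _.
  by rewrite rmorphXn mnmE.
move=> /mpolyP B0; suff /eqP : B a0 = 0.
  by rewrite -tofrac_eq0 -BE mulf_eq0 tofrac_eq0 (negPf s0) orbF => /eqP.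
apply/mpolyP => b; rewrite mcoeff0.
have := B0 (b *+ (q ^ e) + [multinom (a0 i : nat) | i < r])%MM.
rewrite raddf_sum mcoeff0 /= (bigD1 a0) //= mcoeff_expq; try by move=> i; rewrite mnmE.
rewrite eqxx big1 ?addr0 => [|a aN]; last first.
  rewrite mcoeff_expq; try by move=> i; rewrite mnmE.
  case: eqP => // /mnmP E; case/eqP: aN; apply/ffunP => i; apply: val_inj.
  by have := E i; rewrite !mnmE.
by rewrite mulr1n => /eqP; rewrite expf_eq0 => /andP[_ /eqP].
Qed.
End GenericField.

Lemma digits_inj r b (f g : 'I_r -> nat) :
    (forall i, f i < b)%N -> (forall i, g i < b)%N ->
  (\sum_i f i * b ^ i = \sum_i g i * b ^ i)%N -> f =1 g.
Proof.
elim: r f g => [|r IHr] f g fb gb; first by move=> _ [].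
have S (h : 'I_r.+1 -> nat) : (\sum_i h i * b ^ i =
    (\sum_(i < r) h (lift ord0 i) * b ^ i) * b + h ord0)%N.
  rewrite big_ord_recl expn0 muln1 addnC big_distrl /=; congr (_ + _)%N.
  by apply: eq_bigr => i _; rewrite /= /bump add1n expnSr mulnA.
have b_gt0 := leq_ltn_trans (leq0n _) (fb ord0).
rewrite !S => E; have Ediv := congr1 (divn^~ b) E; have := congr1 (modn^~ b) E.
rewrite /= !modnMDl !modn_small // => E0.
rewrite /= !divnMDl // !divn_small // !addn0 in Ediv.
have IH := IHr _ _ (fun i => fb _) (fun i => gb _) Ediv.
by move=> i; case: (unliftP ord0 i) => [j|] ->; [apply: IH|].
Qed.

(** * Independence over [Fq] of products of inverses of linear forms *)

Section LinearForms.
Variables (Fq : finFieldType) (r : nat).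
Local Notation k := {fraction {mpoly Fq[r]}}.

Definition linear_form (u : 'rV[Fq]_r) : {mpoly Fq[r]} := \sum_j u 0 j *: 'X_j.

Lemma linear_formP a u v :
  linear_form (a *: u + v) = a *: linear_form u + linear_form v.
Proof.
rewrite /linear_form scaler_sumr -big_split; apply: eq_bigr => j _.
by rewrite !mxE scalerDl scalerA.
Qed.

Lemma mcoeff_linear_form u i : (linear_form u)@_U_(i)%MM = u 0 i.
Proof.
rewrite /linear_form raddf_sum (bigD1 i) //= mcoeffZ mcoeffXU eqxx mulr1.
rewrite big1 ?addr0 // => j /negPf ji.
by rewrite mcoeffZ mcoeffXU ji mulr0.
Qed.

Definition hat_k (u : 'rV[Fq]_r) : k := FracField.tofrac (linear_form u).

Lemma hat_k_is_zmod_morphism : zmod_morphism hat_k.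
Proof.
move=> u v; rewrite /hat_k -tofracB; congr (FracField.tofrac _).
by rewrite addrC -scaleN1r linear_formP scaleN1r addrC.
Qed.
HB.instance Definition _ := GRing.isZmodMorphism.Build _ _ hat_k
  hat_k_is_zmod_morphism.

Lemma hat_kZ a u : hat_k (a *: u) = const_k r a * hat_k u.
Proof.
have lf0 : linear_form 0 = 0 by rewrite /linear_form big1 // => j _; rewrite mxE scale0r.
by rewrite /hat_k -[a *: u]addr0 linear_formP lf0 addr0 -mul_mpolyC tofracM.
Qed.

Lemma hat_k_eq0 u : (hat_k u == 0) = (u == 0).
Proof.
apply/eqP/eqP => [/eqP|->]; last exact: raddf0.
rewrite tofrac_eq0 => /eqP u0; apply/rowP => i; rewrite mxE.
by rewrite -mcoeff_linear_form u0 mcoeff0.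
Qed.

Lemma hat_k_delta i : hat_k (delta_mx 0 i) = var_k Fq i.
Proof.
rewrite /hat_k /linear_form (bigD1 i) //= mxE !eqxx scale1r big1 ?addr0 // => j /negPf ji.
by rewrite mxE eqxx ji scale0r.
Qed.

Lemma hat_kE u : hat_k u = \sum_i const_k r (u 0 i) * var_k Fq i.
Proof.
rewrite {1}[u]row_sum_delta raddf_sum; apply: eq_bigr => i _.
by rewrite -hat_k_delta -hat_kZ.
Qed.

Definition res_monom K := {ffun 'I_r -> option ('rV[Fq]_r * 'I_K)}.

Definition res_good K (m : res_monom K) :=
  [forall i, if m i is Some (u, _) then leading i u else true].

Definition res_value K (m : res_monom K) : k :=
  \prod_i (if m i is Some (u, a) then (hat_k u)^-1 ^+ a.+1 else 1).

Section Independence.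
Variables (K : nat) (m0 : res_monom K).
Hypothesis m0_good : res_good m0.

(** The vectors of [m0], completed by unit vectors. The leading indices make the matrix
    unitriangular, and in the coordinates it defines the forms of [m0] become variables. *)
Let B : 'M[Fq]_r :=
  \matrix_(i, j) (if m0 i is Some (u, _) then u 0 j else (i == j)%:R).

Let B_diag i : B i i = 1.
Proof.
rewrite mxE; have /forallP/(_ i) := m0_good.
by case: (m0 i) => [[u a]|_]; rewrite ?eqxx // => /leadingP[].
Qed.

Let B_upper (i j : 'I_r) : (i < j)%N -> B i j = 0.
Proof.
move=> ij; rewrite mxE; have /forallP/(_ i) := m0_good.
by case: (m0 i) => [[u a]|_]; [move=> /leadingP[_ ->]|case: eqP ij => // ->; rewrite ltnn].
Qed.

Let B_unit : B \in unitmx.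
Proof.
rewrite unitmxE det_trig; last by apply/is_trig_mxP => i j; apply: B_upper.
by rewrite big1 ?unitr1.
Qed.

Let B_leading i (u : 'rV_r) : leading i u -> leading i (u *m invmx B).
Proof.
move=> ui; set al := u *m _; have uE : u = al *m B by rewrite mulmxKV.
have coef (j : 'I_r) : (forall l : 'I_r, (j < l)%N -> al 0 l = 0) -> u 0 j = al 0 j.
  move=> al0; rewrite uE mxE (bigD1 j) //= B_diag mulr1 big1 ?addr0 // => l lj.
  have [jl|jl|/val_inj E] := ltngtP j l; [by rewrite al0 ?mul0r| |by rewrite E eqxx in lj].
  by rewrite B_upper ?mulr0.
have [u1 u0] := leadingP _ _ ui.
have al0 (j : 'I_r) : (i < j)%N -> al 0 j = 0.
  have [N] := ubnP (r - j); elim: N j => // N IHN j jN ij.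
  rewrite -coef ?u0 // => l jl; apply: IHN; last exact: ltn_trans ij jl.
  by have := ltn_ord l; move: jN jl; lia.
by apply/leadingP; split=> //; rewrite -coef.
Qed.

(** The base exceeds all exponents, which are at most K, and it is at least 2 even for K = 0, so
    that [E] increases strictly. *)
Let E i := (K.+2 ^ i)%N.
Let lt_E i j : (i < j)%N -> (E i < E j)%N.
Proof. by move=> ij; rewrite ltn_exp2l. Qed.

Let sub : {rmorphism {mpoly Fq[r]} -> ratfun Fq} :=
  @polyF Fq \o mmap (@polyC Fq) (fun j => \sum_i invmx B j i *: 'X^(E i)).

Let sub_form u : sub (linear_form u) = polyF (\sum_i (u *m invmx B) 0 i *: 'X^(E i)).
Proof.
rewrite /=; congr polyF; rewrite /linear_form raddf_sum /=.
under eq_bigr => j _ do rewrite mmapZ mmapX mmap1U mul_polyC scaler_sumr.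
rewrite exchange_big; apply: eq_bigr => i _; rewrite mxE scaler_suml.
by apply: eq_bigr => j _; rewrite scalerA.
Qed.

(* Substituting x = B^-1 (z^(E 0), z^(E 1), ...) turns the form u into a       *)
(* polynomial in z whose order at 0 is E e, where e <= i if u has leading     *)
(* index i, with equality only when u is the i-th row of B.                   *)
Let sub_order i u : leading i u -> exists e g,
  [/\ (e <= i)%N, sub (linear_form u) = polyF ('X^(E e) * g), g.[0] != 0
    & (u = row i B -> e = i) /\ (e = i -> u = row i B /\ g = 1)].
Proof.
move=> /B_leading; set al := u *m _ => /leadingP[al1 al0].
have ali : al 0 i != 0 by rewrite al1 oner_eq0.
case: (@arg_minnP _ i (fun j => al 0 j != 0) (fun j => j : nat) ali) => e ale emin.
exists e, (\sum_(j < r | (e <= j)%N) al 0 j *: 'X^(E j - E e)); split.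
- exact: emin.
- rewrite sub_form -/al; congr polyF; rewrite (bigID (fun j : 'I_r => (e <= j)%N)) /=.
  rewrite [X in _ + X]big1 ?addr0 => [|j]; last first.
    by apply: contraNeq => alj; apply: emin; apply: contraNneq alj => ->; rewrite scale0r.
  rewrite mulr_sumr; apply: eq_bigr => j ej; rewrite -scalerAr -exprD subnKC //.
  by rewrite leq_exp2l.
- rewrite horner_sum (bigD1 e) //= hornerZ subnn expr0 hornerC mulr1.
  rewrite big1 ?addr0 // => j /andP[ej je]; rewrite hornerZ hornerXn expr0n.
  suff -> : (E j - E e == 0)%N = false by rewrite mulr0.
  by rewrite subn_eq0 leqNgt lt_E // ltn_neqAle ej andbT eq_sym.
split=> [uB|/val_inj ei].
  apply/eqP; rewrite eqn_leq emin //= leqNgt; apply: contraNN ale => ei.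
  rewrite /al uB rowE -mulmxA mulmxV // mulmx1 mxE (_ : (e == i) = false) ?andbF //.
  by apply/eqP => E'; rewrite E' ltnn in ei.
have alE : al = delta_mx 0 i.
  apply/rowP => j; rewrite [RHS]mxE eqxx; have [ij|ij|/val_inj<-] := ltngtP i j.
  - by rewrite al0 //; case: eqP => // jE; rewrite jE ltnn in ij.
  - apply/eqP; rewrite (_ : (j == i) = false) /= ?mulr0n; last first.
      by apply/eqP => jE; rewrite jE ltnn in ij.
    by apply: contraLR ij => /emin; rewrite ei -leqNgt.
  - by rewrite eqxx al1.
split; first by rewrite rowE -alE mulmxKV.
rewrite -ei in alE al1 *; rewrite (bigD1 e) //= al1 scale1r subnn big1 ?addr0 // => j /andP[_ je].
by rewrite alE mxE (negPf je) andbF scale0r.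
Qed.

Let expo (m : res_monom K) i : nat := if m i is Some (u, a) then a.+1 else 0.
Let size_exp (m : res_monom K) := (\sum_i expo m i * E i)%N.

Let expo_inj m : size_exp m = size_exp m0 -> forall i, expo m i = expo m0 i.
Proof.
apply: digits_inj => i; rewrite /expo; last by case: (m0 i) => [[u a]|//]; rewrite !ltnS ltnW.
by case: (m i) => [[u a]|//]; rewrite !ltnS ltnW.
Qed.

(** The pole of [m] at z = 0 has order at most [size_exp m], hence at most [size_exp m0]. Equality
    forces equal exponents, by uniqueness of digits, and order [E i] for the i-th form, so that its
    vector is a row of [B]. Hence only [m0] leaves a nonzero value, which is 1. *)
Let res_value_order m : res_good m -> (size_exp m <= size_exp m0)%N ->
  exists2 x, specializes sub (res_value m) x &
    specializes (horner_eval 0) (polyF 'X^(size_exp m0) * x) ((m == m0)%:R : Fq).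
Proof.
move=> mg le_m; pose P i (eg : nat * {poly Fq}) := if m i is Some (u, a) then
  [/\ (eg.1 <= i)%N, sub (linear_form u) = polyF ('X^(E eg.1) * eg.2), eg.2.[0] != 0
    & (u = row i B -> eg.1 = i) /\ (eg.1 = i -> u = row i B /\ eg.2 = 1)]
  else eg.1 = i /\ eg.2 = 1.
have /choice[eg egP] i : exists eg, P i eg.
  rewrite /P; have /forallP/(_ i) := mg; case: (m i) => [[u a] /sub_order|_].
    by case=> e [g egP]; exists (e, g).
  by exists (i : nat, 1).
pose x := \prod_i (polyF ('X^(E (eg i).1) * (eg i).2))^-1 ^+ expo m i.
exists x.
  apply: specializes_prod => i _; rewrite /expo; have := egP i; rewrite /P.
  case: (m i) => [[u a] [_ Esub g0 _]|_]; last first.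
    by rewrite expr0 -tofrac1 -(rmorph1 sub); apply: specializes_tofrac.
  rewrite -Esub; apply/specializesX/specializesV/specializes_tofrac; rewrite Esub.
  rewrite /polyF tofrac_eq0; apply: mulf_neq0; first by rewrite monic_neq0 ?monicXn.
  by apply: contraNneq g0 => ->; rewrite horner0.
pose S := (\sum_i expo m i * E (eg i).1)%N.
have eg_le i : ((eg i).1 <= i)%N.
  by have := egP i; rewrite /P; case: (m i) => [[u a] []|[-> _]].
have g0 i : (eg i).2.[0] != 0.
  by have := egP i; rewrite /P; case: (m i) => [[u a] []|[_ ->]]; rewrite ?hornerC ?oner_eq0.
have le_E i : (expo m i * E (eg i).1 <= expo m i * E i)%N.
  by rewrite leq_mul2l leq_exp2l // eg_le orbT.
have le_S : (S <= size_exp m)%N by apply: leq_sum => i _.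
have -> : polyF 'X^(size_exp m0) * x =
    polyF 'X^(size_exp m0 - S) * \prod_i (polyF (eg i).2)^-1 ^+ expo m i.
  rewrite -[in LHS](subnK (leq_trans le_S le_m)) exprD rmorphM -mulrA; congr (_ * _).
  rewrite /S -prodrXr rmorph_prod -big_split /=; apply: eq_bigr => i _.
  rewrite rmorphM invfM exprMn mulrA mulnC exprM rmorphXn -exprMn mulfV ?expr1n ?mul1r //.
  by rewrite /polyF tofrac_eq0 monic_neq0 ?monicXn.
have ord_eq i : m i = None \/ (eg i).1 = i -> (expo m i * E (eg i).1 = expo m i * E i)%N.
  by rewrite /expo; case=> [->|->].
have -> : ((m == m0)%:R : Fq) =
    'X^(size_exp m0 - S).[0] * \prod_i ((eg i).2.[0])^-1 ^+ expo m i.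
  rewrite hornerXn expr0n subn_eq0; case: eqP => [mE|mN].
    have egE i : (eg i).1 = i /\ (eg i).2 = 1.
      have := egP i; rewrite /P mE; case mi: (m0 i) => [[u a]|] // [_ _ _ [ueg eg2]].
      have uB : u = row i B by apply/rowP => j; rewrite !mxE mi.
      by split; [apply: ueg|case: (eg2 (ueg uB))].
    rewrite leq_eqVlt [_ == S](_ : _ = true) /= ?big1 ?mulr1 //.
      by move=> i _; rewrite (egE i).2 hornerC invr1 expr1n.
    by rewrite /S -mE; apply/eqP/eq_bigr => i _; rewrite (egE i).1.
  case: leqP => [le_mS|]; last by rewrite mul0r.
  case: mN; have eq_m : size_exp m = size_exp m0.
    by apply/eqP; rewrite eqn_leq le_m (leq_trans le_mS).
  have /expo_inj ex := eq_m; apply/ffunP => i.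
  have le_i : (expo m i * E i <= expo m i * E (eg i).1)%N.
    have : (size_exp m <= S)%N by rewrite eq_m.
    rewrite /size_exp /S (bigD1 i) //= [X in (_ <= X)%N -> _](bigD1 i) //= => le_sum.
    rewrite -(leq_add2r (\sum_(j < r | j != i) expo m j * E j)).
    by apply: leq_trans le_sum _; rewrite leq_add2l; apply: leq_sum => j _.
  have := egP i; have := ex i; have := le_i; rewrite /P /expo.
  case mi: (m i) => [[u a]|]; last by case: (m0 i) => [[]|].
  case m0i: (m0 i) => [[u0 a0]|] // le_E' [a0E] [_ _ _ [_ eg_row]].
  have /eg_row[uB _] : (eg i).1 = i.
    by apply/eqP; rewrite eqn_leq eg_le; move: le_E'; rewrite leq_mul2l /= leq_exp2l.
  congr (Some (_, _)); last exact: val_inj.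
  by rewrite uB; apply/rowP => j; rewrite !mxE m0i.
apply: specializesM; first exact: (specializes_tofrac (horner_eval 0)).
apply: specializes_prod => i _; apply/specializesX/specializesV => //.
exact: (specializes_tofrac (horner_eval 0)).
Qed.

(** The relation is carried to Fq(z), multiplied by z^(size_exp m0) and evaluated at z = 0, which
    keeps the term of [m0] alone. *)
Lemma res_value_independent_at (c : res_monom K -> Fq) :
    (forall m, c m != 0 -> res_good m /\ (size_exp m <= size_exp m0)%N) ->
  \sum_m const_k r (c m) * res_value m = 0 -> c m0 = 0.
Proof.
move=> cP c0; have /choice[x xP] m : exists x : ratfun Fq, c m != 0 ->
    specializes sub (res_value m) x /\
    specializes (horner_eval 0) (polyF 'X^(size_exp m0) * x) ((m == m0)%:R : Fq).
  have [cm0|/cP[mg le_m]] := eqVneq (c m) 0; first by exists 0.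
  by have [y y1 y2] := res_value_order mg le_m; exists y.
have : specializes sub 0 (\sum_(m | c m != 0) polyF (c m)%:P * x m).
  rewrite -[X in specializes _ X]c0 (bigID (fun m => c m != 0)) /= [X in _ + X]big1 ?addr0.
    apply: specializes_sum => m /xP[y1 _]; apply: specializesM => //.
    have -> : polyF (c m)%:P = sub (c m)%:MP by rewrite /= mmapC.
    exact: specializes_tofrac.
  by move=> m; rewrite negbK => /eqP->; rewrite rmorph0 mul0r.
have z0 : specializes sub 0 0 by rewrite -tofrac0 -(rmorph0 sub); apply: specializes_tofrac.
move=> /specializes_fun/(_ z0) xs0.
have : specializes (horner_eval (0 : Fq)) 0 (\sum_(m | c m != 0) c m * (m == m0)%:R).
  rewrite -[X in specializes _ X](mulr0 (polyF 'X^(size_exp m0))) -xs0 mulr_sumr.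
  apply: specializes_sum => m /xP[_ y2]; rewrite mulrCA; apply: specializesM => //.
  by rewrite -[X in specializes _ _ X](hornerC (c m) 0); apply: specializes_tofrac.
have z1 : specializes (horner_eval (0 : Fq)) 0 0.
  by rewrite -[X in specializes _ _ X](hornerC 0 0) -tofrac0; apply: specializes_tofrac.
move=> /specializes_fun/(_ z1); have [//|cm0] := eqVneq (c m0) 0.
rewrite (bigD1 m0) //= eqxx mulr1 big1 ?addr0 // => m /andP[_ /negPf->].
by rewrite mulr0.
Qed.

End Independence.

Lemma res_value_independent K (c : res_monom K -> Fq) :
    (forall m, ~~ res_good m -> c m = 0) ->
  \sum_m const_k r (c m) * res_value m = 0 -> forall m, c m = 0.
Proof.
move=> cg c0 m; apply/eqP; have [//|cm] := eqVneq (c m) 0.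
pose wt (m : res_monom K) :=
  (\sum_i (if m i is Some (_, a) then a.+1 else 0) * K.+2 ^ i)%N.
case: (@arg_maxnP _ m (fun m => c m != 0) wt cm) => m0 cm0 m0max.
have m0_good : res_good m0 by apply: contraNT cm0 => /cg->.
case/eqP: cm0; apply: (res_value_independent_at m0_good _ c0) => m' cm'.
split; last exact: m0max.
by apply: contraNT cm' => /cg->.
Qed.

End LinearForms.

(** * Torsion points of a Drinfeld module *)

Section AdditivePolynomials.
Variables (Fq : finFieldType).
Local Notation q := #|Fq|.

Lemma card_gt1 : (1 < q)%N.
Proof. exact: finNzRing_gt1. Qed.

Lemma natr_card : q%:R = 0 :> Fq.
Proof.
have /esym := expg_cardG (in_setT (1 : Fq)).
by rewrite FinRing.zmodXgE cardsT => <-.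
Qed.

(** If the q-polynomial E vanishes at x_0, ..., x_(m-1), then E^q - E(x_m)^(q-1) E vanishes at x_m
    as well, and it is again a monic q-polynomial. *)
Lemma qpoly_vanishing (L : fieldType) (c : {rmorphism Fq -> L}) m (x : nat -> L) :
  exists e : nat -> L, [/\ e m = 1, forall l, (m < l)%N -> e l = 0
    & forall i, (i < m)%N -> \sum_(l < m.+1) e l * x i ^+ (q ^ l) = 0].
Proof.
elim: m => [|m [e [em e0 ex]]].
  by exists (fun l => (l == 0)%:R); split=> // l; rewrite lt0n => /negPf->.
pose E z := \sum_(l < m.+1) e l * z ^+ (q ^ l).
pose e' l := (if l is l'.+1 then e l' ^+ q else 0) - E (x m) ^+ q.-1 * e l.
have e'E z : \sum_(l < m.+2) e' l * z ^+ (q ^ l) = E z ^+ q - E (x m) ^+ q.-1 * E z.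
  under eq_bigr => l _ do rewrite mulrBl.
  rewrite sumrB; congr (_ - _).
    rewrite big_ord_recl mul0r add0r -[q in RHS]expn1 /E (expr_sumq c).
    by apply: eq_bigr => l _; rewrite exprMn expn1 -exprM -expnSr.
  rewrite big_ord_recr /= e0 // mulr0 mul0r addr0 /E mulr_sumr.
  by apply: eq_bigr => l _; rewrite mulrA.
have z0 : (0 : L) ^+ q = 0 by rewrite expr0n gtn_eqF // ltnW ?card_gt1.
exists e'; split.
- by rewrite /e' em expr1n (e0 m.+1) // mulr0 subr0.
- case=> // l ml; rewrite /e' (e0 l) // (e0 l.+1) ?mulr0 ?subr0 ?z0 //; exact: ltnW.
move=> i; rewrite e'E ltnS leq_eqVlt => /predU1P[->|im].
  by rewrite -exprSr prednK ?subrr // ltnW ?card_gt1.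
by rewrite [E (x i)](ex i im) mulr0 subr0.
Qed.

Variable r : nat.
Local Notation k := {fraction {mpoly Fq[r]}}.

(** The monic q-polynomial killing the x_j has the q^r linear forms as distinct roots, so it is
    separable. Its derivative is its linear coefficient, which is therefore nonzero and can be
    normalized to 1. *)
Lemma lattice_poly : exists d : nat -> k, [/\ d 0 = 1, d r != 0
  & forall u : 'rV[Fq]_r, \sum_(l < r.+1) d l * hat_k u ^+ (q ^ l) = 0].
Proof.
pose x i : k := if insub i is Some i' then var_k Fq i' else 0.
have [e [er e0 ex]] := qpoly_vanishing (const_k r : {rmorphism Fq -> k}) r x.
have eu (u : 'rV[Fq]_r) : \sum_(l < r.+1) e l * hat_k u ^+ (q ^ l) = 0.
  under eq_bigr => l _ do rewrite hat_kE (expr_sumq (const_k r : {rmorphism Fq -> k})) mulr_sumr.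
  rewrite exchange_big big1 //= => i _.
  transitivity (const_k r (u 0 i) * \sum_(l < r.+1) e l * var_k Fq i ^+ (q ^ l)).
    rewrite mulr_sumr; apply: eq_bigr => l _.
    by rewrite exprMn (expr_constq (const_k r : {rmorphism Fq -> k})) mulrCA.
  by have := ex i (ltn_ord i); rewrite /x valK => ->; rewrite mulr0.
pose p := \sum_(l < r.+1) e l *: 'X^(q ^ l).
have sz_p : size p = (q ^ r).+1.
  rewrite /p big_ord_recr /= er scale1r addrC size_polyDl size_polyXn //.
  rewrite ltnS; apply: leq_trans (size_sum _ _ _) _; apply/bigmax_leqP => l _.
  apply: leq_trans (size_scale_leq _ _) _; rewrite size_polyXn.
  by rewrite ltn_exp2l ?card_gt1.
have lc_p : lead_coef p = 1.
  rewrite lead_coefE sz_p /= /p coef_sum big_ord_recr /= coefZ coefXn eqxx er mulr1.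
  rewrite big1 ?add0r // => l _; rewrite coefZ coefXn.
  by rewrite eqn_exp2l ?card_gt1 // gtn_eqF ?mulr0.
have p_root u : root p (hat_k u).
  rewrite rootE /p horner_sum -[X in _ == X](eu u); apply/eqP.
  by apply: eq_bigr => l _; rewrite hornerZ hornerXn.
pose rs := [seq hat_k u | u <- enum {: 'rV[Fq]_r}].
have rs_uniq : uniq rs.
  rewrite map_inj_uniq ?enum_uniq // => u v /eqP.
  by rewrite -subr_eq0 -raddfB hat_k_eq0 subr_eq0 => /eqP.
have pE : p = \prod_(z <- rs) ('X - z%:P).
  rewrite -[RHS]scale1r -lc_p; apply: all_roots_prod_XsubC.
  - by rewrite sz_p size_map -cardE card_mx mul1n.
  - by apply/allP => z /mapP[u _ ->].
  - by rewrite uniq_rootsE.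
have e0_neq0 : e 0 != 0.
  have : separable_poly p by rewrite pE separable_prod_XsubC.
  have -> : separable_poly p = coprimep p (e 0)%:P.
    rewrite unlock; congr coprimep.
    rewrite /p big_ord_recl /= derivD derivZ derivX raddf_sum big1 ?addr0 ?alg_polyC //= => l _.
    rewrite derivZ derivXn /= /bump add1n expnS -mulr_natl natrM.
    suff -> : q%:R = 0 :> {poly k} by rewrite !mul0r scaler0.
    by rewrite -polyC_natr -(rmorph_nat (const_k r : {rmorphism Fq -> k})) natr_card !rmorph0.
  by apply: contraTneq => ->; rewrite polyC0 coprimep0 -size_poly_eq1 sz_p eqSS expn_eq0 eqn0Ngt ltnW ?card_gt1.
exists (fun l => e l / e 0); split; first by rewrite mulfV.
  by rewrite er mul1r invr_eq0.
move=> u; transitivity ((e 0)^-1 * \sum_(l < r.+1) e l * hat_k u ^+ (q ^ l)).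
  by rewrite mulr_sumr; apply: eq_bigr => l _; rewrite mulrAC mulrC.
by rewrite eu mulr0.
Qed.

End AdditivePolynomials.

Lemma sum_inv_root (L : fieldType) (s : seq L) v : v \notin s ->
  \sum_(w <- s) (v - w)^-1 =
  (\prod_(w <- s) ('X - w%:P))^`().[v] / (\prod_(w <- s) ('X - w%:P)).[v].
Proof.
elim: s => [|w s IHs]; first by rewrite !big_nil derivC horner0 mul0r.
rewrite inE negb_or => /andP[vw vs]; rewrite !big_cons {}IHs //.
have P0 : (\prod_(z <- s) ('X - z%:P)).[v] != 0.
  by have := root_prod_XsubC s v; rewrite rootE => ->.
move: P0; set P := \prod_(_ <- _) _ => P0.
rewrite derivM derivXsubC mul1r hornerD !hornerM hornerXsubC.
by field; rewrite P0 subr_eq0 vw.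
Qed.

Section DrinfeldModule.
Variables (Fq : finFieldType) (r n : nat) (k : fieldType).
Local Notation q := #|Fq|.
Local Notation W := 'M[Fq]_(r, n.+1).
Local Notation S := (shift_mx Fq n).
Variables (c : {rmorphism Fq -> k}) (x : {additive 'rV[Fq]_r -> k}) (d : nat -> k).
Hypothesis xZ : forall a u, x (a *: u) = c a * x u.
Hypothesis x_eq0 : forall u, (x u == 0) = (u == 0).
Hypothesis d0 : d 0 = 1.
Hypothesis dr : d r != 0.
Hypothesis d_root : forall u, \sum_(l < r.+1) d l * x u ^+ (q ^ l) = 0.
Variables (Om : fieldType) (J : {rmorphism {poly k} -> Om}).
Hypothesis J_inj : injective J.

Local Notation t := (J 'X).

Definition const_O : Fq -> Om := J \o @polyC k \o c.
HB.instance Definition _ := GRing.RMorphism.on const_O.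

(** A Drinfeld module of rank r, scaled so that its t-torsion consists of the [x u], which lie in
    k. *)
Definition phi (z : Om) := t * \sum_(l < r.+1) J (d l)%:P * z ^+ (q ^ l).

Lemma t_O_neq0 : t != 0.
Proof. by rewrite -(rmorph0 J) (inj_eq J_inj) polyX_eq0. Qed.

Lemma phiD y z : phi (y + z) = phi y + phi z.
Proof.
rewrite /phi -mulrDr -big_split; congr (_ * _); apply: eq_bigr => l _.
by rewrite (exprDq const_O) mulrDr.
Qed.

Lemma phi_const a z : phi (const_O a * z) = const_O a * phi z.
Proof.
rewrite /phi mulrCA; congr (_ * _); rewrite mulr_sumr; apply: eq_bigr => l _.
by rewrite exprMn (expr_constq const_O) mulrCA.
Qed.

Lemma iter_phiD m y z : iter m phi (y + z) = iter m phi y + iter m phi z.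
Proof. by elim: m => //= m ->; rewrite phiD. Qed.

Lemma iter_phi_const m a z : iter m phi (const_O a * z) = const_O a * iter m phi z.
Proof. by elim: m => //= m ->; rewrite phi_const. Qed.

Lemma iter_phi0 m : iter m phi 0 = 0.
Proof. by have := iter_phi_const m 0 0; rewrite rmorph0 !mul0r. Qed.

Lemma iter_phi_sum m I (s : seq I) (P : pred I) (f : I -> Om) :
  iter m phi (\sum_(i <- s | P i) f i) = \sum_(i <- s | P i) iter m phi (f i).
Proof. exact: (big_morph _ (iter_phiD m) (iter_phi0 m)). Qed.

Lemma phi_x u : phi (J (x u)%:P) = 0.
Proof.
transitivity (t * J (\sum_(l < r.+1) d l * x u ^+ (q ^ l))%:P); last first.
  by rewrite d_root polyC0 rmorph0 mulr0.
rewrite /phi !rmorph_sum; congr (_ * _); apply: eq_bigr => l _.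
by rewrite !rmorphM !rmorphXn.
Qed.

Section Points.
Variable e : 'I_r -> Om.
Hypothesis eP : forall j, iter n phi (e j) = J (x (delta_mx 0 j))%:P.

Definition hat (M : W) : Om := \sum_j \sum_m const_O (M j m) * iter m phi (e j).

Lemma hatZD a M N : hat (a *: M + N) = const_O a * hat M + hat N.
Proof.
rewrite /hat mulr_sumr -big_split; apply: eq_bigr => j _ /=.
rewrite mulr_sumr -big_split; apply: eq_bigr => m _ /=.
by rewrite !mxE rmorphD rmorphM mulrDl mulrA.
Qed.

Lemma hat_is_zmod_morphism : zmod_morphism hat.
Proof.
by move=> M N; rewrite addrC -scaleN1r hatZD rmorphN rmorph1 mulN1r addrC.
Qed.
HB.instance Definition _ := GRing.isZmodMorphism.Build W Om hat hat_is_zmod_morphism.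

Lemma hatZ a M : hat (a *: M) = const_O a * hat M.
Proof. by rewrite -[a *: M]addr0 hatZD raddf0 addr0. Qed.

(** Each power of phi is raised by one, and the top one is lost because phi^(n+1) (e_j) = phi (x_j)
    = 0. *)
Lemma phi_hat M : phi (hat M) = hat (M *m S).
Proof.
rewrite -[LHS]/(iter 1 phi _) /hat iter_phi_sum; apply: eq_bigr => j _.
rewrite iter_phi_sum [RHS]big_ord_recl mulmx_shiftE rmorph0 mul0r add0r.
rewrite big_ord_recr /= [X in _ + X](_ : _ = 0) ?addr0; last first.
  by rewrite phi_const eP phi_x mulr0.
apply: eq_bigr => m _; rewrite phi_const mulmx_shiftE !lift0 /=.
by congr (const_O (M j _) * _); apply: val_inj; rewrite /= inordK // ltnW // ltnS.
Qed.

Lemma iter_phi_hat nu M : iter nu phi (hat M) = hat (M *m S ^+ nu).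
Proof.
elim: nu => [|nu IHnu]; first by rewrite /= mulmx1.
by rewrite iterS IHnu phi_hat -mulmxA exprSr.
Qed.

Lemma hat_top M : hat (M *m S ^+ n) = J (x (residue M))%:P.
Proof.
rewrite {1}[residue M]row_sum_delta /hat !raddf_sum; apply: eq_bigr => j _.
rewrite big_ord_recr /= mulmx_shift_top /= eqxx eP xZ polyCM rmorphM big1 ?add0r // => m _.
by rewrite mulmx_shift_top /= ltn_eqF // rmorph0 mul0r.
Qed.

(** If the columns before [m] vanish, phi^(n-m) moves column [m] to the last position, where
    [hat_top] gives [x] of this column; and [x] is injective. *)
Lemma hat_eq0 M : (hat M == 0) = (M == 0).
Proof.
clear dr; apply/eqP/eqP => [M0|->]; last exact: raddf0.
suff H m : (m < n.+1)%N -> forall j, M j (inord m) = 0.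
  by apply/matrixP => j m; rewrite mxE -[m]inord_val H.
elim/ltn_ind: m => m IHm; rewrite ltnS => le_mn j.
pose N : W := \matrix_(j, l) if l == 0 then M j (inord m) else 0.
have NE : M *m S ^+ (n - m) = N *m S ^+ n.
  apply/matrixP => i l; rewrite [RHS]mulmx_shift_top residueE [N _ _]mxE eqxx mulmx_shift_expE.
  have ltl := ltn_ord l; case: leqP => [le_l|]; last by case: eqP => // ->; lia.
  case: eqP => [->|lN]; first by rewrite subKn.
  by apply: IHm; lia.
have /eqP : iter (n - m) phi (hat M) = 0 by rewrite M0 iter_phi0.
rewrite iter_phi_hat NE hat_top -(rmorph0 J) (inj_eq J_inj) polyC_eq0 x_eq0.
by move/eqP/rowP/(_ j); rewrite residueE !mxE.
Qed.

Lemma hat_inj : injective hat.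
Proof. by apply: raddf_inj => M /eqP; rewrite hat_eq0 => /eqP. Qed.

End Points.
End DrinfeldModule.

Section Kernel.
Variables (Fq : finFieldType) (r n : nat).
Local Notation W := 'M[Fq]_(r, n.+1).
Local Notation S := (shift_mx Fq n).

(** This count is the degree of phi^nu, so that the points [hat N] with t^nu N = 0 exhaust its
    roots. *)
Lemma card_ker_shift nu : (nu <= n.+1)%N ->
  #|[set M : W | M *m S ^+ nu == 0]| = (#|Fq| ^ (r * nu))%N.
Proof.
move=> le_nu; pose f (N : 'M[Fq]_(r, nu)) : W :=
  \matrix_(j, m) if insub (m - (n.+1 - nu))%N is Some l then
     if (n.+1 - nu <= m)%N then N j l else 0 else 0.
have ltm (l : 'I_nu) : (l + (n.+1 - nu) < n.+1)%N by have := ltn_ord l; lia.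
have fE N j (l : 'I_nu) : f N j (Ordinal (ltm l)) = N j l.
  by rewrite mxE /= addnK valK leq_addl.
have f_inj : injective f.
  by move=> N N' /matrixP E; apply/matrixP => j l; rewrite -!fE E.
have -> : [set M : W | M *m S ^+ nu == 0] = f @: setT.
  apply/setP => M; rewrite inE; apply/eqP/imsetP => [M0|[N _ ->]].
    exists (\matrix_(j, l) M j (Ordinal (ltm l))) => //.
    apply/matrixP => j m; rewrite mxE.
    have [le_m|lt_m] := leqP (n.+1 - nu) m; last first.
      have /matrixP/(_ j (inord (m + nu))) := M0.
      rewrite mulmx_shift_expE inordK; last by lia.
      by rewrite leq_addl addnK inord_val mxE => ->; case: insub.
    rewrite insubT /= => [|lt]; first by have := ltn_ord m; lia.
    by rewrite mxE; congr (M j _); apply: val_inj; rewrite /= subnK.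
  apply/matrixP => j m; rewrite mulmx_shift_expE [RHS]mxE; case: leqP => // le_m.
  rewrite mxE; case: insubP => // l _ _; rewrite inordK; last by have := ltn_ord m; lia.
  by rewrite ifF //; apply/negbTE; have := ltn_ord m; lia.
by rewrite card_imset // cardsT card_mx.
Qed.

End Kernel.

(** * The iterates of [phi] and the power sums over a residue class *)

Section Iterates.
Variables (Fq : finFieldType) (r : nat) (k : fieldType).
Local Notation q := #|Fq|.
Variables (c : {rmorphism Fq -> k}) (d : nat -> k).
Hypothesis d0 : d 0 = 1.
Hypothesis dr : d r != 0.

(* H_m, where phi^m = t^m H_m; t is the variable of the inner {poly k}.       *)
Fixpoint iterate m : {poly {poly k}} :=
  if m is m'.+1 then
    \sum_(l < r.+1) ((d l)%:P * 'X^(m' * (q ^ l - 1)))%:P * iterate m' ^+ (q ^ l)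
  else 'X.

(** Counting the degree in t from the order [i] in X makes the slope [b] stable under products. *)
Definition t_bounded b i (f : {poly {poly k}}) : Prop :=
  forall l, ((l < i)%N -> f`_l = 0) /\ (size (f`_l)%R <= b * (l - i) + 1)%N.

Lemma t_boundedM b i j f g :
  t_bounded b i f -> t_bounded b j g -> t_bounded b (i + j) (f * g).
Proof.
clear c d d0 dr; move=> fb gb l; rewrite coefM; split=> [lt_l|].
  rewrite big1 // => -[m /= le_m] _; have [lt_m|le_im] := ltnP m i.
    by rewrite (fb m).1 ?mul0r.
  by rewrite (gb (l - m)%N).1 ?mulr0 //; lia.
apply: leq_trans (size_sum _ _ _) _; apply/bigmax_leqP => -[m /= le_m] _.
have [lt_m|le_im] := ltnP m i; first by rewrite (fb m).1 // mul0r size_poly0.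
have [lt_lm|le_lm] := ltnP (l - m) j; first by rewrite (gb (l - m)%N).1 // mulr0 size_poly0.
apply: leq_trans (size_polyMleq _ _) _.
have := (fb m).2; have := (gb (l - m)%N).2.
have -> : (l - (i + j) = (m - i) + (l - m - j))%N by lia.
rewrite mulnDr; move: (b * (m - i))%N (b * (l - m - j))%N => A B.
by move: (size _) (size _) => x y; lia.
Qed.

Lemma t_boundedX b i f m : t_bounded b i f -> t_bounded b (i * m) (f ^+ m).
Proof.
move=> fb; elim: m => [|m IHm]; last by rewrite exprS mulnS; apply: t_boundedM.
move=> l; rewrite expr0 muln0 coef1; split=> //.
by case: (l == 0)%N; rewrite ?size_poly1 ?size_poly0 ?addn1.
Qed.

(** In the coefficient of X^i, the factor t^(m (q^l - 1)) and the q^l-th power of H_m give degree at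
    most m (q^l - 1) + (m - 1) (i - q^l), hence at most m (i - 1). *)
Lemma iterate_bounded m : t_bounded m.-1 1 (iterate m) /\ (iterate m)`_1 = 1.
Proof.
clear c dr; elim: m => [|m [IHb IH1]].
  split=> [l|]; rewrite /= coefX //; case: l => [|[|l]] //=.
  - by rewrite size_poly0.
  - by rewrite size_poly1.
  - by rewrite size_poly0.
have term (l : 'I_r.+1) i : ((i < q ^ l)%N -> (iterate m ^+ (q ^ l))`_i = 0) /\
    (size ((iterate m ^+ (q ^ l))`_i)%R <= m.-1 * (i - q ^ l) + 1)%N.
  by have := t_boundedX (q ^ l) IHb i; rewrite mul1n.
have ql_gt0 l : (0 < q ^ l)%N by rewrite expn_gt0 ltnW ?card_gt1.
split=> [i|] /=; last first.
  rewrite coef_sum big_ord_recl coefCM expn0 subnn muln0 expr0 mulr1 expr1 IH1 mulr1 d0.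
  rewrite big1 ?addr0 // => l _; rewrite coefCM (term _ _).1 ?mulr0 //.
  apply: (@leq_trans (q ^ 1)); first by rewrite expn1 card_gt1.
  by rewrite leq_exp2l ?card_gt1 // lift0.
split=> [|]; first rewrite ltnS leqn0 => /eqP->.
  rewrite coef_sum big1 // => l _; rewrite coefCM (term _ _).1 ?mulr0 //.
rewrite coef_sum; apply: leq_trans (size_sum _ _ _) _; apply/bigmax_leqP => l _.
rewrite coefCM -mulrA; have [lt_i|le_i] := ltnP i (q ^ l).
  by rewrite (term _ _).1 // !mulr0 size_poly0.
apply: leq_trans (size_polyMleq _ _) _; apply: (@leq_trans (size ('X^(m * (q ^ l - 1)) * (iterate m ^+ (q ^ l))`_i))%R).
  by rewrite -subn1 leq_subLR leq_add2r size_polyC_leq1.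
apply: leq_trans (size_polyMleq _ _) _; rewrite size_polyXn /=.
apply: leq_trans (leq_add (leqnn _) (term l i).2) _; rewrite addnA leq_add2r.
have ->: (i - 1 = (q ^ l - 1) + (i - q ^ l))%N by have := ql_gt0 l; lia.
by rewrite mulnDr leq_add2l leq_mul2r leq_pred orbT.
Qed.

Section Evaluation.
Variables (Om : fieldType) (J : {rmorphism {poly k} -> Om}).
Hypothesis J_inj : injective J.
Local Notation t := (J 'X).

Definition iterate_O m : {poly Om} := map_poly J (iterate m).

Lemma iterate_OS m : iterate_O m.+1 =
  \sum_(l < r.+1) (J (d l)%:P * t ^+ (m * (q ^ l - 1)))%:P * iterate_O m ^+ (q ^ l).
Proof.
rewrite /iterate_O /= rmorph_sum; apply: eq_bigr => l _.
by rewrite rmorphM rmorphXn /= map_polyC /= rmorphM rmorphXn.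
Qed.

Lemma size_iterate_O m : size (iterate_O m) = (q ^ (r * m)).+1.
Proof.
elim: m => [|m IHm]; first by rewrite muln0 /iterate_O map_polyX size_polyX.
have sz l : size (iterate_O m ^+ (q ^ l)) = (q ^ (r * m + l)).+1.
  have /eqP := size_exp (iterate_O m) (q ^ l); rewrite IHm -expnD /=.
  rewrite -(eqn_add2l 1) !add1n prednK ?lt0n ?size_poly_eq0 ?expf_neq0 //; first by move/eqP.
  by rewrite -size_poly_eq0 IHm.
rewrite iterate_OS big_ord_recr /= addrC size_polyDl mul_polyC size_scale ?sz.
- by rewrite mulnS addnC.
- by rewrite mulf_neq0 ?expf_neq0 ?t_O_neq0 // -(rmorph0 J) (inj_eq J_inj) polyC_eq0.
rewrite ltnS; apply: leq_trans (size_sum _ _ _) _; apply/bigmax_leqP => l _.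
rewrite mul_polyC; apply: leq_trans (size_scale_leq _ _) _.
by rewrite sz ltn_exp2l ?card_gt1 // ltn_add2l.
- by rewrite mulf_neq0 ?expf_neq0 ?t_O_neq0 // -(rmorph0 J) (inj_eq J_inj) polyC_eq0.
Qed.

(** Only the summand l = 0 survives differentiation, the others being q-th powers up to
    constants. *)
Lemma deriv_iterate_O m : (iterate_O m)^`() = 1.
Proof.
elim: m => [|m IHm]; first by rewrite /iterate_O map_polyX derivX.
rewrite iterate_OS raddf_sum big_ord_recl /= expn0 subnn muln0 expr0 mulr1 d0 rmorph1 mul1r.
rewrite expr1 IHm big1 ?addr0 // => l _.
rewrite mul_polyC derivZ deriv_exp expnS -mulr_natl natrM.
suff -> : q%:R = 0 :> {poly Om} by rewrite !mul0r scaler0.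
by rewrite -polyC_natr -(rmorph_nat (const_O c J)) natr_card !rmorph0.
Qed.

Lemma iterate_O_compD m (y z : {poly Om}) :
  iterate_O m \Po (y + z) = (iterate_O m \Po y) + (iterate_O m \Po z).
Proof.
elim: m => [|m IHm]; first by rewrite /iterate_O map_polyX !comp_polyX.
rewrite iterate_OS !raddf_sum -big_split; apply: eq_bigr => l _ /=.
rewrite !comp_polyM !comp_polyC !rmorphXn /= IHm -mulrDr.
by rewrite (exprDq (@polyC Om \o const_O c J)).
Qed.

Lemma horner_iterate_O m z : t ^+ m * (iterate_O m).[z] = iter m (phi Fq r d J) z.
Proof.
elim: m => [|m IHm]; first by rewrite mul1r /iterate_O map_polyX hornerX.
rewrite iterS -IHm /phi exprS -mulrA; congr (_ * _).
rewrite iterate_OS horner_sum mulr_sumr; apply: eq_bigr => l _.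
rewrite hornerM hornerC horner_exp exprMn -[in X in _ = _ * (X * _)]exprM.
rewrite !mulrA; congr (_ * _); rewrite [t ^+ m * _]mulrC -mulrA; congr (_ * _).
rewrite -exprD; congr (_ ^+ _).
have : (0 < q ^ l)%N by rewrite expn_gt0 ltnW ?card_gt1.
by case: (q ^ l)%N => // a _; rewrite subSS subn0 mulnS addnC.
Qed.

End Evaluation.
End Iterates.

(** The logarithmic derivative of the product of the 1 - a X is minus the generating series of the
    power sums; [G] absorbs the truncation. *)
Lemma newton_power_sums (R : comNzRingType) (s : seq R) M : exists G,
  (\poly_(i < M) \sum_(a <- s) a ^+ i.+1) * \prod_(a <- s) (1 - a *: 'X) =
  - (\prod_(a <- s) (1 - a *: 'X))^`() + 'X^M * G.
Proof.
elim: s => [|a s [G IHs]].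
  exists 0; rewrite !big_nil mulr1 mulr0 addr0 derivC oppr0.
  by apply/polyP => i; rewrite coef_poly big_nil coef0 if_same.
rewrite !big_cons; set P := \prod_(_ <- s) _ in IHs *.
have geo : (\poly_(i < M) a ^+ i.+1) * (1 - a *: 'X) = a%:P - a ^+ M.+1 *: 'X^M.
  elim: M {G IHs} => [|M IHM].
    rewrite expr1 expr0 alg_polyC subrr (_ : \poly_(i < 0) _ = 0) ?mul0r //.
    by apply/polyP => i; rewrite coef_poly coef0.
  have -> : \poly_(i < M.+1) a ^+ i.+1 = (\poly_(i < M) a ^+ i.+1) + a ^+ M.+1 *: 'X^M.
    by rewrite !poly_def big_ord_recr.
  rewrite mulrDl IHM mulrBr mulr1 -scalerAl -scalerAr scalerA -!exprSr.
  by rewrite addrA subrK.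
have -> : \poly_(i < M) \sum_(b <- a :: s) b ^+ i.+1 =
    (\poly_(i < M) a ^+ i.+1) + \poly_(i < M) \sum_(b <- s) b ^+ i.+1.
  by rewrite !poly_def -big_split; apply: eq_bigr => i _; rewrite big_cons scalerDl.
exists ((1 - a *: 'X) * G - a ^+ M.+1 *: P).
rewrite mulrDl mulrA geo mulrCA IHs derivM derivB derivC derivZ derivX sub0r alg_polyC.
by rewrite -!mul_polyC; ring.
Qed.

Section Traces.
Variables (Fq : finFieldType) (r n : nat) (k : fieldType).
Local Notation q := #|Fq|.
Local Notation W := 'M[Fq]_(r, n.+1).
Local Notation S := (shift_mx Fq n).
Variables (c : {rmorphism Fq -> k}) (x : {additive 'rV[Fq]_r -> k}) (d : nat -> k).
Hypothesis xZ : forall a u, x (a *: u) = c a * x u.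
Hypothesis x_eq0 : forall u, (x u == 0) = (u == 0).
Hypothesis d0 : d 0 = 1.
Hypothesis dr : d r != 0.
Hypothesis d_root : forall u, \sum_(l < r.+1) d l * x u ^+ (q ^ l) = 0.
Variables (Om : fieldType) (J : {rmorphism {poly k} -> Om}).
Hypothesis J_inj : injective J.
Variable e : 'I_r -> Om.
Hypothesis eP : forall j, iter n (phi Fq r d J) (e j) = J (x (delta_mx 0 j))%:P.

Local Notation t := (J 'X).
Local Notation hat := (hat c d J e).
Local Notation H := (iterate_O Fq r d J).

Definition ker_values nu : seq Om := [seq hat M | M <- enum [set M : W | M *m S ^+ nu == 0]].

Lemma iterate_O_root nu M : t ^+ nu * (H nu).[hat M] = hat (M *m S ^+ nu).
Proof.
by rewrite (horner_iterate_O Fq r d J nu (hat M)) (iter_phi_hat c d_root eP).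
Qed.

(** The [hat N] with t^nu N = 0 are distinct roots, and there are as many of them as the degree. *)
Lemma iterate_O_prod nu : (nu <= n.+1)%N ->
  H nu = lead_coef (H nu) *: \prod_(w <- ker_values nu) ('X - w%:P).
Proof.
move=> le_nu; apply: all_roots_prod_XsubC.
- by rewrite (size_iterate_O Fq dr J_inj) size_map -cardE card_ker_shift.
- apply/allP => _ /mapP[M + ->]; rewrite mem_enum inE => /eqP M0.
  have /eqP := iterate_O_root nu M; rewrite M0 raddf0 mulf_eq0 => /orP[|//].
  by rewrite expf_eq0 (negPf (t_O_neq0 J_inj)) andbF.
by rewrite uniq_rootsE map_inj_uniq ?enum_uniq //; apply: (hat_inj xZ x_eq0 d_root J_inj eP).
Qed.

Lemma hat_notin_ker nu M : M *m S ^+ nu != 0 -> hat M \notin ker_values nu.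
Proof.
apply: contraNN => /mapP[N + /(hat_inj xZ x_eq0 d_root J_inj eP)->].
by rewrite mem_enum inE.
Qed.

(** As H_nu has derivative 1, its logarithmic derivative at [hat M] is 1 / H_nu (hat M), and t^nu
    H_nu (hat M) = hat (t^nu M). This is the image of the defining relation of the ring for a =
    t^nu. *)
Lemma sum_inv_hat nu M : (nu <= n.+1)%N -> M *m S ^+ nu != 0 ->
  \sum_(N : W | N *m S ^+ nu == 0) (hat M - hat N)^-1 = t ^+ nu / hat (M *m S ^+ nu).
Proof.
move=> le_nu M0; have Hprod := iterate_O_prod le_nu.
have : (H nu)^`().[hat M] / (H nu).[hat M] = t ^+ nu / hat (M *m S ^+ nu).
  rewrite (deriv_iterate_O r c d0) hornerC -iterate_O_root invfM mulrA mulfV //.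
  by rewrite expf_neq0 ?t_O_neq0.
rewrite Hprod derivZ !hornerZ -mulf_div divff ?lead_coef_eq0; last first.
  by rewrite -size_poly_eq0 (size_iterate_O Fq dr J_inj).
rewrite mul1r -sum_inv_root ?hat_notin_ker // big_map big_enum /= => <-.
by apply: eq_bigl => N; rewrite inE.
Qed.

(** Put v = hat M. By additivity the product of the 1 - X / (v - w) is H_n (v - X) / H_n (v) = 1 -
    H_n / H_n (v), and H_n (v) = x (residue M) / t^n. *)
Lemma trace_factor (M : W) : residue M != 0 ->
  \prod_(w <- ker_values n) (1 - (hat M - w)^-1 *: 'X) =
  1 - (t ^+ n / J (x (residue M))%:P) *: H n.
Proof.
move=> M0; have le_n : (n <= n.+1)%N by [].
have top := hat_top xZ eP M.
have Mn0 : M *m S ^+ n != 0.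
  by rewrite -(hat_eq0 xZ x_eq0 d_root J_inj eP) top -(rmorph0 J) (inj_eq J_inj) polyC_eq0 x_eq0.
have tn0 : t ^+ n != 0 by rewrite expf_neq0 ?t_O_neq0.
have HM : (H n).[hat M] = J (x (residue M))%:P / t ^+ n.
  by rewrite -top -iterate_O_root mulrAC mulfV ?mul1r.
have HM0 : (H n).[hat M] != 0.
  by rewrite HM mulf_neq0 ?invr_eq0 // -(rmorph0 J) (inj_eq J_inj) polyC_eq0 x_eq0.
have -> : t ^+ n / J (x (residue M))%:P = ((H n).[hat M])^-1 by rewrite HM invf_div.
apply: (scalerI HM0); rewrite scalerBr scalerA mulfV // scale1r alg_polyC.
have comp0 : H n \Po 0 = 0.
  by apply: (addrI (H n \Po 0)); rewrite -(iterate_O_compD r c) !addr0.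
transitivity (H n \Po ((hat M)%:P - 'X)); last first.
  rewrite (iterate_O_compD r c) comp_polyCr; congr (_ + _); apply/eqP.
  by rewrite -addr_eq0 addrC -{1}[H n]comp_polyXr -(iterate_O_compD r c) subrr comp0.
rewrite [in RHS](iterate_O_prod le_n) comp_polyZ rmorph_prod /=.
rewrite {1}(iterate_O_prod le_n) hornerZ horner_prod -scalerA; congr (_ *: _).
have : all (fun w => hat M - w != 0) (ker_values n).
  apply/allP => w ws; rewrite subr_eq0; apply: contraNneq (hat_notin_ker Mn0) => E.
  by rewrite E.
elim: (ker_values n) => [|w s IHs] /=; first by rewrite !big_nil scale1r.
case/andP=> w0 /IHs E; rewrite !big_cons -E hornerXsubC comp_polyB comp_polyX comp_polyC.
have <- : (hat M - w)%:P * (1 - ((hat M - w)^-1)%:P * 'X) = (hat M)%:P - 'X - w%:P.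
  by rewrite mulrBr mulr1 mulrA -polyCM mulfV // mul1r polyCB addrAC.
by rewrite -!mul_polyC polyCM; ring.
Qed.

(* Newton's identities for the 1/hat M with residue M = u: their generating   *)
(* polynomial is 1 - (t^n / u) H_n, and the coefficients of H_n have small    *)
(* degree in t, so that the leading term of the m-th power sum is (t^n / u)^m. *)
Lemma trace_poly u m : u != 0 -> exists pp : {poly k},
  [/\ J pp = \sum_(M : W | residue M == u) (hat M)^-1 ^+ m.+1,
      (size pp <= n * m.+1 + 1)%N & (pp`_(n * m.+1))%R = (x u)^-1 ^+ m.+1].
Proof.
move=> u0; pose M0 : W := \matrix_(j, l) if l == 0 then u 0 j else 0.
have M0u : residue M0 = u by apply/rowP => j; rewrite residueE mxE eqxx.
have ker_res N : (N *m S ^+ n == 0) = (residue N == 0 :> 'rV[Fq]_r).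
  apply/eqP/eqP => [N0|/rowP N0].
    apply/rowP => j; have /matrixP/(_ j ord_max) := N0.
    by rewrite mulmx_shift_top eqxx => ->; rewrite !mxE.
  apply/matrixP => j l; by rewrite mulmx_shift_top N0 !mxE if_same.
pose a (w : Om) := (hat M0 - w)^-1.
have sumE i : \sum_(M : W | residue M == u) (hat M)^-1 ^+ i =
    \sum_(b <- [seq a w | w <- ker_values n]) b ^+ i.
  rewrite !big_map big_enum /= (reindex_inj (inj_comp (addrI M0) oppr_inj)) /=.
  apply: eq_big => [N|N _]; last by rewrite /a -raddfB.
  by rewrite inE ker_res raddfB /= M0u -subr_eq0 addrAC subrr add0r oppr_eq0.
pose Y := t ^+ n / J (x u)%:P.
pose N M := \poly_(i < M) \sum_(b <- [seq a w | w <- ker_values n]) b ^+ i.+1.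
have [Hb H1] := @iterate_bounded Fq r k d d0 n.
(* The coefficient of X^i in Newton's identity; the derivative of H_n is 1 and contributes only for
   i = 0. *)
have recur i : (N i.+1)`_i = Y * ((i == 0)%:R +
    \sum_(j < i) (H n)`_j.+1 * (N i.+1)`_(i - j.+1)).
  have [G] := newton_power_sums [seq a w | w <- ker_values n] i.+1.
  rewrite -/(N _) big_map trace_factor M0u //  -/Y => /(congr1 (fun p : {poly Om} => p`_i)) /=.
  rewrite mulrBr mulr1 derivB derivC derivZ (deriv_iterate_O r c d0) sub0r opprK.
  rewrite coefB coefD coefXnM ltnSn addr0 -scalerAr !coefZ coef1 => /eqP.
  rewrite subr_eq => /eqP ->; rewrite mulrDr; congr (_ + Y * _).
  have H0 : (H n)`_0 = 0 by rewrite coef_map (Hb 0).1 //; apply: rmorph0.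
  by rewrite mulrC coefM big_ord_recl H0 mul0r add0r.
have pwE i l : (i <= l)%N -> (N l.+1)`_i = \sum_(M : W | residue M == u) (hat M)^-1 ^+ i.+1.
  by move=> le_i; rewrite coef_poly ltnS le_i sumE.
rewrite -(pwE _ m) //; elim/ltn_ind: m => i IHi.
have /choice[f fP] (j : 'I_i) : exists pp : {poly k},
    [/\ J pp = (N i.+1)`_(i - j.+1), (size pp <= n * (i - j) + 1)%N
      & (pp`_(n * (i - j)))%R = (x u)^-1 ^+ (i - j)].
  have lt_j : (i - j.+1 < i)%N by have := ltn_ord j; lia.
  have [pp [Jpp]] := IHi _ lt_j; rewrite !subnSK // => sz_pp top_pp.
  by exists pp; split=> //; rewrite Jpp !pwE // leq_subr.
pose Q : {poly k} := (i == 0)%:R + \sum_(j < i) (iterate Fq r d n)`_j.+1 * f j.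
have [szQ topQ] : (size Q <= n * i + 1)%N /\ Q`_(n * i) = (x u)^-1 ^+ i.
  rewrite {}/Q; case: (i) f fP => [|i'] f fP.
    by rewrite big_ord0 addr0 muln0 size_poly1 coef1 expr0.
  rewrite add0r big_ord_recl H1 mul1r.
  have [_ sz0 top0] := fP ord0; rewrite subn0 in sz0 top0.
  (* The first term alone reaches the top degree, as H_n has linear coefficient 1. The others have
     degree at most (n - 1) (j + 1) + n (i' - j) in t, and for n = 0 they vanish. *)
  set T := \sum_(_ < _) _; suff szT : (size T <= n * i'.+1)%N.
    split; last by rewrite coefD top0 nth_default ?addr0.
    apply: leq_trans (size_polyD _ _) _; rewrite geq_max sz0.
    by apply: leq_trans szT _; rewrite leq_addr.
  apply: leq_trans (size_sum _ _ _) _; apply/bigmax_leqP => j _.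
  have [_ szj _] := fP (lift ord0 j); have lt_j := ltn_ord j; rewrite !lift0 in szj *.
  have szh := (Hb j.+2).2.
  have [n0|n_gt0] := posnP n.
    by rewrite [in iterate _ _ _ n]n0 coefX mul0r size_poly0.
  apply: leq_trans (size_polyMleq _ _) _; nia.
exists ((x u)^-1%:P * 'X^n * Q); split.
- rewrite recur !rmorphM rmorphXn /= /Y; congr (_ * _).
    rewrite mulrC; congr (_ * _).
    have xu : x u != 0 by rewrite x_eq0.
    apply: (mulIf (_ : J (x u)%:P != 0)).
      by rewrite -(rmorph0 J) (inj_eq J_inj) polyC_eq0.
    by rewrite mulVf -?rmorphM -?polyCM ?mulVf ?rmorph1 // -(rmorph0 J) (inj_eq J_inj) polyC_eq0.
  rewrite rmorphD rmorph_nat rmorph_sum; congr (_ + _); apply: eq_bigr => j _.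
  by rewrite rmorphM coef_map; case: (fP j) => ->.
- rewrite -mulrA mul_polyC; apply: leq_trans (size_scale_leq _ _) _.
  apply: leq_trans (size_polyMleq _ _) _; rewrite size_polyXn mulnS; lia.
rewrite -mulrA coefCM coefXnM mulnS ifF; last by lia.
by rewrite addKn topQ exprS.
Qed.

End Traces.

(** * Change of torsion points *)

Section IntegralCongruence.
Variables (k Om : fieldType) (J : {rmorphism {poly k} -> Om}).
Hypothesis J_inj : injective J.
Local Notation t := (J 'X).
Local Notation integral z := (integralOver J z).

Lemma integral_sum I (s : seq I) (P : pred I) (f : I -> Om) :
  (forall i, P i -> integral (f i)) -> integral (\sum_(i <- s | P i) f i).
Proof.
by move=> fP; elim/big_ind: _ => //; [apply: integral0|apply: integral_add].
Qed.

Lemma integral_exp m z : integral z -> integral (z ^+ m).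
Proof.
move=> zP; elim: m => [|m IHm]; first exact: integral1.
by rewrite exprS; apply: integral_mul.
Qed.

(** Clearing denominators in a monic equation for 1/t gives a polynomial identity whose value at t =
    0 reads 1 = 0. *)
Lemma invX_not_integral : ~ integral t^-1.
Proof.
case=> p mon_p; rewrite rootE => /eqP p0.
have t0 := t_O_neq0 J_inj.
pose D := (size p).-1; have sz_p : size p = D.+1.
  by rewrite prednK // lt0n size_poly_eq0 monic_neq0.
have : J (\sum_(i < D.+1) p`_i * 'X^(D - i)) = 0.
  apply: etrans (etrans (congr1 (GRing.mul (t ^+ D)) p0) (mulr0 _)).
  rewrite (@horner_coef_wide _ D.+1) -?sz_p ?size_poly // sz_p mulr_sumr rmorph_sum /=.
  apply: eq_bigr => -[i /= le_i] _; rewrite rmorphM rmorphXn coef_map /= mulrCA; congr (_ * _).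
  by rewrite -[in RHS](subnK (_ : i <= D)%N) // exprD exprVn mulfK ?expf_neq0.
move/eqP; rewrite -(rmorph0 J) (inj_eq J_inj) => /eqP.
move/(congr1 (fun f : {poly k} => f.[0])); rewrite horner_sum horner0 big_ord_recr /=.
rewrite subnn expr0 mulr1 -[D]/(size p).-1 -lead_coefE (monicP mon_p) hornerC.
rewrite big1 ?add0r => [|i _]; first by move/eqP; rewrite oner_eq0.
by rewrite hornerM hornerXn expr0n subn_eq0 leqNgt ltn_ord mulr0.
Qed.

(** Congruence modulo t times the integral closure of k[t]; it replaces the choice of a place of
    [Om] above t = 0. *)
Definition cong (z : Om) (b : k) : Prop := exists2 y, integral y & z = J b%:P + t * y.

Lemma cong_integral z b : cong z b -> integral z.
Proof.
by case=> y yP ->; apply: integral_add (integral_mul _ yP); apply: integral_id.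
Qed.

Lemma congJ p : cong (J p) p.[0].
Proof.
have /factor_theorem[g gE] : root (p - p.[0]%:P) 0 by rewrite rootE !hornerE subrr.
exists (J g); first exact: integral_id.
by rewrite subr0 in gE; rewrite -rmorphM -rmorphD mulrC -gE addrC subrK.
Qed.

Lemma congC b : cong (J b%:P) b.
Proof. by have := congJ b%:P; rewrite hornerC. Qed.

Lemma cong_integral0 y : integral y -> cong (t * y) 0.
Proof. by exists y; rewrite // polyC0 rmorph0 add0r. Qed.

Lemma congD z z' b b' : cong z b -> cong z' b' -> cong (z + z') (b + b').
Proof.
move=> [y yP ->] [y' y'P ->]; exists (y + y'); first exact: integral_add.
by rewrite polyCD rmorphD mulrDr addrACA.
Qed.

Lemma congM z z' b b' : cong z b -> cong z' b' -> cong (z * z') (b * b').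
Proof.
move=> zb [y' y'P ->]; have zP := cong_integral zb; have [y yP E] := zb.
exists (y * J b'%:P + z * y').
  by apply: integral_add; apply: integral_mul => //; apply: integral_id.
by rewrite polyCM rmorphM mulrDr {1}E; ring.
Qed.

Lemma congX z b m : cong z b -> cong (z ^+ m) (b ^+ m).
Proof.
move=> zb; elim: m => [|m IHm]; last by rewrite !exprS; apply: congM.
by rewrite !expr0; have := congC 1; rewrite polyC1 rmorph1.
Qed.

Lemma cong_prod I (s : seq I) (P : pred I) (z : I -> Om) b :
  (forall i, P i -> cong (z i) (b i)) ->
  cong (\prod_(i <- s | P i) z i) (\prod_(i <- s | P i) b i).
Proof.
move=> zP; elim/big_ind2: _ => [|*|//]; last exact: congM.
by have := congC 1; rewrite polyC1 rmorph1.
Qed.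

Lemma cong_sum I (s : seq I) (P : pred I) (z : I -> Om) b :
  (forall i, P i -> cong (z i) (b i)) ->
  cong (\sum_(i <- s | P i) z i) (\sum_(i <- s | P i) b i).
Proof.
move=> zP; elim/big_ind2: _ => [|*|//]; last exact: congD.
by have := congC 0; rewrite polyC0 rmorph0.
Qed.

(** Otherwise 1/t = - y / b would be integral. *)
Lemma cong0 b : cong 0 b -> b = 0.
Proof.
case=> y yP /esym/eqP; rewrite addr_eq0 => /eqP bE; apply/eqP/negP => /negP b0.
apply: invX_not_integral; have t0 := t_O_neq0 J_inj.
have -> : t^-1 = - (J b^-1%:P * y).
  apply: (mulfI t0); rewrite mulfV // mulrN mulrCA -mulrN -bE -rmorphM -polyCM mulVf //.
  by rewrite polyC1 rmorph1.
by apply/integral_opp/integral_mul => //; apply: integral_id.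
Qed.

End IntegralCongruence.

Section Irreducibility.
Variables (Fq : finFieldType) (r n : nat) (k : fieldType).
Local Notation q := #|Fq|.
Variables (c : {rmorphism Fq -> k}) (d : nat -> k).
Hypothesis dr : d r != 0.
Variables (Om : fieldType) (J : {rmorphism {poly k} -> Om}).
Hypothesis J_inj : injective J.
Local Notation t := (J 'X).
Local Notation integral z := (integralOver J z).
Local Notation Phi := (phi Fq r d J).
Local Notation cong := (cong J).

Fixpoint val_exp m := if m is m'.+1 then (val_exp m' + (q ^ r) ^ m')%N else 0%N.

(* If phi^m a = y then a behaves as (y / (t^N d_r^N))^(1/q^(rm)) at t = 0.    *)
Definition normalized m a := t ^+ val_exp m * a ^+ ((q ^ r) ^ m).

Lemma normalized_step m a : normalized m (Phi a) ^+ (q ^ r) =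
  \sum_(l < r.+1) J (d l ^+ ((q ^ r) ^ m.+1))%:P *
    (t ^+ (val_exp m.+1 * (q ^ r - q ^ l)) * normalized m.+1 a ^+ (q ^ l)).
Proof.
have expE i : ((q ^ r) ^ i = q ^ (r * i))%N by rewrite expnM.
have -> : normalized m (Phi a) ^+ (q ^ r) = t ^+ (val_exp m.+1 * q ^ r) *
    (\sum_(l < r.+1) J (d l)%:P * a ^+ (q ^ l)) ^+ ((q ^ r) ^ m.+1).
  rewrite /normalized /phi exprMn [(_ * _) ^+ ((q ^ r) ^ m)]exprMn exprMn -!exprM.
  by rewrite mulrA -exprD -mulnDl -expnSr.
rewrite expE (expr_sumq (const_O c J)) -expE mulr_sumr; apply: eq_bigr => l _.
rewrite exprMn mulrCA rmorphXn rmorphXn; congr (_ * _).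
rewrite /normalized exprMn -!exprM mulrA -exprD -mulnDr subnK; last first.
  by rewrite leq_exp2l ?card_gt1 // -ltnS.
by congr (_ * _ ^+ _); rewrite mulnC.
Qed.

Lemma val_exp_gt0 m : (0 < val_exp m.+1)%N.
Proof. by rewrite /= addn_gt0 !expn_gt0 (ltnW (card_gt1 Fq)) !orbT. Qed.

(** The terms l < r carry a positive power of t, so that only l = r counts modulo t. *)
Lemma normalized_top m a : integral (normalized m.+1 a) -> exists2 y, integral y &
  normalized m.+1 a ^+ (q ^ r) =
  J ((d r)^-1 ^+ ((q ^ r) ^ m.+1))%:P * (normalized m (Phi a) ^+ (q ^ r) + t * y).
Proof.
move=> int_a; exists (- \sum_(l < r) J (d l ^+ ((q ^ r) ^ m.+1))%:P *
    (t ^+ (val_exp m.+1 * (q ^ r - q ^ l)).-1 * normalized m.+1 a ^+ (q ^ l))).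
  apply/integral_opp/integral_sum => l _; apply: integral_mul; first exact: integral_id.
  by apply: integral_mul; apply: integral_exp => //; apply: integral_id.
rewrite normalized_step big_ord_recr /= -/(val_exp m.+1) subnn muln0 mul1r.
rewrite mulrN mulr_sumr [X in _ * (X + _ - _)](_ : _ = \sum_(l < r) t *
    (J (d l ^+ ((q ^ r) ^ m.+1))%:P *
    (t ^+ (val_exp m.+1 * (q ^ r - q ^ l)).-1 * normalized m.+1 a ^+ (q ^ l)))); last first.
  apply: eq_bigr => l _; rewrite [RHS]mulrCA [t * _]mulrA -exprS prednK //.
  by rewrite muln_gt0 val_exp_gt0 subn_gt0 ltn_exp2l ?card_gt1 /=.
rewrite addrAC subrr add0r mulrA -rmorphM -polyCM -exprMn mulVf // expr1n.
by rewrite polyC1 rmorph1 mul1r.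
Qed.

(** Divided by a power of d_r, the step formula is a monic equation of degree q^r for the normalized
    element, with coefficients that are integral by induction. *)
Lemma normalized_integral m a y : iter m Phi a = J y%:P -> integral (normalized m a).
Proof.
elim: m a => [|m IHm] a.
  by rewrite /normalized /= expr0 mul1r expn0 expr1 => ->; apply: integral_id.
rewrite iterSr => /IHm int_f; set f := normalized m.+1 a.
pose b := J ((d r)^-1 ^+ ((q ^ r) ^ m.+1))%:P.
pose g : {poly Om} := \sum_(l < r) (b * (J (d l ^+ ((q ^ r) ^ m.+1))%:P *
    t ^+ (val_exp m.+1 * (q ^ r - q ^ l)))) *: 'X^(q ^ l) -
    (b * normalized m (Phi a) ^+ (q ^ r))%:P.
have sz_g : (size g <= q ^ r)%N.
  have q_gt0 l : (0 < q ^ l)%N by rewrite expn_gt0 ltnW ?card_gt1.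
  rewrite /g (leq_trans (size_polyD _ _)) // size_polyN geq_max.
  rewrite (leq_trans (size_polyC_leq1 _)) ?q_gt0 // andbT.
  apply: leq_trans (size_sum _ _ _) _; apply/bigmax_leqP => l _.
  by rewrite (leq_trans (size_scale_leq _ _)) // size_polyXn ltn_exp2l ?card_gt1.
apply: (@integral_root_monic _ _ _ f ('X^(q ^ r) + g)).
- by rewrite monicE lead_coefDl ?lead_coefXn // size_polyXn ltnS.
- rewrite rootE hornerD hornerXn /g hornerD hornerN hornerC horner_sum.
  have -> : b * normalized m (Phi a) ^+ (q ^ r) =
      \sum_(l < r.+1) b * (J (d l ^+ ((q ^ r) ^ m.+1))%:P *
      (t ^+ (val_exp m.+1 * (q ^ r - q ^ l)) * f ^+ (q ^ l))).
    by rewrite normalized_step mulr_sumr.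
  rewrite big_ord_recr /= -/(val_exp m.+1) subnn muln0 mul1r.
  rewrite [b * (_ * f ^+ _)]mulrA -rmorphM -polyCM -exprMn mulVf // expr1n polyC1 rmorph1 mul1r.
  rewrite [X in _ + (X - _)](_ : _ = \sum_(l < r) b *
      (J (d l ^+ ((q ^ r) ^ m.+1))%:P *
      (t ^+ (val_exp m.+1 * (q ^ r - q ^ l)) * f ^+ (q ^ l)))).
    by move: (\sum_(l < r) _) => A; apply/eqP; ring.
  by apply: eq_bigr => l _; rewrite hornerZ hornerXn !mulrA.
apply/integral_poly => i; rewrite coefD coefXn; apply: integral_add; first exact: integral_nat.
rewrite coefB coef_sum coefC; apply: integral_sub.
  apply: integral_sum => l _; rewrite coefZ coefXn; apply: integral_mul; last exact: integral_nat.
  apply: integral_mul; first exact: integral_id.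
  by apply: integral_mul; [|apply: integral_exp]; apply: integral_id.
case: ifP => _; last exact: integral0.
by apply: integral_mul; [apply: integral_id|apply: integral_exp].
Qed.

(** Each step determines a q^r-th power modulo t; raising to the power (q^r)^m avoids extracting
    roots in a congruence. *)
Lemma normalized_cong m a y : iter m Phi a = J y%:P ->
  cong (normalized m a ^+ ((q ^ r) ^ m)) (((d r)^-1 ^+ val_exp m * y) ^+ ((q ^ r) ^ m)).
Proof.
elim: m a => [|m IHm] a.
  rewrite /normalized /= expr0 !mul1r expn0 !expr1 => ->; exact: congC.
move=> ay; have [z zP topE] := normalized_top (normalized_integral ay).
move: ay; rewrite iterSr => /IHm cong_f.
have expE i : ((q ^ r) ^ i = q ^ (r * i))%N by rewrite expnM.
have Q_gt0 : (0 < (q ^ r) ^ m)%N by rewrite !expn_gt0 ltnW ?card_gt1.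
rewrite [X in normalized _ _ ^+ X]expnS exprM topE exprMn.
rewrite [in X in _ * X]expE (exprDq (const_O c J)) -expE.
have -> : ((d r)^-1 ^+ val_exp m.+1 * y) ^+ ((q ^ r) ^ m.+1) =
    ((d r)^-1 ^+ ((q ^ r) ^ m.+1)) ^+ ((q ^ r) ^ m) *
    ((((d r)^-1 ^+ val_exp m * y) ^+ ((q ^ r) ^ m)) ^+ (q ^ r) + 0 ^+ ((q ^ r) ^ m)).
  rewrite expr0n gtn_eqF // addr0 -!exprM -expnSr [((q ^ r) ^ m.+1 * _)%N]mulnC exprM -exprMn.
  by rewrite mulrA -exprD addnC.
apply: congM; first by apply: congX; apply: congC.
apply: congD; last by apply/congX/cong_integral0.
by rewrite [X in cong X]exprAC; apply: congX.
Qed.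

End Irreducibility.

(** * Independence of relations from the choice of torsion points *)

Section Transfer.
Variables (Fq : finFieldType) (r n : nat) (k : fieldType).
Local Notation q := #|Fq|.
Local Notation Q := ((q ^ r) ^ n)%N.
Variables (c : {rmorphism Fq -> k}) (d : nat -> k) (x : 'I_r -> k).
Hypothesis d0 : d 0 = 1.
Hypothesis dr : d r != 0.
Variables (Om : fieldType) (J : {rmorphism {poly k} -> Om}).
Hypothesis J_inj : injective J.
Hypothesis x_indep : forall D : {ffun 'I_r -> 'I_Q} -> k,
  \sum_a D a ^+ Q * \prod_i x i ^+ a i = 0 -> forall a, D a = 0.
Local Notation t := (J 'X).
Local Notation Phi := (phi Fq r d J).

Definition torsion_point (e : 'I_r -> Om) := forall i, iter n Phi (e i) = J (x i)%:P.

Definition point_monom (a : {ffun 'I_r -> 'I_Q}) (e : 'I_r -> Om) := \prod_i e i ^+ a i.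

Lemma poly_order0 (p : {poly k}) :
  exists o p', p != 0 -> p = p' * 'X^o /\ p'.[0] != 0.
Proof.
have [-> | p0] := eqVneq p 0; first by exists 0%N, 0.
have [o [p' rp' pE]] := multiplicity_XsubC p 0.
by exists o, p' => _; rewrite subr0 p0 in pE rp'; split.
Qed.

(* At t = 0 the extension generated by e is totally ramified and fierce: the  *)
(* leading coefficients of the e^a are independent over the Q-th powers.      *)
Lemma point_monom_independent e (C : {ffun 'I_r -> 'I_Q} -> {poly k}) :
    torsion_point e -> \sum_a J (C a) * point_monom a e = 0 ->
  forall a, C a = 0.
Proof.
move=> eP C0 a1; apply/eqP; have [//|Ca1] := eqVneq (C a1) 0.
have /choice[o /choice[C' CE]] := fun a => poly_order0 (C a).
pose N := val_exp Fq r n; pose deg (a : {ffun 'I_r -> 'I_Q}) := (\sum_i a i)%N.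
(* The point e_i has a pole of order N / Q at t = 0, so [om a] is Q times the order of the term C_a
   e^a, shifted by N B to stay in [nat]. *)
pose B := (r * Q)%N; pose om a := (Q * o a + N * (B - deg a))%N.
have deg_B a : (deg a <= B)%N.
  rewrite /deg /B -[r in (r * _)%N]card_ord -sum_nat_const; apply: leq_sum => i _.
  exact: ltnW.
case: (@arg_minnP _ a1 (fun a => C a != 0) om Ca1) => a0 Ca0 a0min.
have QE : (Q = q ^ (r * n))%N by rewrite expnM.
have Q_gt0 : (0 < Q)%N by rewrite QE expn_gt0 ltnW ?card_gt1.
have t0 := t_O_neq0 J_inj.
pose f i := normalized Fq r J n (e i) ^+ Q.
have fE i : f i = t ^+ (N * Q) * e i ^+ (Q * Q) by rewrite /f /normalized exprMn -!exprM.
(* The relation raised to the power Q^2, times t^(N Q B), divided by the lowest power t^(Q om a0):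
   all its ingredients are integral. *)
have rel : \sum_(a | C a != 0) J (C' a) ^+ (Q * Q) * t ^+ (Q * (om a - om a0)) *
    \prod_i f i ^+ a i = 0.
  apply: (mulfI (expf_neq0 (Q * om a0) t0)); rewrite mulr0.
  transitivity (t ^+ (N * Q * B) * (\sum_a J (C a) * point_monom a e) ^+ (Q * Q)); last first.
    by rewrite C0 expr0n muln_eq0 eqn0Ngt Q_gt0 mulr0.
  have -> : (Q * Q = q ^ (r * n + r * n))%N by rewrite QE expnD.
  rewrite (expr_sumq (const_O c J)) expnD -QE [in RHS](bigID (fun a => C a != 0)) /=.
  rewrite [X in _ * (_ + X)]big1 ?addr0; last first.
    by move=> a; rewrite negbK => /eqP->; rewrite rmorph0 mul0r expr0n muln_eq0 eqn0Ngt Q_gt0.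
  rewrite !mulr_sumr; apply: eq_bigr => a Ca; have [-> _] := CE a Ca.
  have -> : \prod_i f i ^+ a i = t ^+ (N * Q * deg a) * point_monom a e ^+ (Q * Q).
    rewrite /deg big_distrr /= -prodrXr /point_monom -prodrXl -big_split.
    by apply: eq_bigr => i _; rewrite fE exprMn -!exprM [(Q * Q * _)%N]mulnC.
  rewrite rmorphM rmorphXn /= !exprMn -!exprM.
  rewrite [LHS](_ : _ = J (C' a) ^+ (Q * Q) * point_monom a e ^+ (Q * Q) *
    t ^+ (Q * om a0 + Q * (om a - om a0) + N * Q * deg a)); last by rewrite !exprD; ring.
  rewrite [RHS](_ : _ = J (C' a) ^+ (Q * Q) * point_monom a e ^+ (Q * Q) *
    t ^+ (N * Q * B + o a * (Q * Q))); last by rewrite exprD; ring.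
  congr (_ * _ ^+ _); rewrite -mulnDr subnKC ?a0min // /om.
  have := deg_B a; move: (deg a) (o a) (B) => D O B' le_D.
  by rewrite -{2}(subnK le_D); ring.
pose h i := (d r)^-1 ^+ N * x i.
pose min a := (C a != 0) && (om a == om a0).
(* Modulo t only the terms of minimal order remain. The Q-th power of their sum is an element of k
   congruent to 0, so it is 0. *)
have beta0 : \sum_(a | min a) (C' a).[0] ^+ Q * \prod_i h i ^+ a i = 0.
  apply/eqP; suff : (\sum_(a | min a) (C' a).[0] ^+ Q * \prod_i h i ^+ a i) ^+ Q == 0.
    by rewrite expf_eq0 Q_gt0.
  apply/eqP; rewrite [X in _ ^+ X]QE (expr_sumq c) -QE; apply: (cong0 J_inj).
  rewrite -rel (bigID (fun a => om a == om a0)) /=.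
  rewrite -[X in cong J _ X]addr0; apply: congD.
    apply: cong_sum => a /andP[Ca /eqP->]; rewrite subnn muln0 expr0 mulr1.
    rewrite exprMn -exprM -prodrXl; apply: congM; first by apply/congX/congJ.
    apply: cong_prod => i _; rewrite [X in cong _ _ X]exprAC; apply: congX.
    by have := normalized_cong c dr (eP i).
  rewrite -[X in cong J _ X](_ : \sum_(a | (C a != 0) && (om a != om a0)) 0 = 0); last exact: big1.
  apply: cong_sum => a /andP[Ca om_a].
  have lt_om : (om a0 < om a)%N by rewrite ltn_neqAle eq_sym om_a a0min.
  have tX : cong J (t ^+ (Q * (om a - om a0))) 0.
    have := congX (Q * (om a - om a0)) (congJ J 'X).
    by rewrite hornerX expr0n muln_eq0 subn_eq0 leqNgt lt_om orbF eqn0Ngt Q_gt0.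
  rewrite -(mul0r (\prod_i (h i ^+ Q) ^+ a i)) -[X in cong J _ (X * _)](mulr0 ((C' a).[0] ^+ (Q * Q))).
  apply: congM; last by apply: cong_prod => i _; apply: congX; have := normalized_cong c dr (eP i).
  by apply: congM; first by apply/congX/congJ.
(* In the terms of minimal order the powers of d_r are a common constant times a Q-th power, so that
   the independence of the monomials in x_i over Q-th powers applies. *)
have pw a : min a -> d r ^+ (N * B) * \prod_i h i ^+ a i =
    d r ^+ om a0 * ((d r)^-1 ^+ o a) ^+ Q * \prod_i x i ^+ a i.
  case/andP=> _ /eqP <-; under eq_bigr => i _ do rewrite /h exprMn -exprM.
  rewrite big_split /= prodrXr -big_distrr /= -/(deg a) mulrA; congr (_ * _).
  rewrite -exprM !exprVn /om -{1}(subnK (deg_B a)) mulnDr !exprD.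
  rewrite mulfK ?expf_neq0 // mulnC mulrAC [(o a * Q)%N]mulnC mulfV ?expf_neq0 ?mul1r //.
pose D a := if min a then (C' a).[0] * (d r)^-1 ^+ o a else 0.
have min0 : min a0 by rewrite /min Ca0 eqxx.
have := x_indep (D := D) _ a0; rewrite /D min0 => H.
have [_ C'0] := CE a0 Ca0.
have : (C' a0).[0] * (d r)^-1 ^+ o a0 != 0 by rewrite mulf_neq0 ?expf_neq0 ?invr_eq0.
case/eqP; apply: H.
rewrite (bigID min) /= [X in _ + X]big1 ?addr0; last first.
  by move=> a /negPf->; rewrite expr0n eqn0Ngt Q_gt0 mul0r.
apply: (mulfI (expf_neq0 (om a0) dr)); rewrite mulr0 -[RHS](mulr0 (d r ^+ (N * B))) -[X in _ = _ * X]beta0.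
rewrite !mulr_sumr; apply: eq_bigr => a mina; rewrite mina exprMn.
by rewrite [RHS]mulrCA pw //; ring.
Qed.

(** The coefficients are common to all choices of torsion points: this replaces an automorphism of
    [Om] carrying one choice to another. *)
Definition reduced (v : ('I_r -> Om) -> Om) : Prop :=
  exists (s : {poly k}) (C : {ffun 'I_r -> 'I_Q} -> {poly k}), s != 0 /\
    forall e, torsion_point e -> J s * v e = \sum_a J (C a) * point_monom a e.

(** Independence at [e] makes the coefficients vanish, and these do not depend on [e]. *)
Lemma reduced_transfer v e e' : reduced v -> torsion_point e -> torsion_point e' ->
  v e = 0 -> v e' = 0.
Proof.
move=> [s [C [s0 vE]]] eP e'P v0.
have C0 : forall a, C a = 0.
  by apply: (point_monom_independent eP); rewrite -vE // v0 mulr0.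
apply/eqP; have := vE e' e'P; rewrite big1 => [/eqP|a _]; last by rewrite C0 rmorph0 mul0r.
by rewrite mulf_eq0 -{1}(rmorph0 J) (inj_eq J_inj) (negPf s0).
Qed.

Lemma eq_reduced v v' : (forall e, torsion_point e -> v e = v' e) -> reduced v -> reduced v'.
Proof.
move=> vv' [s [C [s0 vE]]]; exists s, C; split=> // e eP.
by rewrite -vv' // vE.
Qed.

Lemma reducedD v v' : reduced v -> reduced v' -> reduced (fun e => v e + v' e).
Proof.
move=> [s [C [s0 vE]]] [s' [C' [s'0 v'E]]].
exists (s * s'), (fun a => s' * C a + s * C' a); split; first exact: mulf_neq0.
move=> e eP; rewrite mulrDr {1}[s * s']mulrC !rmorphM -!mulrA vE // v'E //.
rewrite !mulr_sumr -big_split; apply: eq_bigr => a _ /=.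
by rewrite rmorphD !rmorphM mulrDl !mulrA.
Qed.

Lemma reducedZ p v : reduced v -> reduced (fun e => J p * v e).
Proof.
move=> [s [C [s0 vE]]]; exists s, (fun a => p * C a); split=> // e eP.
rewrite mulrCA vE // mulr_sumr; apply: eq_bigr => a _.
by rewrite rmorphM mulrA.
Qed.

Lemma reduced_scale s v : s != 0 -> reduced (fun e => J s * v e) -> reduced v.
Proof.
move=> s0 [s' [C [s'0 vE]]]; exists (s' * s), C; split; first exact: mulf_neq0.
by move=> e eP; rewrite rmorphM -mulrA vE.
Qed.

Lemma reduced_monom a : reduced (point_monom a).
Proof.
exists 1, (fun b => (b == a)%:R); split; first exact: oner_neq0.
move=> e _; rewrite rmorph1 mul1r (bigD1 a) //= eqxx rmorph1 mul1r.
by rewrite big1 ?addr0 // => b /negPf->; rewrite rmorph0 mul0r.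
Qed.

Lemma reduced0 : reduced (fun=> 0).
Proof.
exists 1, (fun=> 0); split; first exact: oner_neq0.
by move=> e _; rewrite mulr0 big1 // => a _; rewrite rmorph0 mul0r.
Qed.

Lemma reduced_sum I (s : seq I) (P : pred I) (v : I -> ('I_r -> Om) -> Om) :
  (forall i, P i -> reduced (v i)) -> reduced (fun e => \sum_(i <- s | P i) v i e).
Proof.
move=> vP; elim: s => [|i s IHs].
  by apply: eq_reduced reduced0 => e _; rewrite big_nil.
have [Pi|nPi] := boolP (P i).
  apply: eq_reduced (reducedD (vP i Pi) IHs) => e _.
  by rewrite big_cons Pi.
by apply: eq_reduced IHs => e _; rewrite big_cons (negPf nPi).
Qed.

(** When the exponent reaches Q, the power e_i^Q is eliminated by phi^n (e_i) = x_i, an equation of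
    degree Q with coefficients in k[t] that are the same for every [e]. *)
Lemma reduced_monomX a i : reduced (fun e => point_monom a e * e i).
Proof.
have set_monom (l : 'I_Q) e : point_monom [ffun j => if j == i then l else a j] e =
    e i ^+ l * \prod_(j | j != i) e j ^+ a j.
  rewrite /point_monom (bigD1 i) //= ffunE eqxx; congr (_ * _).
  by apply: eq_bigr => j /negPf ji; rewrite ffunE ji.
have monomE e : point_monom a e * e i = e i ^+ (a i).+1 * \prod_(j | j != i) e j ^+ a j.
  by rewrite /point_monom (bigD1 i) //= mulrAC -exprSr.
have [lt_ai|le_ai] := ltnP (a i).+1 Q.
  by apply: eq_reduced (reduced_monom _) => e _; rewrite monomE -(set_monom (Ordinal lt_ai)).
have aiE : (a i).+1 = Q by apply/eqP; rewrite eqn_leq le_ai ltn_ord.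
have Q_gt0 : (0 < Q)%N by rewrite -aiE.
pose g := ('X^n)%:P * iterate Fq r d n - (x i)%:P%:P.
have gE : map_poly J g = t ^+ n *: iterate_O Fq r d J n - (J (x i)%:P)%:P.
  by rewrite rmorphB rmorphM /= !map_polyC /= rmorphXn mul_polyC.
have szg : size (map_poly J g) = Q.+1.
  have sz1 : size (t ^+ n *: iterate_O Fq r d J n) = Q.+1.
    by rewrite size_scale ?expf_neq0 ?t_O_neq0 // (size_iterate_O Fq dr J_inj) expnM.
  rewrite gE size_polyDl ?sz1 // size_polyN.
  by apply: leq_ltn_trans (size_polyC_leq1 _) _; rewrite ltnS.
have gQ : g`_Q != 0.
  have : lead_coef (map_poly J g) != 0 by rewrite lead_coef_eq0 -size_poly_eq0 szg.
  by rewrite lead_coefE szg coef_map -{1}(rmorph0 J) (inj_eq J_inj).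
apply: (reduced_scale gQ).
apply: (@eq_reduced (fun e => \sum_(l < Q) J (- g`_l) *
   point_monom [ffun j => if j == i then l else a j] e)).
  move=> e eP; rewrite monomE aiE mulrA.
  have : (map_poly J g).[e i] = 0.
    rewrite gE hornerD hornerN hornerC hornerZ (horner_iterate_O Fq r d J n (e i)).
    by rewrite (eP i) subrr.
  rewrite horner_coef szg big_ord_recr /= addrC coef_map => /eqP; rewrite addr_eq0 => /eqP->.
  rewrite -sumrN mulr_suml; apply: eq_bigr => l _.
  by rewrite set_monom coef_map rmorphN mulrA mulNr.
by apply: reduced_sum => l _; apply/reducedZ/reduced_monom.
Qed.

Lemma reduced_mulX i v : reduced v -> reduced (fun e => v e * e i).
Proof.
move=> [s [C [s0 vE]]]; apply: (reduced_scale s0).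
apply: (@eq_reduced (fun e => \sum_a J (C a) * (point_monom a e * e i))).
  by move=> e eP; rewrite mulrA vE // mulr_suml; apply: eq_bigr => a _; rewrite mulrA.
by apply: reduced_sum => a _; apply/reducedZ/reduced_monomX.
Qed.

Lemma reducedM v v' : reduced v -> reduced v' -> reduced (fun e => v e * v' e).
Proof.
move=> vP [s [C [s0 vE]]]; apply: (reduced_scale s0).
apply: (@eq_reduced (fun e => \sum_a J (C a) * (v e * point_monom a e))).
  move=> e eP; rewrite mulrCA vE // mulr_sumr; apply: eq_bigr => a _.
  by rewrite mulrCA.
apply: reduced_sum => a _; apply: reducedZ; rewrite /point_monom.
elim: (index_enum _) => [|i s' IHs].
  by apply: eq_reduced vP => e _; rewrite big_nil mulr1.
apply: (@eq_reduced (fun e => v e * \prod_(j <- s') e j ^+ a j * e i ^+ a i)).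
  by move=> e _; rewrite big_cons -mulrA [X in _ * X]mulrC.
elim: (a i : nat) => [|m IHm]; first by apply: eq_reduced IHs => e _; rewrite mulr1.
by apply: eq_reduced (reduced_mulX i IHm) => e _; rewrite exprSr mulrA.
Qed.

Lemma reduced1 : reduced (fun=> 1).
Proof.
have Q_gt0 : (0 < Q)%N by rewrite !expn_gt0 ltnW ?card_gt1.
apply: eq_reduced (reduced_monom [ffun=> Ordinal Q_gt0]) => e _.
by rewrite /point_monom big1 // => i _; rewrite ffunE expr0.
Qed.

Lemma reduced_coord i : reduced (fun e => e i).
Proof. by apply: eq_reduced (reduced_mulX i reduced1) => e _; rewrite mul1r. Qed.

Lemma reducedX v m : reduced v -> reduced (fun e => v e ^+ m).
Proof.
move=> vP; elim: m => [|m IHm]; first exact: reduced1.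
by apply: eq_reduced (reducedM vP IHm) => e _; rewrite exprS.
Qed.

Lemma reduced_prod I (s : seq I) (v : I -> ('I_r -> Om) -> Om) :
  (forall i, reduced (v i)) -> reduced (fun e => \prod_(i <- s) v i e).
Proof.
move=> vP; elim: s => [|i s IHs].
  by apply: eq_reduced reduced1 => e _; rewrite big_nil.
by apply: eq_reduced (reducedM (vP i) IHs) => e _; rewrite big_cons.
Qed.

Lemma reduced_horner (p : {poly {poly k}}) v :
  reduced v -> reduced (fun e => (map_poly J p).[v e]).
Proof.
move=> vP; apply: (@eq_reduced (fun e => \sum_(l < size p) J p`_l * v e ^+ l)).
  move=> e _; rewrite (@horner_coef_wide _ (size p)) ?size_poly //.
  by apply: eq_bigr => l _; rewrite coef_map.
by apply: reduced_sum => l _; apply/reducedZ/reducedX.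
Qed.

End Transfer.

(** * Automorphisms preserving residues *)

Section ShiftGroup.
Variables (Fq : finFieldType) (r n : nat).
Local Notation W := 'M[Fq]_(r, n.+1).
Local Notation S := (shift_mx Fq n).

Lemma shift_mxS m : S ^+ m.+1 = S *m S ^+ m. Proof. exact: exprS. Qed.
Lemma shift_mxSr m : S ^+ m.+1 = S ^+ m *m S. Proof. exact: exprSr. Qed.

Lemma leading_free (u : 'I_r -> 'rV[Fq]_r) (a : 'I_r -> Fq) :
  (forall i, leading i (u i)) -> \sum_i a i *: u i = 0 -> forall i, a i = 0.
Proof.
move=> ui au0 i1; apply/eqP; have [//|ai1] := eqVneq (a i1) 0.
case: (@arg_maxnP _ i1 (fun i => a i != 0) (fun i => i : nat) ai1) => i ai imax.
case/eqP: ai; have /rowP/(_ i) := au0; rewrite summxE mxE (bigD1 i) //= mxE.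
have [-> _] := leadingP _ _ (ui i); rewrite mulr1 big1 ?addr0 // => j ji; rewrite mxE.
have [ij|le_ji] := ltnP i j.
  apply/eqP; rewrite mulf_eq0; apply/orP; left; apply: contraLR ij => /imax.
  by rewrite -leqNgt.
have [_ ->] := leadingP _ _ (ui j); rewrite ?mulr0 //.
by rewrite ltn_neqAle le_ji andbT.
Qed.

Definition shift_linear (g : W -> W) : Prop :=
  [/\ linear g & forall M, g (M *m S) = g M *m S].

Lemma shift_linear_exp g nu M : shift_linear g -> g (M *m S ^+ nu) = g M *m S ^+ nu.
Proof.
case=> _ gS; elim: nu => [|nu IHnu]; first by rewrite !mulmx1.
by rewrite shift_mxSr !mulmxA gS IHnu.
Qed.

(** The endomorphism of the free module over A / t^(n+1) that takes the standard basis to [v]. *)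
Definition from_basis (v : 'I_r -> W) (M : W) : W :=
  \sum_i \sum_(m < n.+1) M i m *: (v i *m S ^+ m).

Lemma from_basis_shift_linear v : shift_linear (from_basis v).
Proof.
split=> [a M N|M].
  rewrite /from_basis scaler_sumr -big_split; apply: eq_bigr => i _ /=.
  rewrite scaler_sumr -big_split; apply: eq_bigr => m _ /=.
  by rewrite !mxE scalerDl scalerA.
rewrite /from_basis mulmx_suml; apply: eq_bigr => i _.
rewrite mulmx_suml big_ord_recl [in RHS]big_ord_recr /= mulmx_shiftE scale0r add0r.
rewrite [X in _ = _ + X](_ : _ = 0) ?addr0; last first.
  by rewrite -scalemxAl -mulmxA -shift_mxSr mulmx_shift_n scaler0.
apply: eq_bigr => m _; rewrite mulmx_shiftE !lift0 /= -scalemxAl -mulmxA -shift_mxSr.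
by congr (M i _ *: _); apply: val_inj; rewrite /= inordK // ltnW // ltnS.
Qed.

Lemma from_basis_delta v i : from_basis v (delta_mx i 0) = v i.
Proof.
rewrite /from_basis (bigD1 i) //= [X in _ + X]big1 ?addr0; last first.
  by move=> j /negPf ji; rewrite big1 // => m _; rewrite mxE ji scale0r.
rewrite big_ord_recl mxE !eqxx scale1r mulmx1 big1 ?addr0 // => m _.
by rewrite mxE andbF scale0r.
Qed.

Lemma from_basis_id M : from_basis (fun i => delta_mx i 0) M = M.
Proof.
have H i (m : 'I_n.+1) : delta_mx i 0 *m S ^+ m = delta_mx i m :> W.
  apply/matrixP => j l; rewrite mulmx_shift_expE !mxE.
  case: leqP => [le_ml|lt_lm]; last by rewrite (_ : (l == m) = false) ?andbF // -val_eqE ltn_eqF.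
  congr ((_ && _)%:R); rewrite -val_eqE /= inordK; last by have := ltn_ord l; lia.
  by rewrite subn_eq0 -val_eqE /= eqn_leq le_ml andbT.
rewrite [RHS]matrix_sum_delta; apply: eq_bigr => i _; apply: eq_bigr => m _.
by rewrite H.
Qed.

Lemma residue_mulmx_exp (M : W) nu : (0 < nu)%N -> residue (M *m S ^+ nu) = 0.
Proof. by case: nu => // nu _; apply/rowP => j; rewrite residueE mulmx_shift_expE mxE. Qed.

Lemma residue_from_basis v M : residue (from_basis v M) = \sum_i M i 0 *: residue (v i).
Proof.
rewrite /from_basis linear_sum; apply: eq_bigr => i _.
rewrite linear_sum big_ord_recl /= linearZ /= mulmx1 big1 ?addr0 // => m _.
by rewrite linearZ /= residue_mulmx_exp ?scaler0 // lift0.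
Qed.

Lemma shift_linear0 g : shift_linear g -> g 0 = 0.
Proof. by case=> g_lin _; have := g_lin (-1) 0 0; rewrite scaler0 addr0 scaleN1r addNr. Qed.

Lemma shift_linearZ g a M : shift_linear g -> g (a *: M) = a *: g M.
Proof. by move=> gP; rewrite -[a *: M]addr0 gP.1 shift_linear0 ?addr0. Qed.

Lemma shift_linearB g M N : shift_linear g -> g (M - N) = g M - g N.
Proof.
move=> gP; rewrite addrC -[- N]scaleN1r gP.1.
by rewrite scaleN1r addrC.
Qed.

Lemma shift_linear_sum g I (s : seq I) (P : pred I) (f : I -> W) :
  shift_linear g -> g (\sum_(i <- s | P i) f i) = \sum_(i <- s | P i) g (f i).
Proof.
move=> gP; apply: (big_morph g) => [M N|]; last exact: shift_linear0.
by rewrite -{1}[M]scale1r gP.1 scale1r.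
Qed.

Lemma shift_linear_basis g M : shift_linear g -> g M = from_basis (fun i => g (delta_mx i 0)) M.
Proof.
move=> gP; rewrite -{1}[M]from_basis_id /from_basis shift_linear_sum //.
apply: eq_bigr => i _; rewrite shift_linear_sum //; apply: eq_bigr => m _.
by rewrite shift_linearZ // shift_linear_exp.
Qed.

(** A form of Nakayama's lemma: if t^j N is in the kernel and j <= n, then [from_basis v N] has
    residue 0; the residues of [v] are free, so t divides N. After n + 1 steps the element is 0. *)
Lemma from_basis_inj v : (forall i, leading i (residue (v i))) -> injective (from_basis v).
Proof.
move=> vP; have gP := from_basis_shift_linear v.
suff inj0 M : from_basis v M = 0 -> M = 0.
  move=> M N /eqP; rewrite -subr_eq0 -shift_linearB // => /eqP/inj0/eqP.
  by rewrite subr_eq0 => /eqP.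
move=> M0; suff [N ->] : exists N, M = N *m S ^+ n.+1 by apply: mulmx_shift_n.
have H j : (j <= n.+1)%N -> exists N, M = N *m S ^+ j; last exact: (H n.+1).
elim: j => [|j IHj] lt_j; first by exists M; rewrite mulmx1.
have [N NE] := IHj (ltnW lt_j).
have [N' N'E] : exists N', N = N' *m S.
  apply: residue0_shift; apply/rowP => i; rewrite residueE mxE.
  have : residue (from_basis v N) = 0.
    apply/rowP => l; rewrite residueE mxE.
    have := M0; rewrite NE shift_linear_exp // => /matrixP/(_ l (Ordinal lt_j)).
    rewrite mulmx_shift_expE leqnn subnn !mxE => E.
    by rewrite -[RHS]E; congr (from_basis v N l _); apply: val_inj; rewrite /= inordK.
  by rewrite residue_from_basis => /(leading_free vP).
by exists N'; rewrite NE N'E -mulmxA shift_mxS.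
Qed.

Definition residue_auts : {set {perm W}} :=
  [set g : {perm W} | `[< shift_linear g >] & [forall M, residue (g M) == residue M]].

Lemma residue_autsP (g : {perm W}) :
  reflect (shift_linear g /\ forall M, residue (g M) = residue M) (g \in residue_auts).
Proof.
rewrite inE; apply: (iffP andP) => [[/asboolP gP /forallP gr]|[gP gr]].
  by split=> // M; apply/eqP.
by split; [apply/asboolP|apply/forallP => M; rewrite gr].
Qed.

Lemma residue_auts_group : group_set residue_auts.
Proof.
apply/group_setP; split=> [|g h /residue_autsP[[g1 g2] g3] /residue_autsP[[h1 h2] h3]].
  by apply/residue_autsP; split=> [|M]; [split=> [a M N|M]|]; rewrite !perm1.
apply/residue_autsP; split=> [|M]; last by rewrite permM h3 g3.
by split=> [a M N|M]; rewrite !permM ?g1 ?h1 ?g2 ?h2.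
Qed.
Canonical residue_aut_group := Group residue_auts_group.

(* If g <> 1 then g = 1 + D with D nilpotent, and D^2 M = 0 <> D M for some M; *)
(* then g^l M = M + l D M, so that a prime order l is the characteristic.     *)
Lemma residue_auts_pgroup p : p \in [pchar Fq] -> (p.-group residue_auts)%g.
Proof.
move=> pF; apply/pgroupP => l l_pr /(Cauchy l_pr)[g /residue_autsP[gP gr] ord_g].
have [M gM gD] : exists2 M, g M != M & g (g M - M) = g M - M.
  have [M0 gM0] : exists M, g M != M.
    apply/existsP; rewrite -negb_forall; apply/negP => /forallP g1.
    have : g = 1%g by apply/permP => M; rewrite perm1; apply/eqP.
    by move=> E; move: l_pr; rewrite -ord_g E order1.
  have H j : (j <= n.+1)%N -> forall M N, g M != M -> g M - M = N *m S ^+ (n.+1 - j) ->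
      exists2 M, g M != M & g (g M - M) = g M - M.
    elim: j => [|j IHj] lt_j M N gM NE.
      by rewrite -subr_eq0 NE subn0 mulmx_shift_n eqxx in gM.
    have [gD|gD] := eqVneq (g (g M - M)) (g M - M); first by exists M.
    have [N' N'E] : exists N', g N - N = N' *m S.
      by apply: residue0_shift; rewrite raddfB /= gr subrr.
    apply: (IHj (ltnW lt_j) (g M - M) N' gD).
    rewrite NE shift_linear_exp // -mulmxBl N'E -mulmxA -shift_mxS.
    by congr (_ *m S ^+ _); lia.
  by apply: (H n.+1 (leqnn _) M0 (g M0 - M0) gM0); rewrite subnn mulmx1.
have gm m : (g ^+ m)%g M = M + m%:R *: (g M - M).
  elim: m => [|m IHm]; first by rewrite expg0 perm1 scale0r addr0.
  rewrite expgSr permM IHm addrC gP.1 gD -natr1 scalerDl scale1r.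
  by rewrite [RHS]addrCA [M + _]addrC subrK.
have /eqP := gm l; rewrite -ord_g expg_order perm1 -subr_eq0 opprD addrA subrr add0r.
rewrite oppr_eq0 scaler_eq0 subr_eq0 (negPf gM) orbF ord_g => l0.
have : l \in [pchar Fq] by rewrite inE l_pr.
by rewrite (pcharf_eq pF).
Qed.

(** Both families are bases, and the automorphism taking one to the other preserves residues because
    it does so on a basis. *)
Lemma residue_auts_transitive (v v' : 'I_r -> W) :
    (forall i, leading i (residue (v i))) -> (forall i, residue (v i) = residue (v' i)) ->
  exists2 g, g \in residue_auts & forall i, g (v i) = v' i.
Proof.
move=> vP vv'; have v'P i : leading i (residue (v' i)) by rewrite -vv'.
pose pv := perm (from_basis_inj vP); pose pv' := perm (from_basis_inj v'P).
have gE N : (pv^-1 * pv')%g (from_basis v N) = from_basis v' N.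
  by rewrite permM -[from_basis v N](permE (from_basis_inj vP)) permK permE.
have [lv Sv] := from_basis_shift_linear v; have [lv' Sv'] := from_basis_shift_linear v'.
have surj M : exists N, M = from_basis v N.
  by exists (pv^-1%g M); rewrite -[RHS](permE (from_basis_inj vP)) permKV.
exists (pv^-1 * pv')%g; last by move=> i; rewrite -[v i]from_basis_delta gE from_basis_delta.
apply/residue_autsP; split=> [|M].
  split=> [a M N|M]; have [M' ->] := surj M; last by rewrite -Sv !gE Sv'.
  by have [N' ->] := surj N; rewrite -lv !gE lv'.
have [M' ->] := surj M; rewrite gE !residue_from_basis.
by apply: eq_bigr => i _; rewrite vv'.
Qed.

End ShiftGroup.

(** * Independence of the good monomials *)

Definition has_top (R : nzRingType) (p : {poly R}) b z := (size p <= b + 1)%N /\ p`_b = z.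

Lemma has_top1 (R : nzRingType) I (F : I -> nat) (z : I -> R) (p : I -> {poly R}) :
  has_top (\prod_(i <- [::]) p i) (\sum_(i <- [::]) F i) (\prod_(i <- [::]) z i).
Proof. by rewrite /has_top !big_nil size_poly1 coef1. Qed.

Lemma has_topM (R : nzRingType) (p p' : {poly R}) b b' z z' :
  has_top p b z -> has_top p' b' z' -> has_top (p * p') (b + b') (z * z').
Proof.
rewrite /has_top !addn1 => -[szp <-] [szp' <-]; split.
  apply: leq_trans (size_polyMleq _ _) _; rewrite -subn1 leq_subLR.
  by apply: leq_trans (leq_add szp szp') _; rewrite addSn addnS.
have lt_b : (b < (b + b').+1)%N by rewrite ltnS leq_addr.
rewrite coefM (bigD1 (Ordinal lt_b)) //= addKn big1 ?addr0 // => -[i /= lt_i].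
rewrite -val_eqE /= => ib; have [lt_ib|lt_bi|E] := ltngtP i b; last by rewrite E eqxx in ib.
  by rewrite [X in _ * X]nth_default ?mulr0 // (leq_trans szp') //; lia.
by rewrite nth_default ?mul0r // (leq_trans szp).
Qed.

Section MonomialIndependence.
Variables (Fq : finFieldType) (r n : nat) (k : fieldType).
Local Notation q := #|Fq|.
Local Notation W := 'M[Fq]_(r, n.+1).
Local Notation S := (shift_mx Fq n).
Local Notation G := (residue_aut_group Fq r n).
Variables (c : {rmorphism Fq -> k}) (x : {additive 'rV[Fq]_r -> k}) (d : nat -> k).
Hypothesis xZ : forall a u, x (a *: u) = c a * x u.
Hypothesis x_eq0 : forall u, (x u == 0) = (u == 0).
Hypothesis d0 : d 0 = 1.
Hypothesis dr : d r != 0.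
Hypothesis d_root : forall u, \sum_(l < r.+1) d l * x u ^+ (q ^ l) = 0.
Hypothesis x_p_indep : forall D : {ffun 'I_r -> 'I_((q ^ r) ^ n)} -> k,
  \sum_a D a ^+ ((q ^ r) ^ n) * \prod_i x (delta_mx 0 i) ^+ a i = 0 -> forall a, D a = 0.
Hypothesis x_indep : forall K (f : res_monom Fq r K -> Fq),
  (forall m, ~~ res_good m -> f m = 0) ->
  \sum_m c (f m) * \prod_i (if m i is Some (u, a) then (x u)^-1 ^+ a.+1 else 1) = 0 ->
  forall m, f m = 0.
Variables (Om : fieldType) (J : {rmorphism {poly k} -> Om}).
Hypothesis J_inj : injective J.
Variable iota : {rmorphism ratfun Fq -> Om}.
Hypothesis iotaE : forall p, iota (polyF p) = J (map_poly c p).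
Variable e : 'I_r -> Om.
Hypothesis eP : forall j, iter n (phi Fq r d J) (e j) = J (x (delta_mx 0 j))%:P.

Local Notation hate := (hat c d J e).
Local Notation value := (monom_value (fun M => (hate M)^-1)).

Section Action.
Variable K : nat.

Definition act_monom (g : {perm W}) (m : monom Fq r n K) : monom Fq r n K :=
  [ffun i => omap (fun z => (g z.1, z.2)) (m i)].

Lemma act_monom1 : act_monom 1%g =1 id.
Proof. by move=> m; apply/ffunP => i; rewrite ffunE; case: (m i) => [[w a]|] //=; rewrite perm1. Qed.

Lemma act_monomM : {in G &, forall g h, act_monom (g * h)%g =1 act_monom h \o act_monom g}.
Proof.
move=> g h _ _ m; apply/ffunP => i; rewrite !ffunE.
by case: (m i) => [[w a]|] //=; rewrite permM.
Qed.

Definition res_of (m : monom Fq r n K) : res_monom Fq r K :=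
  [ffun i => omap (fun z => (residue z.1, z.2)) (m i)].

Definition lift_mx (u : 'rV[Fq]_r) : W := \matrix_(j, l) if l == 0 then u 0 j else 0.

Lemma residue_lift u : residue (lift_mx u) = u.
Proof. by apply/rowP => j; rewrite residueE mxE. Qed.

Definition lift_of (m : res_monom Fq r K) : monom Fq r n K :=
  [ffun i => omap (fun z => (lift_mx z.1, z.2)) (m i)].

Lemma res_good_of m : res_good (res_of m) = good m.
Proof. by apply: eq_forallb => i; rewrite ffunE /good_factor; case: (m i) => [[w a]|]. Qed.

(** The vectors of a good monomial have distinct leading indices, so [residue_auts_transitive] moves
    them all at once. Hence the orbits of good monomials are fibres of [res_of]. *)
Lemma act_monom_lift m : good m -> exists2 g, g \in G & act_monom g m = lift_of (res_of m).
Proof.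
move=> /forallP mg.
pose v i := if m i is Some (w, _) then w else delta_mx i 0.
pose v' i := if m i is Some (w, _) then lift_mx (residue w) else delta_mx i 0.
have [i|i|g gG gv] := @residue_auts_transitive Fq r n v v'.
- have := mg i; rewrite /good_factor /v; case: (m i) => [[w a] //|_].
  apply/leadingP; rewrite residueE mxE !eqxx; split=> // j ij.
  rewrite residueE mxE (_ : (j == i) = false) //.
  by apply/eqP => jE; rewrite jE ltnn in ij.
- by rewrite /v /v'; case: (m i) => [[w a]|] //; rewrite residue_lift.
exists g => //; apply/ffunP => i; rewrite !ffunE.
by have := gv i; rewrite /v /v'; case: (m i) => [[w a]|] //= ->.
Qed.

(** An automorphism of the module acts on the points as a change of the e_i. *)
Lemma hat_act g : g \in G -> forall M,
  hat c d J (fun i => hate (g (delta_mx i 0))) M = hate (g M).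
Proof.
move=> /residue_autsP[gP _] M; rewrite (shift_linear_basis _ gP) /from_basis raddf_sum.
rewrite /hat; apply: eq_bigr => j _; rewrite raddf_sum; apply: eq_bigr => m _ /=.
by rewrite (iter_phi_hat c d_root eP) hatZ.
Qed.

Lemma torsion_point_act g : g \in G ->
  torsion_point Fq n d (fun i => x (delta_mx 0 i)) J (fun i => hate (g (delta_mx i 0))).
Proof.
move=> /residue_autsP[_ gr] i; rewrite (iter_phi_hat c d_root eP) (hat_top xZ eP) gr.
congr (J (x _)%:P); apply/rowP => j; rewrite residueE !mxE eqxx andbT.
by rewrite eq_sym.
Qed.

Local Notation reduced := (reduced Fq n d (fun i => x (delta_mx 0 i)) J).

Lemma reduced_hat (M : W) : reduced (fun e => hat c d J e M).
Proof.
rewrite /hat; apply: reduced_sum => j _; apply: reduced_sum => m _; apply: reducedZ.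
apply: (@eq_reduced _ _ _ _ _ _ _ _ (fun e => J ('X ^+ m) * (map_poly J (iterate Fq r d m)).[e j])).
  by move=> e' _; rewrite rmorphXn (horner_iterate_O Fq r d J m (e' j)).
exact/reducedZ/reduced_horner/reduced_coord.
Qed.

(* hat M is a root of H_(n+1) = X + X^2 U, so 1 / hat M = - U (hat M).        *)
Lemma reduced_hatV (M : W) : M != 0 -> reduced (fun e => (hat c d J e M)^-1).
Proof.
move=> M0; pose H := iterate Fq r d n.+1.
have [Hb H1] := @iterate_bounded Fq r k d d0 n.+1.
pose U := - drop_poly 2 H.
apply: (@eq_reduced _ _ _ _ _ _ _ _ (fun e => (map_poly J U).[hat c d J e M])); last first.
  exact/reduced_horner/reduced_hat.
move=> e' e'P; have h0 : hat c d J e' M != 0 by rewrite (hat_eq0 xZ x_eq0 d_root J_inj e'P).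
apply: (mulfI h0); rewrite mulfV //; apply: (mulfI h0); rewrite mulr1.
have : (map_poly J H).[hat c d J e' M] = 0.
  have /eqP := iterate_O_root c d_root e'P n.+1 M.
  rewrite mulmx_shift_n raddf0 mulf_eq0 expf_eq0 (negPf (t_O_neq0 J_inj)) andbF /=.
  by move/eqP.
have -> : H = 'X + drop_poly 2 H * 'X^2.
  rewrite -[LHS](poly_take_drop 2); congr (_ + _); apply/polyP => i.
  rewrite coef_take_poly coefX; case: i => [|[|i]] //=; first exact: (Hb 0).1.
rewrite rmorphD rmorphM /= map_polyX map_polyXn hornerD hornerM hornerX hornerXn => /eqP.
rewrite addr_eq0 => /eqP E; rewrite /U rmorphN hornerN !mulrN mulrA -expr2 mulrC.
exact: esym E.
Qed.

(** Applying [g] to the vectors amounts to replacing the e_i by other points above the same x_i; a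
    [reduced] relation survives this. *)
Lemma value_act (f : monom Fq r n K -> ratfun Fq) g : g \in G ->
    (forall m, ~~ good m -> f m = 0) -> \sum_m iota (f m) * value m = 0 ->
  \sum_m iota (f m) * value (act_monom g m) = 0.
Proof.
move=> gG f_good f0; have [s s0 [D DE]] := common_denominator f.
have iota_s : iota (polyF s) != 0 by rewrite fmorph_eq0 /polyF tofrac_eq0.
have iotaD m : iota (polyF s) * iota (f m) = J (map_poly c (D m)).
  by rewrite -rmorphM mulrC [_ * polyF s]DE iotaE.
pose v (y : 'I_r -> Om) := \sum_(m : monom Fq r n K | good m)
  J (map_poly c (D m)) * monom_value (fun M => (hat c d J y M)^-1) m.
have v_reduced : reduced v.
  apply: reduced_sum => m /forallP mg; apply: reducedZ; apply: (reduced_prod dr J_inj) => i.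
  have := mg i; rewrite /factor_value /good_factor; case: (m i) => [[w a]|_]; last first.
    exact: reduced1.
  move=> /leadingP[wi _]; apply: (reducedX dr J_inj); apply: reduced_hatV.
  by apply: contra_eq_neq wi => ->; rewrite residueE mxE eq_sym oner_eq0.
have vE y (F : monom Fq r n K -> Om) :
    (forall m, F m = monom_value (fun M => (hat c d J y M)^-1) m) ->
    v y = iota (polyF s) * \sum_m iota (f m) * F m.
  move=> FE; rewrite /v mulr_sumr [RHS](bigID (@good Fq r n K)) /= [X in _ + X]big1 ?addr0.
    by apply: eq_bigr => m _; rewrite mulrA iotaD FE.
  by move=> m /f_good->; rewrite rmorph0 mul0r mulr0.
have ve : v e = 0 by rewrite (vE e (fun m => value m)) ?f0 ?mulr0.
have := reduced_transfer c dr J_inj x_p_indep v_reduced eP (torsion_point_act gG) ve.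
rewrite (vE _ (fun m => value (act_monom g m))) => [/eqP|m].
  by rewrite mulf_eq0 (negPf iota_s) => /eqP.
apply: eq_bigr => i _; rewrite ffunE /factor_value; case: (m i) => [[w a]|] //=.
by rewrite hat_act.
Qed.

Lemma sum_value_fiber (mb : res_monom Fq r K) :
  \sum_(m | res_of m == mb) value m =
  \prod_i (if mb i is Some (u, a) then \sum_(M : W | residue M == u) (hate M)^-1 ^+ a.+1 else 1).
Proof.
transitivity (\prod_i \sum_(z | omap (fun z => (residue z.1, z.2)) z == mb i)
    factor_value (fun M => (hate M)^-1) (z : option (W * 'I_K))).
  rewrite bigA_distr_big_dep /=; apply: eq_bigl => m.
  apply/eqP/familyP => [<- i|mP]; first by rewrite unfold_in /= ffunE.
  by apply/ffunP => i; rewrite ffunE; have := mP i; rewrite unfold_in => /eqP.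
apply: eq_bigr => i _; case: (mb i) => [[u a]|]; last first.
  by rewrite (big_pred1 None) // => -[].
rewrite (reindex_omap (fun M : W => Some (M, a)) (omap fst)) => [|[[M b]|] //= /eqP[_ ->] //].
by apply: eq_bigl => M; rewrite /= eqxx andbT; apply/eqP/eqP => [[]|->].
Qed.

(** Each fibre sum is a product of power sums, hence a polynomial in t with known top term. The top
    coefficient of the relation is an [Fq]-relation between products of inverses of linear forms,
    which is trivial. *)
Lemma trace_independent (f : res_monom Fq r K -> ratfun Fq) :
    (forall mb, ~~ res_good mb -> f mb = 0) ->
    \sum_mb iota (f mb) * \sum_(m | res_of m == mb) value m = 0 ->
  forall mb, f mb = 0.
Proof.
move=> f_good f0 mb1; apply/eqP; have [//|fmb1] := eqVneq (f mb1) 0.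
have [s s0 [D DE]] := common_denominator f.
pose degz (z : option ('rV[Fq]_r * 'I_K)) := if z is Some (_, a) then (n * a.+1)%N else 0%N.
pose top (z : option ('rV[Fq]_r * 'I_K)) : k :=
  if z is Some (u, a) then (x u)^-1 ^+ a.+1 else 1.
have /choice[P PE] (z : option ('rV[Fq]_r * 'I_K)) : exists p : {poly k},
    has_top p (degz z) (top z) /\
    ((if z is Some (u, _) then u != 0 else true) -> J p = if z is Some (u, a) then
       \sum_(M : W | residue M == u) (hate M)^-1 ^+ a.+1 else 1).
  case: z => [[u a]|] /=; last first.
    exists 1; split=> [|_]; last exact: rmorph1.
    by rewrite /has_top size_poly1 coef1.
  have [->|u0] := eqVneq u 0.
    (* A default value: the residues in a good monomial are nonzero. *)
    exists ((x 0)^-1 ^+ a.+1 *: 'X^(n * a.+1)); split=> //; split.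
      by apply: leq_trans (size_scale_leq _ _) _; rewrite size_polyXn addn1.
    by rewrite coefZ coefXn eqxx mulr1.
  have [p [pE szp topp]] := trace_poly xZ x_eq0 d0 dr d_root J_inj eP a u0.
  by exists p.
pose deg (mb : res_monom Fq r K) := (\sum_i degz (mb i))%N.
have Ptop (mb : res_monom Fq r K) : has_top (\prod_i P (mb i)) (deg mb) (\prod_i top (mb i)).
  rewrite /deg; elim: (index_enum _) => [|i l IHl]; first exact: has_top1.
  by rewrite !big_cons; apply: has_topM => //; case: (PE (mb i)).
have rel : \sum_(mb : res_monom Fq r K | res_good mb) map_poly c (D mb) * \prod_i P (mb i) = 0.
  apply: J_inj; rewrite rmorph0 rmorph_sum -[RHS](mulr0 (iota (polyF s))) -[X in _ = _ * X]f0.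
  rewrite mulr_sumr [RHS](bigID (@res_good Fq r K)) /= [X in _ = _ + X]big1 ?addr0; last first.
    by move=> mb /f_good->; rewrite rmorph0 mul0r mulr0.
  apply: eq_bigr => mb /forallP mbg; rewrite mulrA -rmorphM mulrC.
  rewrite [polyF s * _]mulrC [_ * polyF s]DE iotaE rmorphM mulrC; congr (_ * _).
  rewrite sum_value_fiber rmorph_prod; apply: eq_bigr => i _.
  have [_ ->] := PE (mb i); first by case: (mb i).
  have := mbg i; case: (mb i) => [[u a]|] // /leadingP[ui _].
  by apply: contra_eq_neq ui => ->; rewrite mxE eq_sym oner_eq0.
have D_eq0 mb : (D mb == 0) = (f mb == 0).
  have : (polyF (D mb) == 0) = (f mb * polyF s == 0) by rewrite [f mb * _]DE.
  by rewrite mulf_eq0 /polyF !tofrac_eq0 (negPf s0) orbF.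
pose w (mb : res_monom Fq r K) := ((size (D mb)).-1 + deg mb)%N.
have Dmb1 : D mb1 != 0 by rewrite D_eq0.
case: (@arg_maxnP _ mb1 (fun mb => D mb != 0) w Dmb1) => mb0 Dmb0 mb0max.
(* The contributions of the [D mb] to the largest total degree in t, which is [w mb0]. *)
pose cc mb := if res_good mb && (deg mb <= w mb0)%N then (D mb)`_(w mb0 - deg mb) else 0.
have cc0 : forall mb, cc mb = 0.
  apply: x_indep => [mb /negPf mbN|]; first by rewrite /cc mbN.
  have := congr1 (fun p : {poly k} => p`_(w mb0)) rel; rewrite coef0 => rel0.
  rewrite -[RHS]rel0 coef_sum (bigID (@res_good Fq r K)) /= [X in _ + X]big1 ?addr0; last first.
    by move=> mb /negPf mbN; rewrite /cc mbN rmorph0 mul0r.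
  apply: eq_bigr => mb mbg; rewrite /cc mbg /=.
  have [D0|D_neq0] := eqVneq (D mb) 0.
    by rewrite D0 coef0 if_same rmorph0 map_poly0 !mul0r coef0.
  have le_w : (w mb <= w mb0)%N by apply: mb0max.
  have le_deg : (deg mb <= w mb0)%N by apply: leq_trans le_w; apply: leq_addl.
  have Dtop : has_top (map_poly c (D mb)) (w mb0 - deg mb) (c (D mb)`_(w mb0 - deg mb)).
    split; last by rewrite coef_map.
    rewrite size_map_poly addn1 -[X in (X <= _)%N]prednK ?lt0n ?size_poly_eq0 //.
    by rewrite ltnS leq_subRL // addnC.
  have [_] := has_topM Dtop (Ptop mb); rewrite subnK // => ->.
  by rewrite le_deg.
have mb0g : res_good mb0 by apply: contraNT Dmb0 => /f_good/eqP; rewrite -D_eq0.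
case/eqP: Dmb0; apply/eqP; rewrite -lead_coef_eq0 lead_coefE.
by have := cc0 mb0; rewrite /cc mb0g leq_addl addnK /= => ->.
Qed.

(** The p-group of automorphisms preserving residues permutes relations, so a nonzero one yields a
    nonzero invariant one. Its coefficients are constant on the good fibres of [res_of], and
    grouping by fibres contradicts [trace_independent]. *)
Theorem monom_value_independent (f : monom Fq r n K -> ratfun Fq) :
    (forall m, ~~ good m -> f m = 0) -> \sum_m iota (f m) * value m = 0 ->
  forall m, f m = 0.
Proof.
move=> f_good f0 m1; apply/eqP; have [//|fm1] := eqVneq (f m1) 0.
have [p _ pF] := finPcharP Fq.
have pR : p \in [pchar ratfun Fq].
  by apply: (rmorph_pchar (@polyF Fq)); apply: (rmorph_pchar (@polyC Fq)).
have [a [f' [f'E [m2 f'm2] f'G]]] := pgroup_fixed_vector act_monom1 act_monomM pR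
  (residue_auts_pgroup r n pF) (ex_intro _ m1 fm1).
have good_act g m : g \in G -> good (act_monom g m) = good m.
  move=> /residue_autsP[_ gr]; apply: eq_forallb => i; rewrite ffunE /good_factor.
  by case: (m i) => [[w b]|] //=; rewrite gr.
have f'_good m : ~~ good m -> f' m = 0.
  move=> mN; rewrite f'E big1 // => g gG; rewrite big1 ?mulr0 // => m' /eqP mE.
  by apply: f_good; rewrite -(good_act g) // -mE.
have f'0 : \sum_m iota (f' m) * value m = 0.
  transitivity (\sum_(g in G) iota (a g) * \sum_m iota (f m) * value (act_monom g m)).
    under eq_bigr => m _ do rewrite f'E rmorph_sum mulr_suml.
    rewrite exchange_big; apply: eq_bigr => g gG /=.
    rewrite [in RHS](partition_big (act_monom g) predT) //= mulr_sumr.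
    apply: eq_bigr => m _; rewrite rmorphM -mulrA rmorph_sum mulr_suml; congr (_ * _).
    by apply: eq_big => [m'|m' /eqP->] //; rewrite eq_sym.
  by rewrite big1 // => g gG; rewrite value_act ?mulr0.
case/eqP: f'm2.
have [m2g|/f'_good//] := boolP (good m2).
have f'_lift m : good m -> f' m = f' (lift_of (res_of m)).
  by move=> /act_monom_lift[g gG <-]; rewrite f'G.
have res_lift mb : res_of (lift_of mb) = mb.
  by apply/ffunP => i; rewrite !ffunE; case: (mb i) => [[u b]|] //=; rewrite residue_lift.
rewrite f'_lift //; apply: (trace_independent (f := f' \o lift_of)) => [mb mbN|].
  by apply: f'_good; rewrite -res_good_of res_lift.
rewrite -[RHS]f'0 [RHS](partition_big res_of predT) //=; apply: eq_bigr => mb _.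
rewrite mulr_sumr; apply: eq_bigr => m /eqP <-.
have [mg|mN] := boolP (good m); first by rewrite -f'_lift.
rewrite [f' m]f'_good // [f' _]f'_good ?rmorph0 ?mul0r //.
by rewrite -res_good_of res_lift res_good_of.
Qed.

End Action.

End MonomialIndependence.

(** * Existence of torsion points *)

Section CountableCode.

(** Countability as a retraction from a [countType]; it makes [countable_algebraic_closure]
    applicable to k(t). *)
Definition coded (R : Type) : Prop :=
  exists (T : countType) (f : R -> T) (g : T -> R), cancel f g.

Lemma coded_fraction (R : idomainType) : coded R -> coded {fraction R}.
Proof.
move=> [T [f [g fK]]].
have /choice[u uP] (x : {fraction R}) : exists z : R * R,
    x = FracField.tofrac z.1 / FracField.tofrac z.2.
  by have [a [b [b0 xb]]] := fracP x; exists (a, b); rewrite -xb mulfK ?tofrac_eq0.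
exists (T * T)%type, (fun x => (f (u x).1, f (u x).2)).
exists (fun z => FracField.tofrac (g z.1) / FracField.tofrac (g z.2)) => x /=.
by rewrite !fK -uP.
Qed.

Lemma coded_poly (R : nzRingType) : coded R -> coded {poly R}.
Proof.
move=> [T [f [g fK]]]; exists (seq T), (fun p : {poly R} => map f p), (fun s => Poly (map g s)).
by move=> p; rewrite (mapK fK) polyseqK.
Qed.

Lemma coded_mpoly (R : countNzRingType) r : coded {mpoly R[r]}.
Proof.
exists (seq ('X_{1..r} * R)%type), (fun p => [seq (m, p@_m) | m <- msupp p]).
exists (fun s => \sum_(z <- s) z.2 *: 'X_[z.1]) => p.
by rewrite big_map -mpolyE.
Qed.

Lemma coded_closure (K : fieldType) : coded K ->
  exists (Om : closedFieldType) (h : {rmorphism K -> Om}), True.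
Proof.
move=> [T [f [g fK]]].
pose cK : countFieldType := HB.pack K (CanIsCountable fK).
have [Om [h _]] := countable_algebraic_closure cK.
by exists Om, h.
Qed.

End CountableCode.

Lemma exists_torsion_point (Fq : finFieldType) (r n : nat) (k : fieldType) (d : nat -> k)
    (x : 'I_r -> k) : coded k -> d r != 0 ->
  exists (Om : fieldType) (J : {rmorphism {poly k} -> Om}) (e : 'I_r -> Om),
    injective J /\ torsion_point Fq n d x J e.
Proof.
move=> kC dr; have [Om [h _]] := coded_closure (coded_fraction (coded_poly kC)).
pose J : {rmorphism {poly k} -> Om} := h \o @FracField.tofrac {poly k}.
have J_inj : injective J.
  by move=> p p' /fmorph_inj/eqP; rewrite tofrac_eq => /eqP.
suff /choice[e eP] i : exists z, iter n (phi Fq r d J) z = J (x i)%:P.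
  by exists Om, J, e.
pose p := (J 'X ^+ n) *: iterate_O Fq r d J n - (J (x i)%:P)%:P.
have szp : size p != 1.
  have sz1 : size (J 'X ^+ n *: iterate_O Fq r d J n) = (#|Fq| ^ (r * n)).+1.
    by rewrite size_scale ?expf_neq0 ?t_O_neq0 // (size_iterate_O Fq dr J_inj).
  have q_gt0 : (0 < #|Fq| ^ (r * n))%N by rewrite expn_gt0 ltnW ?card_gt1.
  rewrite size_polyDl sz1 ?eqSS -?lt0n // size_polyN.
  by apply: leq_ltn_trans (size_polyC_leq1 _) _; rewrite ltnS.
have [z /eqP] := closed_rootP p szp.
rewrite hornerD hornerN hornerC hornerZ (horner_iterate_O Fq r d J n z) => /eqP.
by rewrite subr_eq0 => /eqP; exists z.
Qed.

(** * Evaluation at torsion points *)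

Section TensorMorphism.
Variables (K : fieldType) (A B : comAlgType K) (R : comNzRingType).
Variables (c : {rmorphism K -> R}) (f : {rmorphism A -> R}) (g : {rmorphism B -> R}).
Hypothesis fZ : forall a y, f (a *: y) = c a * f y.
Hypothesis gZ : forall a y, g (a *: y) = c a * g y.

(* R seen as a K-algebra through c, as bilin requires modules over K.         *)
Definition twisted : Type := R.
HB.instance Definition _ := GRing.ComNzRing.on twisted.
Definition twisted_scale (a : K) (y : twisted) : twisted := c a * y.
Fact twisted_scaleA a b y : twisted_scale a (twisted_scale b y) = twisted_scale (a * b) y.
Proof. by rewrite /twisted_scale mulrA rmorphM. Qed.
Fact twisted_scale1 : left_id 1 twisted_scale.
Proof. by move=> y; rewrite /twisted_scale rmorph1 mul1r. Qed.
Fact twisted_scaleDr : right_distributive twisted_scale +%R.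
Proof. by move=> a y z; rewrite /twisted_scale mulrDr. Qed.
Fact twisted_scaleDl y : {morph twisted_scale^~ y : a b / a + b}.
Proof. by move=> a b; rewrite /twisted_scale rmorphD mulrDl. Qed.
HB.instance Definition _ := GRing.Zmodule_isLmodule.Build K twisted
  twisted_scaleA twisted_scale1 twisted_scaleDr twisted_scaleDl.

Let b (y : A) (z : B) : twisted := f y * g z.

Let b_bilin : bilin b.
Proof.
split=> [z|y] a u v; rewrite /b /=.
  by rewrite rmorphD mulrDl fZ -mulrA.
by rewrite rmorphD mulrDr gZ mulrCA.
Qed.

Let tens_map (z : tens A B) : R := tsum b (generic_quotient.repr z).

Let tens_map_tpi s : tens_map (tpi s) = \sum_(p <- s) f p.1 * g p.2.
Proof. exact: (tsum_repr s b_bilin). Qed.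

Let tens_map_tensor y z : tens_map (tensor y z) = f y * g z.
Proof. by rewrite tens_map_tpi big_seq1. Qed.

Let tens_map_is_zmod_morphism : zmod_morphism tens_map.
Proof.
move=> y z; rewrite -[y]tpiK -[z]tpiK -[- tpi (generic_quotient.repr z)]/(topp _) topp_pi.
rewrite -[_ + _]/(tadd _ _) tadd_pi !tens_map_tpi big_cat big_map -sumrN /=.
by congr (_ + _); apply: eq_bigr => p _; rewrite rmorphN mulNr.
Qed.
HB.instance Definition _ := GRing.isZmodMorphism.Build (tens A B) R tens_map
  tens_map_is_zmod_morphism.

Let tens_map_is_monoid_morphism : monoid_morphism tens_map.
Proof.
split; first by rewrite -[1]/(tensor 1 1) tens_map_tensor !rmorph1 mulr1.
move=> y z; rewrite -[y]tpiK -[z]tpiK -[_ * _]/(tmul _ _) tmul_pi !tens_map_tpi.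
rewrite mulr_suml big_allpairs_dep; apply: eq_bigr => p _.
rewrite mulr_sumr; apply: eq_bigr => p' _ /=.
by rewrite !rmorphM mulrACA.
Qed.
HB.instance Definition _ := GRing.isMonoidMorphism.Build (tens A B) R tens_map
  tens_map_is_monoid_morphism.

Lemma tens_rmorphism : exists h : {rmorphism tens A B -> R},
  forall y z, h (tensor y z) = f y * g z.
Proof. by exists tens_map; apply: tens_map_tensor. Qed.

End TensorMorphism.

Section QuotientMorphism.
Variables (R R' : comPzRingType) (G : R -> Prop) (f : {rmorphism R -> R'}).
Hypothesis fG : forall y, G y -> f y = 0.

Let qring_map (z : qring G) : R' := f (generic_quotient.repr z).

Let qring_map_pi y : qring_map (qpi G y) = f y.
Proof.
apply/eqP; rewrite -subr_eq0 -rmorphB; apply/eqP.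
have : generic_quotient.repr (qpi G y) - y \in ideal_gen G by rewrite -qpi_eq qpiK.
case/ideal_genP => s sG ->; rewrite rmorph_sum big_seq big1 // => p /sG/fG E.
by rewrite rmorphM E mulr0.
Qed.

Let qring_map_is_zmod_morphism : zmod_morphism qring_map.
Proof. by move=> y z; rewrite -[y]qpiK -[z]qpiK -rmorphB !qring_map_pi rmorphB. Qed.
HB.instance Definition _ := GRing.isZmodMorphism.Build (qring G) R' qring_map
  qring_map_is_zmod_morphism.

Let qring_map_is_monoid_morphism : monoid_morphism qring_map.
Proof.
split=> [|y z]; first by rewrite -(rmorph1 (qpi G)) qring_map_pi rmorph1.
by rewrite -[y]qpiK -[z]qpiK -rmorphM !qring_map_pi rmorphM.
Qed.
HB.instance Definition _ := GRing.isMonoidMorphism.Build (qring G) R' qring_map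
  qring_map_is_monoid_morphism.

Lemma qring_rmorphism : exists h : {rmorphism qring G -> R'}, forall y, h (qpi G y) = f y.
Proof. by exists qring_map; apply: qring_map_pi. Qed.

End QuotientMorphism.

Section RVMorphism.
Variables (K : fieldType) (V : vectType K) (L : fieldType) (c : {rmorphism K -> L}).
Variable f : V -> L.
Hypothesis fP : forall a u v, f (a *: u + v) = c a * f u + f v.
Hypothesis f_neq0 : forall v, v != 0 -> f v != 0.

Let f0 : f 0 = 0.
Proof. by have := fP (-1) 0 0; rewrite scaler0 addr0 rmorphN rmorph1 mulN1r addNr. Qed.

Let fZ a u : f (a *: u) = c a * f u.
Proof. by rewrite -[a *: u]addr0 fP f0 addr0. Qed.

Let f_sum I (s : seq I) (F : I -> V) : f (\sum_(i <- s) F i) = \sum_(i <- s) f (F i).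
Proof.
apply: (big_morph f) => // u v.
by rewrite -{1}[u]scale1r fP rmorph1 mul1r.
Qed.

Let sub : {rmorphism symV V -> L} := mmap c (fun i => f (vbasis {:V})`_i).

Let sub_in v : sub (sym_in v) = f v.
Proof.
rewrite [in RHS](coord_vbasis (memvf v)) f_sum /sym_in rmorph_sum /=.
by apply: eq_bigr => i _; rewrite mmapZ mmapX mmap1U fZ.
Qed.

Let frac_in_specializes v : specializes sub (frac_in v) (f v).
Proof. by rewrite -sub_in; apply: specializes_tofrac. Qed.

Let scale_specializes a (y : fracV V) z : specializes sub y z -> specializes sub (a *: y) (c a * z).
Proof.
move=> yz; apply: specializesM => //.
by have := specializes_tofrac sub (a%:MP); rewrite /= mmapC.
Qed.

(** The elements at which [sub] can be evaluated form a subalgebra, which contains all 1/v because f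
    v is nonzero; so it contains R_V. *)
Let RV_specializes (y : RV V) : exists z, specializes sub (val y) z.
Proof.
pose S : {pred fracV V} := fun y => `[< exists z, specializes sub y z >].
have /asboolP/(_ S) Sy : val y \in @RV_pred K V := valP y.
apply/asboolP; apply: Sy => [|v v0].
  split=> [|a u v /asboolP[u' uP] /asboolP[v' vP]|u v /asboolP[u' uP] /asboolP[v' vP]].
  - apply/asboolP; exists 1; rewrite -tofrac1 -(rmorph1 sub); exact: specializes_tofrac.
  - by apply/asboolP; exists (c a * u' + v'); apply/specializesD/vP/scale_specializes.
  - by apply/asboolP; exists (u' * v'); apply: specializesM.
apply/asboolP; exists (f v)^-1; apply: specializesV; first exact: f_neq0.
exact: frac_in_specializes.
Qed.

Definition RV_map (y : RV V) : L := sval (cid (RV_specializes y)).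

Lemma RV_mapE y z : specializes sub (val y) z -> RV_map y = z.
Proof. exact: specializes_fun (svalP (cid (RV_specializes y))). Qed.

Let RV_mapP y : specializes sub (val y) (RV_map y).
Proof. exact: (svalP (cid (RV_specializes y))). Qed.

Lemma RV_mapZ a y : RV_map (a *: y) = c a * RV_map y.
Proof. by apply: RV_mapE; apply: scale_specializes (RV_mapP y). Qed.

Lemma RV_map_is_zmod_morphism : zmod_morphism RV_map.
Proof.
move=> y z; rewrite -[- z]scaleN1r.
rewrite -[RHS](_ : RV_map y + c (-1) * RV_map z = _); last by rewrite rmorphN rmorph1 mulN1r.
apply: RV_mapE.
exact: specializesD (RV_mapP y) (scale_specializes (-1) (RV_mapP z)).
Qed.
HB.instance Definition _ := GRing.isZmodMorphism.Build (RV V) L RV_map RV_map_is_zmod_morphism.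

Lemma RV_map_is_monoid_morphism : monoid_morphism RV_map.
Proof.
split=> [|y z]; apply: RV_mapE; last exact: specializesM (RV_mapP y) (RV_mapP z).
by rewrite rmorph1 -tofrac1 -(rmorph1 sub); apply: specializes_tofrac.
Qed.
HB.instance Definition _ := GRing.isMonoidMorphism.Build (RV V) L RV_map RV_map_is_monoid_morphism.

Lemma RV_map_inv v : RV_map (RV_inv v) = (f v)^-1.
Proof.
apply: RV_mapE => /=; have [->|v0] := eqVneq v 0.
  rewrite f0 /frac_in linear0 tofrac0 !invr0.
  by rewrite -tofrac0 -(rmorph0 sub); apply: specializes_tofrac.
by apply: specializesV; [apply: f_neq0|apply: frac_in_specializes].
Qed.

End RVMorphism.

Lemma invf_mul_addf (L : fieldType) (u v : L) : u != 0 -> v != 0 -> u + v != 0 ->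
  u^-1 * v^-1 = (u + v)^-1 * (u^-1 + v^-1).
Proof. by move=> u0 v0 uv0; field; rewrite uv0 v0 u0. Qed.

(** * Generators and relations of the ring in matrix coordinates *)

Section Coordinatization.
Variables (Fq : finFieldType) (r n : nat).
Local Notation W := 'M[Fq]_(r, n.+1).
Local Notation V := (Vn Fq n.+1 r).
Local Notation S := (shift_mx Fq n).
Local Notation R := (Rn Fq n.+1 r).
Local Notation act := (@Defs.act Fq n.+1 r).

Implicit Types (M N : W) (v : V).

Definition coord_mx (v : V) : W := vec_mx (Vn_coord v).

Lemma coord_mxK v : Vn_of (coord_mx v) = v.
Proof. exact: Vn_coordK. Qed.

Lemma Vn_of_mxK M : coord_mx (Vn_of M) = M.
Proof. by rewrite /coord_mx -{1}[M]mxvecK Vn_ofK mxvecK. Qed.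

Lemma coef_row_poly M j i :
  (rVpoly (row j M))`_i = if (i < n.+1)%N then M j (inord i) else 0.
Proof.
rewrite coef_rVpoly; case: insubP => [i' lt_i i'E|/negPf->] //.
by rewrite lt_i mxE -i'E inord_val.
Qed.

Lemma act_XM M : act 'X (Vn_of M) = Vn_of (M *m S).
Proof.
apply/val_inj/ffunP => j; rewrite /= !ffunE pscale_pi; apply/eqP; rewrite fpi_eq.
have X0 : polyF 'X^(n.+1) != 0 :> ratfun Fq by apply: polyFX_neq0.
rewrite mulrA -rmorphM -mulrBl -rmorphB; apply/integralP.
(* The shift drops the coefficient of t^n, which t / t^(n+1) turns into an element of A. *)
exists (M j ord_max)%:P; apply: (canLR (mulfK X0)); rewrite -rmorphM; congr polyF.
apply/polyP => i; rewrite coefB coefXM coefCM coefXn !coef_row_poly.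
have [->|i_gt0] := posnP i; first by rewrite mulmx_shiftE inordK //= subrr mulr0.
have [lt_i|] := ltnP i n.+1.
  rewrite mulmx_shiftE inordK // i_gt0 (leq_ltn_trans (leq_pred i) lt_i) subrr.
  by rewrite ltn_eqF ?mulr0.
rewrite leq_eqVlt => /predU1P[<-|lt_i]; last by rewrite gtn_eqF // mulr0 subr0 ifN //; lia.
by rewrite eqxx mulr1 subr0 leqnn; congr (M j _); apply: val_inj; rewrite /= inordK.
Qed.

Lemma actM_X a b v : act (a * b) v = act a (act b v).
Proof. by apply/val_inj/ffunP => j; rewrite /= !ffunE pscaleA. Qed.

Lemma act_expM nu M : act 'X^nu (Vn_of M) = Vn_of (M *m S ^+ nu).
Proof.
elim: nu => [|nu IHnu].
  by rewrite mulmx1; apply/val_inj/ffunP => j; rewrite /= !ffunE pscale1.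
by rewrite exprS actM_X IHnu act_XM shift_mxSr mulmxA.
Qed.

Lemma act_scale a b v : act (a *: b) v = a *: act b v.
Proof. by rewrite -mul_polyC actM_X; apply/val_inj/ffunP => j; rewrite /= !ffunE. Qed.

Lemma Vsub_mx nu M : (Vn_of M \in Vsub nu) = (M *m S ^+ nu == 0).
Proof.
apply/idP/eqP => [/Vsub_torsion|M0].
  by rewrite act_expM -(linear0 (@Vn_of Fq n.+1 r)) => /Vn_of_inj.
by apply/Vsub_torsion; rewrite act_expM M0 linear0.
Qed.

Definition gen_R (M : W) : R := qpi _ (tensor (RV_inv (Vn_of M)) 1).

Definition const_R (y : ratfun Fq) : R := qpi _ (tensor 1 y).

Lemma const_R_is_zmod_morphism : zmod_morphism const_R.
Proof.
move=> y z; rewrite /const_R -rmorphB; congr qpi; apply: (canRL (addrK _)).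
by rewrite -tensorDr subrK.
Qed.
HB.instance Definition _ := GRing.isZmodMorphism.Build (ratfun Fq) R const_R
  const_R_is_zmod_morphism.

Lemma const_R_is_monoid_morphism : monoid_morphism const_R.
Proof. by split=> // y z; rewrite /const_R -rmorphM tensorM mulr1. Qed.
HB.instance Definition _ := GRing.isMonoidMorphism.Build (ratfun Fq) R const_R
  const_R_is_monoid_morphism.

Lemma tensor_split (y : RV V) (z : ratfun Fq) : tensor y z = tensor y 1 * tensor 1 z.
Proof. by rewrite tensorM mulr1 mul1r. Qed.

Lemma ratfun_scaleE a : a *: (1 : ratfun Fq) = polyF a%:P.
Proof. by rewrite -[LHS]/(polyF a%:P * 1) mulr1. Qed.

Lemma frac_in_linear : linear (@frac_in Fq V).
Proof. by move=> a u v; rewrite /frac_in linearP tofracD /= -mul_mpolyC tofracM. Qed.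

Lemma frac_in_eq0 v : (frac_in v == 0) = (v == 0).
Proof.
by rewrite /frac_in tofrac_eq0 -(inj_eq (@sym_in_inj Fq V)) linear0.
Qed.

Lemma Vn_of_eq0 M : (Vn_of M == 0) = (M == 0).
Proof. by rewrite -(inj_eq (@Vn_of_inj Fq n.+1 r)) linear0. Qed.

Lemma gen_RZ a M : a != 0 -> gen_R (a *: M) = const_R (polyF a^-1%:P) * gen_R M.
Proof.
move=> a0; rewrite /gen_R; have -> : RV_inv (Vn_of (a *: M)) = a^-1 *: RV_inv (Vn_of M).
  apply: val_inj => /=; rewrite linearZ /=.
  have /= := frac_in_linear a (Vn_of M) 0; rewrite /frac_in linear0 tofrac0 !addr0 => ->.
  rewrite -[a *: _ in LHS]/(fracV_scale _ _) -[a^-1 *: _]/(fracV_scale _ _) /fracV_scale invfM.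
  have a'0 : FracField.tofrac (a%:MP : symV V) != 0 by rewrite tofrac_eq0 mpolyC_eq0.
  congr (_ * _); apply: (mulfI a'0).
  by rewrite mulfV // -tofracM -mpolyCM mulfV // mpolyC1 tofrac1.
by rewrite tensorZ ratfun_scaleE tensor_split rmorphM mulrC.
Qed.

Lemma gen_RM M N : M != 0 -> N != 0 -> M + N != 0 ->
  gen_R M * gen_R N = gen_R (M + N) * (gen_R M + gen_R N).
Proof.
move=> M0 N0 MN0; rewrite /gen_R -rmorphD -!rmorphM -tensorDl !tensorM !mulr1.
congr (qpi _ (tensor _ _)); apply: val_inj => /=.
have := frac_in_linear 1 (Vn_of M) (Vn_of N); rewrite !scale1r -linearD => E.
have := invf_mul_addf (negbT (etrans (frac_in_eq0 (Vn_of M)) _)) (negbT (etrans (frac_in_eq0 (Vn_of N)) _)).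
rewrite -E => -> //; rewrite ?frac_in_eq0 Vn_of_eq0 //; exact: negPf.
Qed.

Lemma sum_Vsub (A : nmodType) nu (F : V -> A) :
  \sum_(v : finvect_type V | Vsub nu v) F v = \sum_(N : W | N *m S ^+ nu == 0) F (Vn_of N).
Proof.
rewrite (reindex (@Vn_of Fq n.+1 r : W -> finvect_type V)) /=.
  by apply: eq_bigl => N; rewrite -Vsub_mx.
by exists coord_mx => v _; [apply: Vn_of_mxK|apply: coord_mxK].
Qed.

(** The defining relation for a = t, in the form that the spanning argument takes as hypothesis. *)
Lemma gen_RT M : M *m S != 0 ->
  const_R (polyF 'X) * gen_R (M *m S) = \sum_(N : W | N *m S == 0) gen_R (M - N).
Proof.
move=> M0; have : qpi (@Rn_gen Fq n.+1 r) (Rn_rel 1 1 (Vn_of M)) = 0.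
  apply/eqP; rewrite -(rmorph0 (qpi _)) qpi_eq subr0; apply: mem_ideal_gen.
  by exists 1, 1%N, (Vn_of M); split; rewrite ?oner_eq0 // Vsub_mx expr1.
rewrite /Rn_rel scale1r rmorphB => /eqP; rewrite subr_eq0 => /eqP.
rewrite act_expM expr1 tensor_split rmorphM mulrC => ->.
rewrite rmorph_sum sum_Vsub expr1.
by apply: eq_bigr => N _; rewrite /gen_R linearB.
Qed.

Let generated z : Prop := exists L : seq (ratfun Fq * seq W),
  (forall p, p \in L -> nonzero p.2) /\ z = \sum_(p <- L) const_R p.1 * prodY gen_R p.2.

Let generatedD y z : generated y -> generated z -> generated (y + z).
Proof.
move=> [L [Ln ->]] [L' [Ln' ->]]; exists (L ++ L'); split; last by rewrite big_cat.
by move=> p; rewrite mem_cat => /orP[/Ln|/Ln'].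
Qed.

Let generatedM y z : generated y -> generated z -> generated (y * z).
Proof.
move=> [L [Ln ->]] [L' [Ln' ->]].
exists [seq (p.1 * p'.1, p.2 ++ p'.2) | p <- L, p' <- L']; split.
  move=> _ /allpairsP[[p p'] [/Ln pn /Ln' p'n ->]] /=.
  by rewrite /nonzero all_cat; apply/andP.
rewrite big_allpairs_dep mulr_suml; apply: eq_bigr => p _.
rewrite mulr_sumr; apply: eq_bigr => p' _ /=.
by rewrite rmorphM /prodY big_cat mulrACA.
Qed.

Let generated_const y : generated (const_R y).
Proof.
exists [:: (y, [::])]; split; first by move=> p; rewrite inE => /eqP->.
by rewrite big_seq1 /prodY big_nil mulr1.
Qed.

Let generated_RV (y : RV V) : generated (qpi _ (tensor y 1)).
Proof.
pose P : {pred fracV V} := fun z =>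
  `[< exists2 y : RV V, val y = z & generated (qpi _ (tensor y 1)) >].
suff : val y \in P by move=> /asboolP[y' /val_inj->].
have /asboolP Ry : val y \in @RV_pred Fq V := valP y.
apply: (Ry P) => [|v v0]; last first.
  apply/asboolP; exists (RV_inv v) => //; exists [:: (1, [:: coord_mx v])]; split.
    move=> p; rewrite inE => /eqP->; rewrite /nonzero /= andbT.
    by apply: contraNneq v0 => v0; rewrite -[v]coord_mxK v0 linear0.
  by rewrite big_seq1 /prodY big_seq1 rmorph1 mul1r /gen_R coord_mxK.
split=> [|a u v /asboolP[u' <- u'g] /asboolP[v' <- v'g]|u v /asboolP[u' <- u'g] /asboolP[v' <- v'g]].
- by apply/asboolP; exists 1 => //; apply: (generated_const 1).
- apply/asboolP; exists (a *: u' + v') => //.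
  rewrite tensorDl rmorphD tensorZ tensor_split rmorphM.
  by apply: generatedD v'g; apply: generatedM u'g _; apply: generated_const.
apply/asboolP; exists (u' * v') => //.
have -> : tensor (u' * v') (1 : ratfun Fq) = tensor u' 1 * tensor v' 1 by rewrite tensorM mulr1.
by rewrite rmorphM; apply: generatedM.
Qed.

Lemma gen_R_generate z : exists L : seq (ratfun Fq * seq W),
  (forall p, p \in L -> nonzero p.2) /\ z = \sum_(p <- L) const_R p.1 * prodY gen_R p.2.
Proof.
rewrite -[z]qpiK -[generic_quotient.repr z]tpiK tpiE rmorph_sum.
apply: (big_ind generated) => [||p _]; first by exists [::]; rewrite big_nil.
  exact: generatedD.
by rewrite tensor_split rmorphM; apply: generatedM (generated_RV _) (generated_const _).
Qed.

End Coordinatization.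

Section Evaluation.
Variables (Fq : finFieldType) (r n : nat) (k : fieldType).
Local Notation q := #|Fq|.
Local Notation W := 'M[Fq]_(r, n.+1).
Local Notation V := (Vn Fq n.+1 r).
Local Notation S := (shift_mx Fq n).
Local Notation R := (Rn Fq n.+1 r).
Variables (c : {rmorphism Fq -> k}) (x : {additive 'rV[Fq]_r -> k}) (d : nat -> k).
Hypothesis xZ : forall a u, x (a *: u) = c a * x u.
Hypothesis x_eq0 : forall u, (x u == 0) = (u == 0).
Hypothesis d0 : d 0 = 1.
Hypothesis dr : d r != 0.
Hypothesis d_root : forall u, \sum_(l < r.+1) d l * x u ^+ (q ^ l) = 0.
Hypothesis x_p_indep : forall D : {ffun 'I_r -> 'I_((q ^ r) ^ n)} -> k,
  \sum_a D a ^+ ((q ^ r) ^ n) * \prod_i x (delta_mx 0 i) ^+ a i = 0 -> forall a, D a = 0.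
Hypothesis x_indep : forall K (f : res_monom Fq r K -> Fq),
  (forall m, ~~ res_good m -> f m = 0) ->
  \sum_m c (f m) * \prod_i (if m i is Some (u, a) then (x u)^-1 ^+ a.+1 else 1) = 0 ->
  forall m, f m = 0.
Variables (Om : fieldType) (J : {rmorphism {poly k} -> Om}).
Hypothesis J_inj : injective J.
Variable e : 'I_r -> Om.
Hypothesis eP : forall j, iter n (phi Fq r d J) (e j) = J (x (delta_mx 0 j))%:P.

Local Notation hate := (hat c d J e).

Let polyO : {rmorphism {poly Fq} -> Om} := J \o map_poly c.

Let polyO_inj : injective polyO.
Proof. by move=> p p' /J_inj/map_poly_inj. Qed.

Let iota : {rmorphism ratfun Fq -> Om} := frac_ext polyO_inj.

Let iotaE p : iota (polyF p) = J (map_poly c p).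
Proof. exact: frac_ext_tofrac. Qed.

Let hatV (v : V) : Om := hate (coord_mx v).

Let hatVP a u v : hatV (a *: u + v) = const_O c J a * hatV u + hatV v.
Proof.
by rewrite /hatV -hatZD -{1}[u]coord_mxK -{1}[v]coord_mxK -linearP Vn_of_mxK.
Qed.

Let hatV_neq0 v : v != 0 -> hatV v != 0.
Proof.
rewrite /hatV (hat_eq0 xZ x_eq0 d_root J_inj eP); apply: contraNneq => v0.
by rewrite -[v]coord_mxK v0 linear0.
Qed.

Let iotaZ a y : iota (a *: y) = const_O c J a * iota y.
Proof.
rewrite -[a *: y]/(polyF a%:P * y) rmorphM iotaE; congr (_ * _).
exact: (congr1 J (map_polyC c a)).
Qed.

Lemma evaluation : exists ev : {rmorphism R -> Om},
  (forall M, ev (gen_R M) = (hate M)^-1) /\ (forall y, ev (const_R r n y) = iota y).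
Proof.
have [h hE'] := tens_rmorphism (RV_mapZ hatVP hatV_neq0) iotaZ.
have hE y z : h (tensor y z) = RV_map hatVP hatV_neq0 y * iota z := hE' y z.
(* For a = al t^nu the scalar al cancels between 1/(a v) and a, and [sum_inv_hat] gives the rest. *)
have rel0 y : @Rn_gen Fq n.+1 r y -> h y = 0.
  move=> [al [nu [v [al0 le_nu vN ->]]]]; rewrite -[v]coord_mxK in vN *.
  move: (coord_mx v) vN => M; rewrite Vsub_mx => M0.
  rewrite /Rn_rel act_scale act_expM rmorphB rmorph_sum sum_Vsub hE RV_map_inv.
  rewrite iotaE map_polyZ map_polyXn -mul_polyC rmorphM rmorphXn -linearZ /hatV Vn_of_mxK.
  rewrite hatZ invfM mulrACA mulVf ?fmorph_eq0 // mul1r mulrC.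
  rewrite -(sum_inv_hat xZ x_eq0 d0 dr d_root J_inj eP le_nu M0).
  apply/eqP; rewrite subr_eq0; apply/eqP/eq_bigr => N _.
  by rewrite hE rmorph1 mulr1 RV_map_inv -linearB /hatV Vn_of_mxK raddfB.
have [ev evE] := qring_rmorphism rel0; exists ev; split=> [M|y]; rewrite evE hE rmorph1.
  by rewrite mulr1 RV_map_inv /hatV Vn_of_mxK.
by rewrite mul1r.
Qed.

(** An element of the kernel is a combination of good monomials, whose images are independent. The
    bound [K] on the lengths of its products puts them all in one finite family. *)
Lemma evaluation_inj (ev : {rmorphism R -> Om}) : (forall M, ev (gen_R M) = (hate M)^-1) ->
  (forall y, ev (const_R r n y) = iota y) -> injective ev.
Proof.
move=> ev_gen ev_const; apply: (raddf_inj (f := ev)) => z.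
have [L [Ln ->]] := gen_R_generate z; pose K := \max_(p <- L) size p.2.
have [dd [dd0 ->]] : good_span (const_R r n) (@gen_R Fq r n) K
    (\sum_(p <- L) const_R r n p.1 * prodY (@gen_R Fq r n) p.2).
  rewrite big_seq; apply: good_span_sum => p pL; apply: good_spanZ.
  apply: (prodY_good_span (@gen_RZ Fq r n) (@gen_RM Fq r n) (@gen_RT Fq r n)) => //; last exact: Ln.
  exact: (leq_bigmax_seq (F := fun p : ratfun Fq * seq 'M[Fq]_(r, n.+1) => size p.2)).
move=> ev0; rewrite big1 // => m _.
rewrite (monom_value_independent xZ x_eq0 d0 dr d_root x_p_indep x_indep J_inj iotaE eP dd0).
  by rewrite rmorph0 mul0r.
rewrite -[RHS]ev0 raddf_sum; apply: eq_bigr => m' _ /=.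
rewrite (rmorphM ev) ev_const (rmorph_prod ev); congr (_ * _); apply: eq_bigr => i _.
by case: (m' i) => [[M a]|] /=; rewrite ?rmorph1 // rmorphXn ev_gen.
Qed.

Lemma exists_embedding : exists ev : {rmorphism R -> Om}, injective ev /\
  forall v : V, v != 0 -> ev (qpi _ (tensor (RV_inv v) 1)) != 0.
Proof.
have [ev [ev_gen ev_const]] := evaluation; exists ev; split; first exact: evaluation_inj.
move=> v v0; rewrite -[v]coord_mxK; have := ev_gen (coord_mx v); rewrite /gen_R => ->.
by rewrite invr_eq0; apply: hatV_neq0.
Qed.

End Evaluation.

(** * Embedding in a field and conclusion *)

Lemma Rn_embedding (Fq : finFieldType) (r n : nat) :
  exists (Om : fieldType) (ev : {rmorphism Rn Fq n.+1 r -> Om}), injective ev /\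
    forall v : Vn Fq n.+1 r, v != 0 -> ev (qpi _ (tensor (RV_inv v) 1)) != 0.
Proof.
have [d [d0 dr d_root]] := lattice_poly Fq r.
have kC : coded {fraction {mpoly Fq[r]}} by apply/coded_fraction/coded_mpoly.
have [Om [J [e [J_inj eP]]]] :=
  exists_torsion_point Fq n (fun i => hat_k (delta_mx 0 i : 'rV[Fq]_r)) kC dr.
exists Om; apply: (exists_embedding (c := const_k r) (@hat_kZ Fq r) (@hat_k_eq0 Fq r) d0 dr d_root
  _ (@res_value_independent Fq r) J_inj eP).
rewrite -expnM => D D0; apply: var_k_p_independent.
by rewrite -[RHS]D0; apply: eq_bigr => a _; congr (_ * _); apply: eq_bigr => i _ /=; rewrite hat_k_delta.
Qed.

Theorem theorem3p3p2 (Fq : finFieldType) (n r : nat)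
    (n_ge1 : (1 <= n)%N) (r_ge1 : (1 <= r)%N) :
  ((1 : Rn Fq n r) != 0 /\ GRing.integral_domain_axiom (Rn Fq n r)) /\
  injective (@Rn_to_RSn Fq n r).
Proof.
case: n n_ge1 => // n _; have [Om [ev [ev_inj ev_neq0]]] := Rn_embedding Fq r n.
have ev_eq0 z : (ev z == 0) = (z == 0) by rewrite -(inj_eq ev_inj) (rmorph0 ev).
have domain (y z : Rn Fq n.+1 r) : y * z = 0 -> (y == 0) || (z == 0).
  by move=> yz; rewrite -!ev_eq0 -mulf_eq0 -rmorphM yz rmorph0.
split; first by split=> //; rewrite -ev_eq0 rmorph1 oner_eq0.
(* An element that dies in the localization is annihilated by a product of 1/v, and such a product
   is nonzero in [Om]. *)
apply: (raddf_inj (f := @to_loc _ (@RSn_gen Fq n.+1 r))) => z /to_loc_eq0[u /asboolP[s sG ->] uz].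
have /orP[|/eqP//] := domain _ _ uz; rewrite -ev_eq0 rmorph_prod big_seq prodf_seq_eq0.
by case/hasP => y ys /andP[/sG[v v0 ->]]; rewrite (negPf (ev_neq0 v v0)).
Qed.
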